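(* Let $X$ be a super-reflexive sequence space and let $\Omega:X\to\omega$ be a centralizer on $X$. Let $Y=X\oplus_\Omega X$ and let $X_0=\{(0,y):y\in X\}\subset Y$. Then the following are equivalent: (1) $Y$ is isomorphic to $X\oplus X$. (2) $Y$ has local unconditional structure. (3) $Y$ has an unconditional basis. (4) The subspace $X_0$ is complemented in $Y$. (5) There exist $b\in\omega$ and $C>0$ so that $\|\Omega(x)-bx\|_X\le C\|x\|_X$ for all $x\in X$ (where $bx$ is the pointwise product).
   Context: $\omega$ denotes the space of all sequences. A (Köthe) sequence space $X$ is a Banach space of sequences in which the canonical basis vectors $(e_n)$ form a 1-unconditional basis. Products of sequences are pointwise. A centralizer on $X$ is a map $\Omega:X\to\omega$ such that for a suitable constant $\Delta$: (i) $\Omega(\alpha x)=\alpha\Omega(x)$ for $\alpha\in\mathbb{R}$, $x\in X$; (ii) for all $x\in X$ and $u\in\ell_\infty$, $\Omega(ux)-u\Omega(x)\in X$ and $\|\Omega(ux)-u\Omega(x)\|_X\le\Delta\|u\|_\infty\|x\|_X$. The twisted sum $X\oplus_\Omega X$ is the space of all pairs $(x,y)\in\omega\times\omega$ such that $x\in X$, $y-\Omega(x)\in X$, with $\|(x,y)\|_\Omega=\|x\|_X+\|y-\Omega(x)\|_X<\infty$. This is a quasinorm which, since $X$ is super-reflexive, is equivalent to a norm, so $Y$ is regarded as a Banach space. The subspace $X_0$ is closed in $Y$ and isomorphic to $X$. A Banach space $Y$ has (Gordon–Lewis) local unconditional structure if there is a constant $C$ so that whenever $E$ is a finite-dimensional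 subspace of $Y$ there are a finite-dimensional Banach lattice $L$ and operators $A:E\to L$, $B:L\to Y$ with $\|A\|\|B\|\le C$ and $BA=I_E$. *)

(* Defs.v *)
From mathcomp Require Import all_boot all_order all_algebra.
From mathcomp Require Import all_classical all_reals all_analysis.

Set Implicit Arguments.
Unset Strict Implicit.
Unset Printing Implicit Defensive.

Import Order.TTheory GRing.Theory Num.Theory.
Import numFieldNormedType.Exports.
Local Open Scope classical_set_scope.
Local Open Scope ring_scope.

(* A set of vectors of an ambient space V together with a size function, of
   which only the values on the carrier matter. No axiom is imposed here: the
   same operator-theoretic notions are needed for Banach spaces and for twisted
   sums, whose natural size function is only a quasinorm. All the notions below
   that are applied to a twisted sum are invariant under passing to an
   equivalent norm or quasinorm. *)
Record nspace (R : realType) (V : lmodType R) := NSpace {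
  carrier :> V -> Prop ;
  nm : V -> R }.

Definition full_space (R : realType) (V : lmodType R) (N : V -> R) : nspace V :=
  NSpace setT N.

Definition banach_nspace (R : realType) (Z : completeNormedModType R) :
  nspace Z := full_space (fun z : Z => `|z|).

Record is_normed (R : realType) (V : lmodType R) (E : nspace V) : Prop := {
  normed_carrier0 : E 0 ;
  normed_carrier_lin : forall (a : R) x y, E x -> E y -> E (a *: x + y) ;
  normed_triangle : forall x y, E x -> E y -> nm E (x + y) <= nm E x + nm E y ;
  normed_scale : forall (a : R) x, E x -> nm E (a *: x) = `|a| * nm E x ;
  normed_eq0 : forall x, E x -> nm E x = 0 -> x = 0 }.

Definition is_complete (R : realType) (V : lmodType R) (E : nspace V) : Prop :=
  forall v : nat -> V, (forall n, E (v n)) ->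
    (forall eps : R, 0 < eps -> exists n0 : nat, forall m n : nat,
      (n0 <= m)%N -> (n0 <= n)%N -> nm E (v m - v n) < eps) ->
  exists2 x, E x & (fun n => nm E (v n - x)) @ \oo --> (0 : R).

Definition linear_on (R : realType) (V W : lmodType R) (S : set V)
    (T : V -> W) : Prop :=
  forall (a : R) x y, S x -> S y -> T (a *: x + y) = a *: T x + T y.

(* T restricts to an operator from E to F of norm at most c; the values of T
   outside E are irrelevant. *)
Definition operator_le (R : realType) (V W : lmodType R) (c : R)
    (E : nspace V) (F : nspace W) (T : V -> W) : Prop :=
  [/\ 0 <= c, linear_on E T &
      forall x, E x -> F (T x) /\ nm F (T x) <= c * nm E x].

Definition bounded_operator (R : realType) (V W : lmodType R)
    (E : nspace V) (F : nspace W) (T : V -> W) : Prop :=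
  exists c : R, operator_le c E F T.

Definition isomorphic (R : realType) (V W : lmodType R)
    (E : nspace V) (F : nspace W) : Prop :=
  exists (T : V -> W) (T' : W -> V),
    [/\ bounded_operator E F T, bounded_operator F E T',
        forall x, E x -> T' (T x) = x & forall y, F y -> T (T' y) = y].

Definition complemented (R : realType) (V : lmodType R)
    (E : nspace V) (S : set V) : Prop :=
  exists P : V -> V,
    [/\ bounded_operator E E P, forall x, E x -> P (P x) = P x & P @` carrier E = S].

Definition direct_sum (R : realType) (V W : lmodType R)
    (E : nspace V) (F : nspace W) : nspace (V * W)%type :=
  NSpace (carrier E `*` carrier F) (fun p => nm E p.1 + nm F p.2).

Definition finite_dim (R : realType) (V : lmodType R) (S : set V) : Prop :=
  exists (n : nat) (v : 'I_n -> V),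
    S = [set x | exists a : 'I_n -> R, x = \sum_(i < n) a i *: v i].

Definition subspace (R : realType) (V : lmodType R) (S : set V)
    (E : nspace V) : nspace V := NSpace S (nm E).

Definition expansion (R : realType) (V : lmodType R) (E : nspace V)
    (b : nat -> V) (x : V) (a : nat -> R) : Prop :=
  (fun n : nat => nm E (\sum_(k < n) a k *: b k - x)) @ \oo --> (0 : R).

Definition schauder_basis (R : realType) (V : lmodType R) (E : nspace V)
    (b : nat -> V) : Prop :=
  (forall n, E (b n)) /\
  (forall x, E x -> exists! a : nat -> R, expansion E b x a).

Definition unconditional_basis (R : realType) (V : lmodType R) (E : nspace V)
    (b : nat -> V) : Prop :=
  schauder_basis E b /\
  (forall x a, E x -> expansion E b x a ->
   forall s : nat -> nat, bijective s -> expansion E (b \o s) x (a \o s)).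

Definition K_unconditional_basis (R : realType) (V : lmodType R) (K : R)
    (E : nspace V) (b : nat -> V) : Prop :=
  unconditional_basis E b /\
  (forall (n : nat) (a : nat -> R) (s : nat -> bool),
    nm E (\sum_(k < n) ((-1) ^+ s k * a k) *: b k)
      <= K * nm E (\sum_(k < n) a k *: b k)).

Definition has_unconditional_basis (R : realType) (V : lmodType R)
    (E : nspace V) : Prop :=
  exists b : nat -> V, unconditional_basis E b.

(* Meets, [- join (- x) (- y)], come for free; so does completeness of the norm
   when L is finite-dimensional, the only case used. *)
Record is_banach_lattice (R : realType) (L : vectType R)
    (le : L -> L -> Prop) (join : L -> L -> L) (N : L -> R) : Prop := {
  lattice_refl : forall x, le x x ;
  lattice_anti : forall x y, le x y -> le y x -> x = y ;
  lattice_trans : forall x y z, le x y -> le y z -> le x z ;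
  lattice_add : forall x y z, le x y -> le (x + z) (y + z) ;
  lattice_scale : forall (a : R) x, 0 <= a -> le 0 x -> le 0 (a *: x) ;
  lattice_joinl : forall x y, le x (join x y) ;
  lattice_joinr : forall x y, le y (join x y) ;
  lattice_join_least : forall x y z, le x z -> le y z -> le (join x y) z ;
  lattice_normed : is_normed (full_space N) ;
  lattice_norm : forall x y,
    le (join x (- x)) (join y (- y)) -> N x <= N y }.

Definition local_unconditional_structure (R : realType) (V : lmodType R)
    (Y : nspace V) : Prop :=
  exists C : R, forall E : set V, E `<=` carrier Y -> finite_dim E ->
    exists (L : vectType R) (le : L -> L -> Prop) (join : L -> L -> L)
           (N : L -> R),
      is_banach_lattice le join N /\
      exists (A : V -> L) (B : L -> V) (cA cB : R),
        [/\ operator_le cA (subspace E Y) (full_space N) A,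
            operator_le cB (full_space N) Y B,
            cA * cB <= C &
            forall x, E x -> B (A x) = x].

Definition dual (R : realType) (Z : completeNormedModType R) :
    nspace (Z -> R : lmodType R) :=
  NSpace
    [set f : Z -> R | bounded_operator (banach_nspace Z) (banach_nspace R) f]
    (fun f : Z -> R => sup [set `|f z| | z in [set z : Z | `|z| <= 1]]).

(* The canonical embedding of Z into its bidual is onto. *)
Definition reflexive_space (R : realType) (Z : completeNormedModType R) : Prop :=
  forall phi : (Z -> R) -> R,
    bounded_operator (dual Z) (banach_nspace R) phi ->
    exists z : Z, forall f, dual Z f -> phi f = f z.

Definition finitely_representable (R : realType)
    (Z : completeNormedModType R) (V : lmodType R) (X : nspace V) : Prop :=
  forall E : set Z, finite_dim E -> forall eps : R, 0 < eps ->
    exists T : Z -> V, linear_on E T /\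
      forall z, E z ->
        X (T z) /\ `|z| <= nm X (T z) <= (1 + eps) * `|z|.

Definition super_reflexive (R : realType) (V : lmodType R)
    (X : nspace V) : Prop :=
  forall Z : completeNormedModType R,
    finitely_representable Z X -> reflexive_space Z.

Definition e_ (R : realType) (n : nat) : nat -> R := fun k => (k == n)%:R.

(* The last field says that the coefficients of x in the basis (e_n) are its
   entries as a sequence, i.e. that the coordinate functionals of X as a space
   of sequences are the biorthogonal functionals of the basis. *)
Record sequence_space (R : realType) (X : nspace (nat -> R : lmodType R)) :
    Prop := {
  seqsp_normed : is_normed X ;
  seqsp_complete : is_complete X ;
  seqsp_basis : K_unconditional_basis 1 X (@e_ R) ;
  seqsp_coord : forall x, X x -> expansion X (@e_ R) x x }.

Definition l_infty (R : realType) : set (nat -> R) :=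
  [set u | exists M : R, forall n, `|u n| <= M].

Definition norm_infty (R : realType) (u : nat -> R) : R :=
  sup (range (fun n => `|u n|)).

Definition centralizer (R : realType) (X : nspace (nat -> R : lmodType R))
    (Omega : (nat -> R) -> (nat -> R)) : Prop :=
  exists Delta : R,
    (forall (a : R) x, X x -> Omega (a *: x) = a *: Omega x) /\
    (forall x u, X x -> l_infty u ->
      X (Omega (u \* x) - u \* Omega x) /\
      nm X (Omega (u \* x) - u \* Omega x) <= Delta * norm_infty u * nm X x).

Definition twisted_sum (R : realType) (X : nspace (nat -> R : lmodType R))
    (Omega : (nat -> R) -> (nat -> R)) :
    nspace ((nat -> R) * (nat -> R) : lmodType R)%type :=
  NSpace [set p | X p.1 /\ X (p.2 - Omega p.1)]
         (fun p => nm X p.1 + nm X (p.2 - Omega p.1)).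

(* Main.v *)
Require Import Defs.
From HB Require Import structures.
From mathcomp Require Import all_boot all_order all_algebra.
From mathcomp Require Import all_classical all_reals all_analysis.
From mathcomp Require Import complex.
From mathcomp Require Import ring lra zify.

(** If [Omega] is the multiplication by b up to a bounded map, the shear
    (x, y) |-> (x, y - b x) is an isomorphism of Y onto X (+) X, and
    (x, y) |-> (0, y - b x) is a bounded projection of Y onto the fiber, the
    subspace of the pairs (0, y). The direct sum X (+) X has the interleaved unit vectors as an
    unconditional basis, and local unconditional structure because its
    finite-dimensional subspaces are nearly contained in spans of finitely many
    unit vectors, which are lattices. Three implications lead back to
    such a b.

    From a projection onto the fiber: its average over all changes of signs of
    coordinates is again bounded and is diagonal, that is, of the form
    (x, y) |-> (0, y - b x); evaluated on the graph of [Omega] it bounds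
    [Omega] - b ([bounded_of_complemented]).

    From local unconditional structure or an unconditional basis, both are
    reduced to one statement, [uniform_unconditional_sums]: the identity on the
    first N coordinates of Y is a sum of rank one operators which remain
    uniformly bounded when multiplied by coefficients in [-1, 1]. For local
    unconditional structure these operators come from the atoms of a
    finite-dimensional lattice ([finite_lattice_coordinates]); for an
    unconditional basis they are those of the expansion, uniformly bounded by
    Baire's theorem applied to the norm that makes all projections onto finite
    sets of basis vectors contractive
    ([unconditional_projections]).

    Such a sum can be made block diagonal. A centralizer commutes with bounded
    multipliers up to bounded terms, so sign changes of coordinates act on Y.
    Riesz products then yield not only the averages of the rank one operators
    over sign changes, which keep the 2 x 2 diagonal blocks (one for each
    coordinate of X), but allow the coefficients in [-1, 1] to be chosen
    independently for every coordinate ([block_operator_bounded]). The argument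
    averages vectors of Y, hence needs Y to be convex up to a constant although
    it is only quasi-normed. This is where super-reflexivity enters: X does not
    contain l1 finitely, so sums of 2^n unit vectors can be signed to be
    exponentially shorter than 2^n; the quasi-linearity of [Omega] costs a factor
    of order n only, so Y inherits the property, and a sum is a signed sum plus
    twice a sum with half as many terms ([tw_convex], [signed_small_convex]).

    The blocks [[p, q], [r, s]] have rank one, p s = q r, and after subtraction
    of the multiplier given by the diagonal of [Omega] one may assume that
    [Omega] is bounded on the unit vectors. Where the q's are not small, a
    combination of the blocks maps (x, Omega x) to a vector whose first component
    is bounded by x and contains Omega x with a large coefficient. Where they are
    small, p and s are almost disjoint, and a combination of the blocks is
    bounded on Y with diagonal entries that differ by at least 1/2. It nearly
    preserves the graph of [Omega], which makes V = q Omega an almost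
    multiplicative map with V V close to - m V, m at least 1/2; an argument on
    minimal supports shows that V is small, and this forces [Omega] to be bounded
    on these coordinates ([rank_one_rigidity]). *)

Set Implicit Arguments.
Unset Strict Implicit.
Unset Printing Implicit Defensive.

Import Order.TTheory GRing.Theory Num.Theory.
Import numFieldNormedType.Exports.
Local Open Scope classical_set_scope.
Local Open Scope ring_scope.

(** * Quasi-norms *)

(** The constant Q of the triangle inequality is kept as a parameter: rates of
    decay have to beat it. *)
Record quasi_normed (R : realType) (V : lmodType R) (Q : R) (E : nspace V) :
    Prop := {
  qn_ge1 : 1 <= Q ;
  qn_0 : E 0 ;
  qn_lin : forall (a : R) x y, E x -> E y -> E (a *: x + y) ;
  qn_triangle : forall x y, E x -> E y -> nm E (x + y) <= Q * (nm E x + nm E y) ;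
  qn_scale : forall (a : R) x, E x -> nm E (a *: x) = `|a| * nm E x ;
  qn_eq0 : forall x, E x -> nm E x = 0 -> x = 0 }.

Section QuasiNormed.
Context {R : realType} {V : lmodType R} {Q : R} {E : nspace V}.
Hypothesis qE : quasi_normed Q E.

Lemma qnD x y : E x -> E y -> E (x + y).
Proof. by move=> Ex Ey; rewrite -[x]scale1r; apply: qn_lin qE _ _ _ _ _. Qed.

Lemma qnZ a x : E x -> E (a *: x).
Proof.
by move=> Ex; rewrite -[_ *: _]addr0; apply: qn_lin qE _ _ _ _ (qn_0 qE).
Qed.

Lemma qnN x : E x -> E (- x).
Proof. by rewrite -scaleN1r; apply: qnZ. Qed.

Lemma qnB x y : E x -> E y -> E (x - y).
Proof. by move=> Ex Ey; apply: qnD => //; apply: qnN. Qed.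

Lemma qn_sum (I : Type) (r : seq I) (P : pred I) (F : I -> V) :
  (forall i, P i -> E (F i)) -> E (\sum_(i <- r | P i) F i).
Proof.
by move=> EF; apply: big_ind => //; [exact: (qn_0 qE) | exact: qnD].
Qed.

Lemma qn_nm0 : nm E 0 = 0.
Proof. by rewrite -(scale0r 0) (qn_scale qE _ (qn_0 qE)) normr0 mul0r. Qed.

Lemma qn_nmN x : E x -> nm E (- x) = nm E x.
Proof. by move=> Ex; rewrite -scaleN1r (qn_scale qE _ Ex) normrN1 mul1r. Qed.

Lemma qn_Q0 : 0 < Q.
Proof. exact: lt_le_trans ltr01 (qn_ge1 qE). Qed.

Lemma qn_ge0 x : E x -> 0 <= nm E x.
Proof.
move=> Ex; have := qn_triangle qE Ex (qnN Ex).
rewrite subrr qn_nm0 qn_nmN // pmulr_rge0 ?qn_Q0 //; lra.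
Qed.

Lemma qn_nmB x y : E x -> E y -> nm E (x - y) <= Q * (nm E x + nm E y).
Proof. by move=> Ex Ey; rewrite -(qn_nmN Ey); apply: qn_triangle qE _ _ Ex (qnN Ey). Qed.

Lemma qn_distC x y : E x -> E y -> nm E (x - y) = nm E (y - x).
Proof. by move=> Ex Ey; rewrite -qn_nmN ?opprB //; apply: qnB. Qed.

Lemma qn_sign (b : bool) x : E x -> E ((-1) ^+ b *: x) /\
  nm E ((-1) ^+ b *: x) = nm E x.
Proof.
move=> Ex; split; first exact: qnZ.
by rewrite (qn_scale qE _ Ex) normrX normrN1 expr1n mul1r.
Qed.

(** A crude bound, useful only because it depends on the number of terms and
    on nothing else. *)
Lemma qn_sum_crude n (v : nat -> V) t :
  (forall i, (i < n)%N -> E (v i) /\ nm E (v i) <= t) -> 0 <= t ->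
  nm E (\sum_(i < n) v i) <= (2 * Q) ^+ n * t.
Proof.
move=> vt t0; elim: n vt => [_|n IH vt].
  by rewrite big_ord0 qn_nm0 expr0 mul1r.
have {}IH : nm E (\sum_(i < n) v i) <= (2 * Q) ^+ n * t.
  by apply: IH => i /ltnW; exact: vt.
have [En tn] := vt n (ltnSn n).
rewrite big_ord_recr /=; apply: le_trans (qn_triangle qE _ En) _.
  by apply: qn_sum => i _; apply: (vt i (ltnW _)).1; rewrite ltnS.
have Q1 := qn_ge1 qE.
have : t <= (2 * Q) ^+ n * t.
  by rewrite ler_peMl // exprn_ege1 //; move: Q1; lra.
move=> h; have -> : (2 * Q) ^+ n.+1 * t = Q * ((2 * Q) ^+ n * t + (2 * Q) ^+ n * t).
  by rewrite exprS; ring.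
by rewrite ler_pM2l ?qn_Q0 // lerD // (le_trans tn).
Qed.

Lemma qn_sum_dyadic_crude j (v : nat -> V) t :
  (forall i, E (v i) /\ nm E (v i) <= t) -> 0 <= t ->
  nm E (\sum_(i < 2 ^ j) v i) <= (2 * Q) ^+ j * t.
Proof.
move=> vt t0; elim: j v vt => [|j IH] v vt.
  by rewrite big_ord1 expr0 mul1r; case: (vt 0%N).
rewrite expnS mul2n -addnn big_split_ord /=.
have Ev i : E (v i) by case: (vt i).
have E1 : E (\sum_(i < 2 ^ j) v i) by apply: qn_sum.
have E2 : E (\sum_(i < 2 ^ j) v (2 ^ j + i)%N) by apply: qn_sum.
apply: le_trans (qn_triangle qE E1 E2) _ => //.
have h1 := IH v vt.
have h2 := IH (fun i => v (2 ^ j + i)%N) (fun i => vt _).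
have Q1 := qn_ge1 qE.
have -> : (2 * Q) ^+ j.+1 * t = Q * ((2 * Q) ^+ j * t + (2 * Q) ^+ j * t).
  by rewrite exprS; ring.
by rewrite ler_pM2l ?qn_Q0 // lerD.
Qed.

(** In a quasi-normed space a series converges absolutely as soon as its terms
    decay geometrically fast compared with the quasi-norm constant; it suffices
    that the decay shows every [J] terms. *)
Lemma qn_sum_geometric J (k : R) : (0 < J)%N -> 0 <= k -> 2 * Q * k <= 1 ->
  exists2 K, 1 <= K & forall n t (v : nat -> V), 0 <= t ->
    (forall l, (l < n)%N -> E (v l) /\ nm E (v l) <= t * k ^+ (l %/ J)) ->
    nm E (\sum_(l < n) v l) <= K * t.
Proof.
move=> J0 k0 Qk; have Q1 := qn_ge1 qE.
have k1 : k <= 1 by nra.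
set K1 := (2 * Q) ^+ J.
have K11 : 1 <= K1 by rewrite exprn_ege1 //; lra.
exists (2 * Q * K1); first by rewrite mulr_ege1 //; lra.
move=> n; have [m] := ubnP n; elim: m n => // m IH n nm' t v t0 vt.
have vt' l : (l < n)%N -> E (v l) /\ nm E (v l) <= t.
  move=> /vt[El tl]; split=> //; apply: le_trans tl _.
  by rewrite ler_piMr // exprn_ile1.
have [nJ|Jn] := leqP n J.
  apply: le_trans (qn_sum_crude vt' t0) _.
  rewrite ler_wpM2r //; apply: (@le_trans _ _ K1).
    by apply: ler_weXn2l => //; lra.
  rewrite ler_peMl //; lra.
rewrite -(subnKC (ltnW Jn)) big_split_ord /=.
apply: le_trans (qn_triangle qE _ _) _.
- by apply: qn_sum => i _; apply: (vt' _ _).1; apply: ltn_trans Jn.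
- by apply: qn_sum => i _; apply: (vt' _ _).1; case: i => i /=; rewrite ltn_subRL.
have h1 : nm E (\sum_(i < J) v i) <= K1 * t.
  by apply: qn_sum_crude => // i iJ; apply: vt'; apply: ltn_trans Jn.
have h2 : nm E (\sum_(i < n - J) v (J + i)%N) <= 2 * Q * K1 * (t * k).
  apply: (IH (n - J)%N _ (t * k) (fun i => v (J + i)%N)).
  - by move: nm' Jn J0; lia.
  - exact: mulr_ge0.
  - move=> l ln; have [] := vt (J + l)%N; first by rewrite -ltn_subRL.
    by move=> El tl; split=> //; apply: le_trans tl _; rewrite divnDl // divnn J0 exprS mulrA.
have -> : 2 * Q * K1 * t = Q * (K1 * t + K1 * t) by ring.
rewrite ler_pM2l ?qn_Q0 // lerD //; apply: le_trans h2 _.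
have -> : 2 * Q * K1 * (t * k) = (2 * Q * k) * (K1 * t) by ring.
by rewrite ler_piMl // mulr_ge0 // (le_trans ler01).
Qed.

End QuasiNormed.

Lemma normed_quasi (R : realType) (V : lmodType R) (E : nspace V) :
  is_normed E -> quasi_normed 1 E.
Proof.
case=> e0 el et es ez; split=> // x y Ex Ey; rewrite mul1r; exact: et.
Qed.

(** * Signed sums and convexity *)

(** For c = r n with r < 1 this is the condition of B-convexity. *)
Definition signed_small (R : realType) (V : lmodType R) (E : nspace V)
    (n : nat) (c : R) : Prop :=
  forall x : nat -> V, (forall i, E (x i) /\ nm E (x i) <= 1) ->
  exists e : nat -> bool, nm E (\sum_(i < n) (-1) ^+ e i *: x i) <= c.

(** The triangle inequality for averages, up to the constant K: what is left of
    the existence of an equivalent norm. *)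
Definition dyadic_convex (R : realType) (V : lmodType R) (E : nspace V)
    (K : R) : Prop :=
  forall j (x : nat -> V), (forall i, E (x i) /\ nm E (x i) <= 1) ->
  nm E (\sum_(i < 2 ^ j) x i) <= K * 2 ^+ j.

Lemma sum_ord_mul (V : nmodType) m n (F : nat -> V) :
  \sum_(i < n * m) F i = \sum_(g < n) \sum_(l < m) F (g * m + l)%N.
Proof.
elim: n => [|n IH]; first by rewrite !big_ord0.
rewrite mulSn addnC big_split_ord /= IH big_ord_recr /=; congr (_ + _).
Qed.

Lemma sum_filter_nth (V : nmodType) n (a : pred nat) (F : nat -> V) m :
  (size (seq.filter a (iota 0 n)) <= m)%N ->
  \sum_(i < n | a i) F i =
  \sum_(i < m) nth 0 (map F (seq.filter a (iota 0 n))) i.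
Proof.
move=> sm; rewrite -(big_mkord a F) /index_iota subn0 -big_filter -(big_map F xpredT id).
rewrite (big_nth 0) size_map big_mkord.
rewrite (big_ord_widen m (fun i => nth 0 (map F (seq.filter a (iota 0 n))) i)) //.
rewrite big_mkcond; apply: eq_bigr => i _.
by case: ltnP => // h; rewrite nth_default // size_map.
Qed.

Section Convexity.
Context {R : realType} {V : lmodType R} {Q : R} {E : nspace V}.
Hypothesis qE : quasi_normed Q E.

Lemma signed_small_scale n c : signed_small E n c ->
  forall t (x : nat -> V), 0 < t -> (forall i, E (x i) /\ nm E (x i) <= t) ->
  exists e : nat -> bool, nm E (\sum_(i < n) (-1) ^+ e i *: x i) <= c * t.
Proof.
move=> H t x t0 xt.
have [|e He] := H (fun i => t^-1 *: x i).
  move=> i; have [Ei ti] := xt i; split; first exact: (qnZ qE).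
  by rewrite (qn_scale qE) // ger0_norm ?invr_ge0 ?(ltW t0) // ler_pdivrMl // mulr1.
exists e; rewrite -ler_pdivrMr // mulrC.
apply: le_trans He; rewrite -[X in X * _]ger0_norm ?invr_ge0 ?(ltW t0) //.
rewrite -(qn_scale qE); last first.
  by apply: (qn_sum qE) => i _; apply: (qnZ qE); case: (xt i).
rewrite scaler_sumr le_eqVlt; apply/orP; left; apply/eqP; congr (nm E _).
by apply: eq_bigr => i _; rewrite !scalerA mulrC.
Qed.

(** Choose signs inside each of [n] groups of [m] vectors, then signs for the
    [n] signed sums so obtained. *)
Lemma signed_small_mul m n c d : 0 < c ->
  signed_small E m c -> signed_small E n d -> signed_small E (n * m) (d * c).
Proof.
move=> c0 Hm Hn x xE.
have /choice[e1 He1] g : exists e : nat -> bool,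
    nm E (\sum_(l < m) (-1) ^+ e l *: x (g * m + l)%N) <= c.
  exact: (Hm (fun l => x (g * m + l)%N)).
pose y g := \sum_(l < m) (-1) ^+ e1 g l *: x (g * m + l)%N.
have [|e2 He2] := signed_small_scale Hn (t := c) (x := y) c0.
  move=> g; split; last exact: He1.
  rewrite /y; apply: (qn_sum qE) => l _; apply: (qnZ qE).
  by case: (xE (g * m + l)%N).
exists (fun i => e2 (i %/ m)%N (+) e1 (i %/ m)%N (i %% m)%N).
rewrite (sum_ord_mul m n
  (fun i => (-1) ^+ (e2 (i %/ m)%N (+) e1 (i %/ m)%N (i %% m)%N) *: x i)).
apply: le_trans He2; rewrite le_eqVlt; apply/orP; left; apply/eqP; congr (nm E _).
apply: eq_bigr => g _; rewrite scaler_sumr; apply: eq_bigr => l _.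
have m0 : (0 < m)%N by case: (m) l => [[]|].
rewrite divnMDl // divn_small // addn0 modnMDl modn_small //.
by rewrite signr_addb scalerA.
Qed.

Lemma signed_small_iter J (k : R) : 0 < k -> signed_small E (2 ^ J) (k * 2 ^+ J) ->
  forall l, signed_small E (2 ^ (l * J)) (k ^+ l * 2 ^+ (l * J)).
Proof.
move=> k0 H; elim=> [|l IH].
  move=> x xE; exists (fun=> false); rewrite big_ord1 !expr0 scale1r mulr1.
  by case: (xE 0%N).
rewrite mulSn expnD exprD exprS mulrACA.
by apply: signed_small_mul => //; rewrite mulr_gt0 // exprn_gt0.
Qed.

Lemma signed_small_le n c d : c <= d -> signed_small E n c -> signed_small E n d.
Proof. by move=> cd H x /H[e He]; exists e; apply: le_trans cd. Qed.

(** One good scale [2 ^ J] gives geometric decay along all dyadic scales. *)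
Lemma signed_small_dyadic J (k : R) : (0 < J)%N -> 0 < k ->
  signed_small E (2 ^ J) (k * 2 ^+ J) ->
  forall l, signed_small E (2 ^ l) (Q ^+ J * k ^+ (l %/ J) * 2 ^+ l).
Proof.
move=> J0 k0 H l; rewrite [l in (2 ^ l)%N](divn_eq l J) addnC expnD.
have crude i : signed_small E (2 ^ i) ((2 * Q) ^+ i).
  move=> x xE; exists (fun=> false); rewrite -[leRHS]mulr1.
  apply: (qn_sum_dyadic_crude qE _ (v := fun i' => (-1) ^+ false *: x i')) => //.
  by move=> i'; rewrite expr0 scale1r.
have h := signed_small_mul _ (signed_small_iter k0 H (l %/ J)%N) (crude (l %% J)%N).
apply: signed_small_le (h _); last by rewrite mulr_gt0 // exprn_gt0.
rewrite [l in leRHS](divn_eq l J) divnMDl // (divn_small (ltn_pmod _ _)) // addn0.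
rewrite exprD exprMn.
set a := k ^+ _; set b := 2 ^+ _; set c := 2 ^+ _.
have -> : Q ^+ J * a * (b * c) = (Q ^+ J) * (a * b * c) by ring.
have -> : c * Q ^+ (l %% J) * (a * b) = Q ^+ (l %% J) * (a * b * c) by ring.
rewrite ler_wpM2r //; first by rewrite !mulr_ge0 // exprn_ge0 // ltW.
by apply: ler_weXn2l; [exact: (qn_ge1 qE)| exact/ltnW/ltn_pmod].
Qed.

(** A sum is a signed sum plus twice the sum of the terms with the less
    frequent sign. *)
Lemma sum_halving j c (x : nat -> V) : signed_small E (2 ^ j.+1) c ->
  (forall i, E (x i) /\ nm E (x i) <= 1) ->
  exists (v : V) (y : nat -> V), [/\ E v, nm E v <= c,
    forall i, E (y i) /\ nm E (y i) <= 1 &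
    \sum_(i < 2 ^ j.+1) x i = v + 2 *: \sum_(i < 2 ^ j) y i].
Proof.
move=> H xE; have [e He] := H x xE.
set n := (2 ^ j.+1)%N in He *.
have Es : E (\sum_(i < n) (-1) ^+ e i *: x i).
  by apply: (qn_sum qE) => i _; apply: (qnZ qE); case: (xE i).
wlog eh : e He Es / (size (seq.filter e (iota 0 n)) <= 2 ^ j)%N.
  move=> W; have [|h] := leqP (size (seq.filter e (iota 0 n))) (2 ^ j).
    exact: W.
  have eN : \sum_(i < n) (-1) ^+ (~~ e i) *: x i = - \sum_(i < n) (-1) ^+ e i *: x i.
    by rewrite -sumrN; apply: eq_bigr => i _; case: (e i);
      rewrite /= ?expr0 ?expr1 ?scaleN1r ?scale1r ?opprK.
  apply: (W (fun i => ~~ e i)); rewrite ?eN ?(qn_nmN qE) //; first exact: (qnN qE).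
  have := count_predC e (iota 0 n); rewrite size_iota -!size_filter => hc.
  have : (size (seq.filter (predC e) (iota 0 n)) <= 2 ^ j)%N.
    by move: h hc; rewrite /n expnS; lia.
  by rewrite (eq_filter (_ : predC e =1 (fun i => ~~ e i))).
exists (\sum_(i < n) (-1) ^+ e i *: x i).
exists (fun i => nth 0 (map x (seq.filter e (iota 0 n))) i); split=> //.
  move=> i; have [ih|ih] := ltnP i (size (seq.filter e (iota 0 n))).
    by rewrite (nth_map 0%N).
  by rewrite nth_default ?size_map // (qn_nm0 qE); split=> //; exact: (qn_0 qE).
rewrite -(sum_filter_nth x eh) scaler_sumr [X in _ + X]big_mkcond -big_split /=.
apply: eq_bigr => i _; case: (e i); last by rewrite expr0 scale1r addr0.
by rewrite expr1 scaleN1r scaler_nat mulr2n addrA addNr add0r.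
Qed.

(** Iterating [sum_halving] writes the sum of [2 ^ j] unit vectors as a series
    whose terms decay geometrically, so that the failure of the triangle
    inequality costs only a constant. *)
Theorem signed_small_convex J (k : R) : (0 < J)%N -> 0 < k -> 2 * Q * k <= 1 ->
  signed_small E (2 ^ J) (k * 2 ^+ J) -> exists2 K, 1 <= K & dyadic_convex E K.
Proof.
move=> J0 k0 Qk H; have dec := signed_small_dyadic J0 k0 H.
have Q1 := qn_ge1 qE.
have QJ1 : 1 <= Q ^+ J by rewrite exprn_ege1.
have [K K1 HK] := qn_sum_geometric qE J0 (ltW k0) Qk.
exists (K * Q ^+ J); first by rewrite mulr_ege1.
move=> j x xE.
suff [v [vE ->]] : exists v : nat -> V, (forall l, (l < j.+1)%N -> E (v l) /\
    nm E (v l) <= Q ^+ J * 2 ^+ j * k ^+ (l %/ J)) /\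
    \sum_(i < 2 ^ j) x i = \sum_(l < j.+1) v l.
  by rewrite -mulrA; apply: HK => //; rewrite mulr_ge0 ?exprn_ge0 //; lra.
elim: j x xE => [|j IH] x xE.
  exists (fun=> x 0%N); rewrite !big_ord1; split=> // l.
  rewrite ltnS leqn0 => /eqP ->; rewrite div0n !expr0 !mulr1.
  by have [? h] := xE 0%N; split=> //; apply: le_trans h _.
have [v [y [Ev hv yE ->]]] := sum_halving (dec j.+1) xE.
have [w [wE ->]] := IH y yE.
exists (fun l => if l == j.+1 then v else 2 *: w l); split=> [l|].
  case: eqP => [->|/eqP nl] lj.
    by split=> //; apply: le_trans hv _; rewrite mulrAC.
  have [|Ew hw] := wE l; first by rewrite ltn_neqAle nl -ltnS lj.
  split; first exact: (qnZ qE).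
  rewrite (qn_scale qE) // ger0_norm // exprS.
  have -> : Q ^+ J * (2 * 2 ^+ j) * k ^+ (l %/ J) = 2 * (Q ^+ J * 2 ^+ j * k ^+ (l %/ J)) by ring.
  by rewrite ler_pM2l.
rewrite [RHS]big_ord_recr /= eqxx addrC scaler_sumr; congr (_ + _).
by apply: eq_bigr => i _; rewrite ltn_eqF.
Qed.

Lemma dyadic_convex_scale K : dyadic_convex E K ->
  forall j t (x : nat -> V), 0 <= t -> (forall i, E (x i) /\ nm E (x i) <= t) ->
  nm E (\sum_(i < 2 ^ j) x i) <= K * 2 ^+ j * t.
Proof.
move=> H j t x; rewrite le_eqVlt => /predU1P[<-|t0] xt.
  have x0 i : x i = 0.
    by have [Ei ti] := xt i; apply: (qn_eq0 qE) => //; apply/le_anti; rewrite ti (qn_ge0 qE).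
  by rewrite mulr0 big1 ?(qn_nm0 qE).
have Es : E (\sum_(i < 2 ^ j) x i) by apply: (qn_sum qE) => i _; case: (xt i).
rewrite -ler_pdivrMr // mulrC -[X in X * _]ger0_norm ?invr_ge0 ?(ltW t0) //.
rewrite -(qn_scale qE) // scaler_sumr; apply: (H _ (fun i => t^-1 *: x i)) => i.
have [Ei ti] := xt i; split; first exact: (qnZ qE).
by rewrite (qn_scale qE) // ger0_norm ?invr_ge0 ?(ltW t0) // ler_pdivrMl // mulr1.
Qed.

(** The form in which convexity is used: averages over a finite set with a
    dyadic number of elements. *)
Lemma dyadic_convex_avg K : dyadic_convex E K ->
  forall (T : finType) j, #|T| = (2 ^ j)%N -> forall t (x : T -> V), 0 <= t ->
  (forall i, E (x i) /\ nm E (x i) <= t) ->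
  nm E ((2 ^+ j)^-1 *: \sum_i x i) <= K * t.
Proof.
move=> H T j cT t x t0 xt.
have Es : E (\sum_i x i) by apply: (qn_sum qE) => i _; case: (xt i).
rewrite (qn_scale qE) // ger0_norm ?invr_ge0 ?exprn_ge0 //.
rewrite ler_pdivrMl ?exprn_gt0 // mulrA [_ * K]mulrC.
have [i0|T0] := pickP (@predT T); last first.
  have : (0 < #|T|)%N by rewrite cT expn_gt0.
  by rewrite (eq_card0 T0).
move=> _.
have -> : \sum_i x i = \sum_(i < 2 ^ j) x (nth i0 (enum T) i).
  rewrite (eq_bigl (fun i => i \in T)) // big_enum_val -cT.
  by apply: eq_bigr => i _; rewrite (enum_val_nth i0).
by apply: (dyadic_convex_scale H j (x := fun i => x (nth i0 (enum T) i))).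
Qed.

End Convexity.

(** * Solidity of sequence spaces *)

Definition restr (R : realType) (B : pred nat) (x : nat -> R) : nat -> R :=
  fun k => if B k then x k else 0.

Lemma cvg0P (R : realType) (f : nat -> R) :
  f @ \oo --> (0 : R) <->
  forall eps, 0 < eps -> exists n0, forall n, (n0 <= n)%N -> `|f n| < eps.
Proof.
split=> [/cvgr0Pnorm_lt H eps /H [n0 _ Hn]|H].
  by exists n0 => n ?; apply: Hn.
apply/cvgr0Pnorm_lt => eps /H [n0 Hn]; exists n0 => //= n; exact: Hn.
Qed.

Lemma le_eps (R : realType) (a b : R) :
  (forall eps, 0 < eps -> a <= b + eps) -> a <= b.
Proof. by move=> H; apply/ler_addgt0Pr => eps /H. Qed.

Lemma sum_e (R : realType) n (a : nat -> R) :
  \sum_(k < n) a k *: @e_ R k = restr (fun k => k < n)%N a.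
Proof.
apply/funext => k; rewrite fct_sumE /restr.
under eq_bigr => i _ do rewrite (_ : (a i *: @e_ R i) k = a i * (k == i)%:R) //.
case: ltnP => kn.
  rewrite (bigD1 (Ordinal kn)) //= eqxx mulr1 big1 ?addr0 // => i ik.
  by case: eqP => [ki|]; rewrite ?mulr0 //; case/eqP: ik; apply/val_inj.
rewrite big1 // => i _; case: eqP => [ki|]; rewrite ?mulr0 //.
by move: (ltn_ord i); rewrite -ki ltnNge kn.
Qed.

Lemma pair_sumE (R : realType) (I : Type) (r : seq I) (P : pred I)
    (F : I -> (nat -> R) * (nat -> R)) :
  \sum_(i <- r | P i) F i =
  (\sum_(i <- r | P i) (F i).1, \sum_(i <- r | P i) (F i).2).
Proof.
by elim/big_rec3: _ => [//|i x y z _ ->].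
Qed.

Lemma pair_expansion (R : realType) N (p : (nat -> R) * (nat -> R)) :
  (forall k, (N <= k)%N -> p.1 k = 0 /\ p.2 k = 0) ->
  p = \sum_(k < N) (p.1 k *: (@e_ R k, 0) + p.2 k *: (0, @e_ R k)).
Proof.
move=> p0; rewrite pair_sumE /= [LHS]surjective_pairing; apply/pair_equal_spec; split.
  under eq_bigr => k _ do rewrite scaler0 addr0.
  rewrite sum_e; apply/funext => k; rewrite /restr; case: ltnP => // Nk.
  by case: (p0 k Nk).
under eq_bigr => k _ do rewrite scaler0 add0r.
rewrite sum_e; apply/funext => k; rewrite /restr; case: ltnP => // Nk.
by case: (p0 k Nk).
Qed.

Section SeqSpace.
Context {R : realType} {X : nspace (nat -> R : lmodType R)}.
Hypothesis HX : sequence_space X.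

Lemma seqsp_quasi : quasi_normed 1 X.
Proof. exact: normed_quasi (seqsp_normed HX). Qed.
Let nX := seqsp_quasi.

Lemma X_triangle x y : X x -> X y -> nm X (x + y) <= nm X x + nm X y.
Proof. by move=> Xx Xy; have := qn_triangle nX Xx Xy; rewrite mul1r. Qed.

Lemma X_triangleB x y : X x -> X y -> nm X (x - y) <= nm X x + nm X y.
Proof. by move=> Xx Xy; have := qn_nmB nX Xx Xy; rewrite mul1r. Qed.

Lemma X_le_dist x y : X x -> X y -> nm X x <= nm X y + nm X (x - y).
Proof.
by move=> Xx Xy; rewrite -[in leLHS](subrKC y x); apply: X_triangle => //; apply: (qnB nX).
Qed.

Lemma X_sum n (v : nat -> nat -> R) : (forall i, (i < n)%N -> X (v i)) ->
  nm X (\sum_(i < n) v i) <= \sum_(i < n) nm X (v i).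
Proof.
elim: n => [|n IH] H; first by rewrite !big_ord0 (qn_nm0 nX).
rewrite !big_ord_recr /=; apply: le_trans (X_triangle _ _) _.
- by apply: (qn_sum nX) => i _; apply: H; rewrite ltnS ltnW.
- exact: H.
by rewrite lerD2r IH // => i /ltnW; exact: H.
Qed.

Lemma X_e n : X (@e_ R n).
Proof. exact: (seqsp_basis HX).1.1.1. Qed.

Lemma X_fin n a : X (restr (fun k => k < n)%N a).
Proof.
by rewrite -sum_e; apply: (qn_sum nX) => i _; apply: (qnZ nX); exact: X_e.
Qed.

Lemma nm_flip n a (s : nat -> bool) :
  nm X (restr (fun k => k < n)%N (fun k => (-1) ^+ s k * a k)) <=
  nm X (restr (fun k => k < n)%N a).
Proof. by rewrite -!sum_e -[leRHS]mul1r; apply: (seqsp_basis HX).2. Qed.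

(** A multiplier with values in [-1, 1] is, one coordinate at a time, a convex
    combination of sign changes. *)
Lemma nm_mult_fin n (t a : nat -> R) : (forall k, `|t k| <= 1) ->
  nm X (restr (fun k => k < n)%N (fun k => t k * a k)) <=
  nm X (restr (fun k => k < n)%N a).
Proof.
move=> t1; pose h m k := (if (k < m)%N then t k else 1) * a k.
suff H m : nm X (restr (fun k => k < n)%N (h m)) <= nm X (restr (fun k => k < n)%N a).
  have <- // : restr (fun k => k < n)%N (h n) = restr (fun k => k < n)%N (fun k => t k * a k).
  by apply/funext => k; rewrite /restr /h; case: ltnP.
elim: m => [|m IH].
  by have -> : h 0%N = a by apply/funext => k; rewrite /h ltn0 mul1r.
set y := restr _ (h m) in IH.
pose z := restr (fun k => k < n)%N (fun k => (-1) ^+ (k == m) * h m k).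
have -> : restr (fun k => k < n)%N (h m.+1) =
    (((1 + t m) / 2) *: y) + (((1 - t m) / 2) *: z).
  apply/funext => k; rewrite [RHS](_ : _ = (1 + t m) / 2 * y k + (1 - t m) / 2 * z k) //.
  rewrite /y /z /restr /h; case: (k < n)%N; last by rewrite !mulr0 addr0.
  have [->|km] := eqVneq k m; first by rewrite ltnSn ltnn expr1; field.
  by rewrite expr0 ltnS leq_eqVlt (negbTE km) /=; field.
have [Xy Xz] : X y /\ X z by split; exact: X_fin.
have zy : nm X z <= nm X y by apply: nm_flip.
apply: le_trans (X_triangle (qnZ nX _ Xy) (qnZ nX _ Xz)) _.
rewrite !(qn_scale nX) //.
have [t1' t2'] : -1 <= t m /\ t m <= 1 by apply/andP; rewrite -ler_norml.
rewrite !ger0_norm; [|lra|lra]; apply: le_trans IH.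
have h1 : 0 <= (1 - t m) / 2 by lra.
have := ler_wpM2l h1 zy; lra.
Qed.

Lemma nm_fin_le n a b : (forall k, (k < n)%N -> `|a k| <= `|b k|) ->
  nm X (restr (fun k => k < n)%N a) <= nm X (restr (fun k => k < n)%N b).
Proof.
move=> ab; pose t k := if (k < n)%N && (b k != 0) then a k / b k else 0.
rewrite (_ : restr _ a = restr (fun k => k < n)%N (fun k => t k * b k)).
  apply: nm_mult_fin => k; rewrite /t; case: ifP => [/andP[kn b0]|]; last by rewrite normr0.
  by rewrite normrM normfV ler_pdivrMr ?normr_gt0 // mul1r ab.
apply/funext => k; rewrite /restr /t; case: ltnP => //= kn.
case: eqP => [b0|/eqP b0]; last by rewrite divfK.
by have := ab k kn; rewrite b0 normr0 normr_le0 mul0r => /eqP.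
Qed.

Lemma X_expand x : X x -> forall eps, 0 < eps -> exists n0, forall n,
  (n0 <= n)%N -> nm X (restr (fun k => k < n)%N x - x) < eps.
Proof.
move=> Xx eps e0; have /cvg0P/(_ _ e0)[n0 H] := seqsp_coord HX Xx.
exists n0 => n /H; rewrite sum_e ger0_norm //.
by apply: (qn_ge0 nX); apply: (qnB nX) => //; exact: X_fin.
Qed.

Lemma nm_restr_lt n x : X x -> nm X (restr (fun k => k < n)%N x) <= nm X x.
Proof.
move=> Xx; apply: le_eps => eps /(X_expand Xx)[n0 /(_ (maxn n0 n) (leq_maxl _ _)) H].
set m := maxn n0 n in H.
apply: (@le_trans _ _ (nm X (restr (fun k => k < m)%N x))).
  rewrite (_ : restr (fun k => k < n)%N x =
      restr (fun k => k < m)%N (restr (fun k => k < n)%N x)).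
    by apply: nm_fin_le => k _; rewrite /restr; case: ifP => // _; rewrite normr0.
  apply/funext => k; rewrite /restr; case: (ltnP k m) => // mk.
  by rewrite ltnNge (leq_trans (leq_maxr n0 n) mk).
apply: le_trans (X_le_dist (X_fin _ _) Xx) _.
by rewrite lerD2l ltW.
Qed.

(** Membership in X is a Cauchy condition on blocks: the limit given by
    completeness has the right coordinates because expansions in the basis are
    unique. *)
Lemma X_of_blocks (x : nat -> R) :
  (forall eps, 0 < eps -> exists n0, forall m n, (n0 <= m <= n)%N ->
     nm X (restr (fun k => m <= k < n)%N x) <= eps) ->
  X x /\ forall eps, 0 < eps -> exists n0, forall n, (n0 <= n)%N ->
     nm X (restr (fun k => k < n)%N x - x) < eps.
Proof.
move=> H.
have D m n : (m <= n)%N -> restr (fun k => k < n)%N x - restr (fun k => k < m)%N x =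
    restr (fun k => m <= k < n)%N x.
  move=> mn; apply/funext => k.
  rewrite [LHS](_ : _ = restr (fun k => k < n)%N x k - restr (fun k => k < m)%N x k) //.
  rewrite /restr; case: (leqP m k) => mk /=; first by rewrite subr0.
  by rewrite (leq_trans mk mn) subrr.
have [||x' Xx' Hx'] := seqsp_complete HX (v := fun n => restr (fun k => k < n)%N x).
- by move=> n; exact: X_fin.
- move=> eps e0; have [|n0 Hn] := H (eps / 2); first by rewrite divr_gt0.
  have e2 : eps / 2 < eps by lra.
  exists n0 => m n n0m n0n; case/orP: (leq_total m n) => mn.
    rewrite (qn_distC nX); [|exact: X_fin|exact: X_fin]; rewrite D //.
    by apply: le_lt_trans e2; apply: Hn; rewrite n0m.
  by rewrite D //; apply: le_lt_trans e2; apply: Hn; rewrite n0n.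
have xx : x = x'.
  have [a [_ ua]] := (seqsp_basis HX).1.1.2 _ Xx'.
  rewrite -(ua _ (seqsp_coord HX Xx')); symmetry; apply: ua.
  by rewrite /expansion; under eq_fun do rewrite sum_e.
subst x'; split=> // eps e0; have /cvg0P/(_ _ e0)[n0 Hn] := Hx'.
exists n0 => n /Hn; rewrite ger0_norm //; apply: (qn_ge0 nX).
by apply: (qnB nX) => //; exact: X_fin.
Qed.

Lemma nm_limit x c : X x -> (forall n, nm X (restr (fun k => k < n)%N x) <= c) ->
  nm X x <= c.
Proof.
move=> Xx H; apply: le_eps => eps /(X_expand Xx)[n0 /(_ _ (leqnn _)) Hn].
apply: le_trans (X_le_dist Xx (X_fin n0 x)) _.
by rewrite (qn_distC nX) //; [apply: lerD => //; exact: ltW|exact: X_fin].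
Qed.

(** The truncations of x are dominated by those of y, blockwise; this gives the
    membership, and the bound passes to the limit. *)
Lemma X_solid x y : X y -> (forall k, `|x k| <= `|y k|) ->
  X x /\ nm X x <= nm X y.
Proof.
move=> Xy xy.
suff Xx : X x.
  split=> //; apply: nm_limit => // n; apply: le_trans (nm_restr_lt n Xy).
  exact: nm_fin_le.
suff [] : X x /\ forall eps, 0 < eps -> exists n0, forall n, (n0 <= n)%N ->
     nm X (restr (fun k => k < n)%N x - x) < eps by [].
apply: X_of_blocks => eps e0.
have [n0 Hn] := X_expand Xy e0; exists n0 => m n /andP[n0m mn].
apply: (@le_trans _ _ (nm X (restr (fun k => k < n)%N
    (restr (fun k => k < m)%N y - y)))); last first.
  apply: le_trans (nm_restr_lt _ _) _; last exact/ltW/Hn.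
  by apply: (qnB nX) => //; exact: X_fin.
rewrite (_ : restr _ x = restr (fun k => k < n)%N (restr (fun k => m <= k)%N x)).
  apply: nm_fin_le => k _.
  rewrite [X in _ <= `|X|](_ : _ = restr (fun k => k < m)%N y k - y k) // /restr.
  by case: leqP => // _; rewrite ?normr0 // sub0r normrN.
by apply/funext => k; rewrite /restr; case: (m <= k)%N; case: (k < n)%N.
Qed.

Lemma nm_le x y : X y -> (forall k, `|x k| <= `|y k|) -> nm X x <= nm X y.
Proof. by move=> Xy /(X_solid Xy)[]. Qed.

Lemma X_mul u x c : X x -> (forall k, `|u k| <= c) ->
  X (u \* x) /\ nm X (u \* x) <= c * nm X x.
Proof.
move=> Xx uc; have c0 : 0 <= c by apply: le_trans (uc 0%N).
have [|h1 h2] := X_solid (x := u \* x) (qnZ nX c Xx).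
  move=> k; rewrite [X in _ <= `|X|](_ : _ = c * x k) //= !normrM (ger0_norm c0).
  by rewrite ler_wpM2r.
by split=> //; rewrite -[c in c * _]ger0_norm // -(qn_scale nX).
Qed.

Lemma X_restr B x : X x -> X (restr B x) /\ nm X (restr B x) <= nm X x.
Proof.
move=> Xx; apply: X_solid => // k; rewrite /restr.
by case: ifP => // _; rewrite normr0.
Qed.

Lemma nm_e_gt0 k : 0 < nm X (@e_ R k).
Proof.
rewrite lt_neqAle (qn_ge0 nX) ?andbT; last exact: X_e.
apply/eqP => /esym/(qn_eq0 nX (X_e k)) /(congr1 (fun f => f k)).
by rewrite /e_ eqxx => /eqP; rewrite oner_eq0.
Qed.

Lemma restr1 k (x : nat -> R) : restr (pred1 k) x = x k *: @e_ R k.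
Proof.
apply/funext => i; rewrite [RHS](_ : _ = x k * (i == k)%:R) // /restr /=.
by case: eqP => [->|]; rewrite ?mulr1 ?mulr0.
Qed.

Lemma nm_coord k x : X x -> `|x k| * nm X (@e_ R k) <= nm X x.
Proof.
move=> Xx; rewrite -(qn_scale nX _ (X_e k)) -restr1; exact: (X_restr _ Xx).2.
Qed.

Lemma X_tail x : X x -> forall eps, 0 < eps -> exists n0, forall B : pred nat,
  (forall k, B k -> n0 <= k)%N -> nm X (restr B x) <= eps.
Proof.
move=> Xx eps /(X_expand Xx)[n0 /(_ _ (leqnn _)) H]; exists n0 => B Bn.
apply: le_trans (ltW H); apply: nm_le.
  by apply: (qnB nX) => //; exact: X_fin.
move=> k; rewrite [X in _ <= `|X|](_ : _ = restr (fun k => k < n0)%N x k - x k) // /restr.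
case: ifP => [/Bn|]; last by rewrite normr0.
by rewrite leqNgt => /negbTE ->; rewrite sub0r normrN.
Qed.

End SeqSpace.

(** * Centralizers and twisted sums *)

Record centralizer_le (R : realType) (X : nspace (nat -> R : lmodType R))
    (Omega : (nat -> R) -> (nat -> R)) (D : R) : Prop := {
  cz_ge0 : 0 <= D ;
  cz_hom : forall (a : R) x, X x -> Omega (a *: x) = a *: Omega x ;
  cz_mul : forall x u c, X x -> (forall k, `|u k| <= c) ->
    X (Omega (u \* x) - u \* Omega x) /\
    nm X (Omega (u \* x) - u \* Omega x) <= D * c * nm X x }.

Lemma norm_infty_le (R : realType) (u : nat -> R) c :
  (forall k, `|u k| <= c) -> 0 <= norm_infty u <= c.
Proof.
move=> uc; apply/andP; split.
  apply: (le_trans (normr_ge0 (u 0%N))); apply: ub_le_sup; last by exists 0%N.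
  by exists c => _ [n _ <-].
by apply: ge_sup; [exists `|u 0%N|; exists 0%N|move=> _ [n _ <-]].
Qed.

Lemma restrE (R : realType) (B : pred nat) (x : nat -> R) :
  restr B x = (fun k => (B k)%:R) \* x.
Proof.
by apply/funext => k; rewrite /restr /=; case: (B k); rewrite ?mul1r ?mul0r.
Qed.

Section Centralizer.
Context {R : realType} {X : nspace (nat -> R : lmodType R)}.
Hypothesis HX : sequence_space X.
Let nX := seqsp_quasi HX.

Lemma centralizerP (Omega : (nat -> R) -> (nat -> R)) :
  centralizer X Omega -> exists D, centralizer_le X Omega D.
Proof.
case=> D [hom mul]; exists `|D|; split=> // x u c Xx uc.
have [|h1 h2] := mul x u Xx; first by exists c.
split=> //; apply: le_trans h2 _; have /andP[n0 nc] := norm_infty_le uc.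
apply: ler_wpM2r; first exact: (qn_ge0 nX).
apply: le_trans (ler_norm _) _; rewrite normrM ler_wpM2l // ger0_norm //.
Qed.

Context {Omega : (nat -> R) -> (nat -> R)} {D : R}.
Hypothesis HO : centralizer_le X Omega D.

Lemma cz_0 : Omega 0 = 0.
Proof. by rewrite -(scale0r 0) (cz_hom HO) ?scale0r //; exact: (qn_0 nX). Qed.

Lemma cz_shift b : centralizer_le X (fun x => Omega x - b \* x) D.
Proof.
have [D0 hom mul] := HO; split=> // [a x Xx|x u c Xx uc].
  rewrite hom // scalerBr; congr (_ - _); apply/funext => k /=.
  by rewrite [LHS](_ : _ = b k * (a * x k)) // [RHS](_ : _ = a * (b k * x k)) // mulrCA.
suff -> : Omega (u \* x) - b \* (u \* x) - u \* (Omega x - b \* x) =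
   Omega (u \* x) - u \* Omega x by exact: mul.
apply/funext => k.
rewrite [LHS](_ : _ = Omega (u \* x) k - b k * (u k * x k) - u k * (Omega x k - b k * x k)) //.
rewrite [RHS](_ : _ = Omega (u \* x) k - u k * Omega x k) //; ring.
Qed.

Lemma cz_restr B x : X x -> X (Omega (restr B x) - restr B (Omega x)) /\
  nm X (Omega (restr B x) - restr B (Omega x)) <= D * nm X x.
Proof.
move=> Xx; rewrite !restrE -[D in D * _]mulr1; apply: (cz_mul HO) => // k.
by case: (B k); rewrite ?normr1 ?normr0.
Qed.

(** Both x and y are multiples of |x| + |y| by functions bounded by 1, and
    so is their sum. *)
Lemma cz_add x y : X x -> X y -> X (Omega (x + y) - Omega x - Omega y) /\
  nm X (Omega (x + y) - Omega x - Omega y) <= 3 * D * (nm X x + nm X y).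
Proof.
move=> Xx Xy; have D0 := cz_ge0 HO.
pose z k := `|x k| + `|y k|.
pose u k := x k / z k; pose v k := y k / z k.
have [Xax nax] := X_solid HX (x := fun k => `|x k|) Xx (fun k => ltac:(by rewrite normr_id)).
have [Xay nay] := X_solid HX (x := fun k => `|y k|) Xy (fun k => ltac:(by rewrite normr_id)).
have Xz : X z by apply: (qnD nX Xax Xay).
have nz : nm X z <= nm X x + nm X y.
  by apply: le_trans (X_triangle HX Xax Xay) _; exact: lerD.
have z0 k : 0 <= z k by rewrite addr_ge0.
have frac a k : `|a| <= z k -> `|a / z k| <= 1.
  have := z0 k; rewrite le_eqVlt => /predU1P[<-|zp] h; first by rewrite invr0 mulr0 normr0.
  by rewrite normrM normfV (gtr0_norm zp) ler_pdivrMr // mul1r.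
have fracK a k : `|a| <= z k -> a = a / z k * z k.
  move=> h; have [zk|zk] := eqVneq (z k) 0; last by rewrite divfK.
  by move: h; rewrite zk normr_le0 => /eqP ->; rewrite !mul0r.
have hx k : `|x k| <= z k by rewrite lerDl.
have hy k : `|y k| <= z k by rewrite lerDr.
have hxy k : `|x k + y k| <= z k by exact: ler_normD.
have [X1 n1] := cz_mul HO (u := u) Xz (fun k => frac _ k (hx k)).
have [X2 n2] := cz_mul HO (u := v) Xz (fun k => frac _ k (hy k)).
have [X3 n3] := cz_mul HO (u := fun k => (x k + y k) / z k) Xz (fun k => frac _ k (hxy k)).
have e1 : u \* z = x by apply/funext => k; rewrite /= -fracK.
have e2 : v \* z = y by apply/funext => k; rewrite /= -fracK.
have e3 : (fun k => (x k + y k) / z k) \* z = x + y.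
  by apply/funext => k; rewrite /= -fracK.
rewrite e1 in X1 n1; rewrite e2 in X2 n2; rewrite e3 in X3 n3.
have -> : Omega (x + y) - Omega x - Omega y =
   (Omega (x + y) - (fun k => (x k + y k) / z k) \* Omega z) - (Omega x - u \* Omega z)
     - (Omega y - v \* Omega z).
  apply/funext => k.
  rewrite [LHS](_ : _ = Omega (x + y) k - Omega x k - Omega y k) //.
  rewrite [RHS](_ : _ = (Omega (x + y) k - (x k + y k) / z k * Omega z k) -
    (Omega x k - x k / z k * Omega z k) - (Omega y k - y k / z k * Omega z k)) //.
  by rewrite mulrDl; ring.
have X31 := qnB nX X3 X1; split; first exact: (qnB nX X31 X2).
apply: le_trans (X_triangleB HX X31 X2) _.
apply: le_trans (lerD (X_triangleB HX X3 X1) (lexx _)) _.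
have := ler_wpM2l D0 nz; move: n1 n2 n3; rewrite !mulr1; lra.
Qed.

Lemma cz_sum_dyadic j (x : nat -> nat -> R) t : 0 <= t ->
  (forall i, X (x i) /\ nm X (x i) <= t) ->
  X (Omega (\sum_(i < 2 ^ j) x i) - \sum_(i < 2 ^ j) Omega (x i)) /\
  nm X (Omega (\sum_(i < 2 ^ j) x i) - \sum_(i < 2 ^ j) Omega (x i)) <=
    3 * D * j%:R * 2 ^+ j * t.
Proof.
move=> t0; elim: j x => [|j IH] x xt.
  rewrite !big_ord1 subrr (qn_nm0 nX) mulr0 !mul0r; split=> //; exact: (qn_0 nX).
have Xx i : X (x i) by case: (xt i).
have [X1 n1] := IH x xt.
have [X2 n2] := IH (fun i => x (2 ^ j + i)%N) (fun i => xt _).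
have Xs1 : X (\sum_(i < 2 ^ j) x i) by apply: (qn_sum nX).
have Xs2 : X (\sum_(i < 2 ^ j) x (2 ^ j + i)%N) by apply: (qn_sum nX).
have [X3 n3] := cz_add Xs1 Xs2.
rewrite expnS mul2n -addnn !big_split_ord /=.
set s1 := \sum_(i < _) x i in X1 n1 Xs1 X3 n3 *.
set s2 := \sum_(i < _) x _ in X2 n2 Xs2 X3 n3 *.
set o1 := \sum_(i < _) Omega _ in X1 n1 *.
set o2 := \sum_(i < _) Omega _ in X2 n2 *.
have -> : Omega (s1 + s2) - (o1 + o2) =
   (Omega (s1 + s2) - Omega s1 - Omega s2) + (Omega s1 - o1) + (Omega s2 - o2).
  rewrite !addrA; move: (Omega (s1 + s2)) (Omega s1) (Omega s2) o1 o2 {X1 n1 X2 n2 X3 n3}.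
  by move=> a b c d e; apply/funext => k; rewrite !fctE; ring.
have X31 := qnD nX X3 X1; split; first exact: (qnD nX X31 X2).
apply: le_trans (X_triangle HX X31 X2) _.
apply: le_trans (lerD (X_triangle HX X3 X1) (lexx _)) _.
have hs (y : nat -> nat -> R) : (forall i, X (y i) /\ nm X (y i) <= t) ->
    nm X (\sum_(i < 2 ^ j) y i) <= 2 ^+ j * t.
  move=> yt; have h := X_sum HX (n := 2 ^ j) (v := y) (fun i _ => (yt i).1).
  apply: le_trans h _.
  apply: (@le_trans _ _ (\sum_(i < 2 ^ j) t)); first by apply: ler_sum => i _; case: (yt i).
  by rewrite sumr_const card_ord -[t *+ _]mulr_natl natrX.
have hs1 := hs _ xt; have hs2 := hs _ (fun i => xt (2 ^ j + i)%N).
have D0 : 0 <= 3 * D by have := cz_ge0 HO; lra.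
have := ler_wpM2l D0 (lerD hs1 hs2).
rewrite -natr1 exprS; move: n1 n2 n3; rewrite -/s1 -/s2; lra.
Qed.

Local Notation Y := (twisted_sum X Omega).

Lemma tw_quasi : quasi_normed (1 + 3 * D) Y.
Proof.
have D0 := cz_ge0 HO.
split.
- lra.
- by split=> /=; rewrite ?cz_0 ?subr0; exact: (qn_0 nX).
- move=> a [x y] [x' y'] [/= Xx Xy] [/= Xx' Xy']; split=> /=.
    exact: (qn_lin nX).
  have Xax := qnZ nX a Xx.
  have [X1 _] := cz_add Xax Xx'.
  have -> : a *: y + y' - Omega (a *: x + x') = a *: (y - Omega x) + (y' - Omega x')
     - (Omega (a *: x + x') - Omega (a *: x) - Omega x').
    rewrite (cz_hom HO) // scalerBr; move: (Omega (_ + _)) (a *: Omega x) (Omega x') => p q r.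
    by apply/funext => k; rewrite !fctE; ring.
  by apply: (qnB nX) => //; apply: (qn_lin nX).
- move=> [x y] [x' y'] [/= Xx Xy] [/= Xx' Xy'].
  have [X1 n1] := cz_add Xx Xx'.
  have -> : y + y' - Omega (x + x') = (y - Omega x) + (y' - Omega x')
     - (Omega (x + x') - Omega x - Omega x').
    by move: (Omega (_ + _)) (Omega x) (Omega x') => p q r; apply/funext => k; rewrite !fctE; ring.
  have := X_triangleB HX (qnD nX Xy Xy') X1.
  have := X_triangle HX Xy Xy'; have := X_triangle HX Xx Xx'.
  have : 0 <= 3 * D * (nm X (y - Omega x) + nm X (y' - Omega x')).
    by rewrite mulr_ge0 ?addr_ge0 ?(qn_ge0 nX) //; lra.
  lra.
- move=> a [x y] [/= Xx Xy]; rewrite (cz_hom HO) // -scalerBr !(qn_scale nX) //; lra.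
- move=> [x y] [/= Xx Xy] h.
  have := qn_ge0 nX Xx; have := qn_ge0 nX Xy => h1 h2.
  have x0 : x = 0 by apply: (qn_eq0 nX) => //; lra.
  have : y - Omega x = 0 by apply: (qn_eq0 nX) => //; lra.
  by rewrite x0 cz_0 subr0 => ->.
Qed.

Lemma tw_mul u c p : (forall k, `|u k| <= c) -> Y p ->
  Y (u \* p.1, u \* p.2) /\ nm Y (u \* p.1, u \* p.2) <= c * (1 + D) * nm Y p.
Proof.
case: p => x y uc [/= Xx Xy].
have [X1 n1] := X_mul HX Xx uc; have [X2 n2] := X_mul HX Xy uc.
have [X3 n3] := cz_mul HO Xx uc.
have e : u \* y - Omega (u \* x) = u \* (y - Omega x) - (Omega (u \* x) - u \* Omega x).
  by apply/funext => k; rewrite !fctE /=; ring.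
split; first by split=> //=; rewrite e; exact: (qnB nX).
rewrite /= e; have := X_triangleB HX X2 X3.
have c0 : 0 <= c by apply: le_trans (uc 0%N).
have : 0 <= c * D * nm X (y - Omega x).
  by rewrite !mulr_ge0 ?(cz_ge0 HO) ?(qn_ge0 nX).
lra.
Qed.

Lemma tw_restr B p : Y p ->
  Y (restr B p.1, restr B p.2) /\ nm Y (restr B p.1, restr B p.2) <= (1 + D) * nm Y p.
Proof.
move=> Yp; rewrite !restrE -[1 + D]mul1r; apply: tw_mul => // k.
by case: (B k); rewrite ?normr1 ?normr0.
Qed.

Lemma tw_graph x : X x -> Y (x, Omega x) /\ nm Y (x, Omega x) = nm X x.
Proof.
by move=> Xx; split=> /=; rewrite subrr ?(qn_nm0 nX) ?addr0 //; split=> //; exact: (qn_0 nX).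
Qed.

Lemma tw_fiber y : X y -> Y (0, y) /\ nm Y (0, y) = nm X y.
Proof.
move=> Xy; split=> /=; rewrite cz_0 subr0 ?(qn_nm0 nX) ?add0r //.
by split=> //; exact: (qn_0 nX).
Qed.

Lemma cz_e k : X (Omega (@e_ R k) - Omega (@e_ R k) k *: @e_ R k) /\
  nm X (Omega (@e_ R k) - Omega (@e_ R k) k *: @e_ R k) <= D * nm X (@e_ R k).
Proof.
have := cz_restr (pred1 k) (X_e HX k).
by rewrite !restr1 /e_ eqxx scale1r.
Qed.

(** Uniform bounds on the truncations of [Omega x] put [Omega x] in X, even
    when the basis is not boundedly complete: applied to the tails of x, they
    show that the blocks of [Omega x] are small. *)
Lemma cz_bounded_of_truncations K :
  (forall n x, X x -> nm X (restr (fun k => k < n)%N (Omega x)) <= K * nm X x) ->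
  forall x, X x -> X (Omega x) /\ nm X (Omega x) <= K * nm X x.
Proof.
move=> H x Xx.
have K0 : 0 <= K.
  have := H 0%N _ (X_e HX 0); have := nm_e_gt0 HX 0.
  have := qn_ge0 nX (X_fin HX 0 (Omega (@e_ R 0))) => h1 h2 h3.
  by rewrite -(pmulr_lge0 _ h2) (le_trans h1).
suff XO : X (Omega x) by split=> //; apply: (nm_limit HX) => // n; exact: H.
suff [] : X (Omega x) /\ forall eps, 0 < eps -> exists n0, forall n, (n0 <= n)%N ->
     nm X (restr (fun k => k < n)%N (Omega x) - Omega x) < eps by [].
apply: (X_of_blocks HX) => eps e0.
have e1 : 0 < eps / 2 / (K + 1) by rewrite !divr_gt0 //; lra.
have [n1 Hn1] := X_tail HX Xx e1.
pose x1 := restr (fun k => n1 <= k)%N x.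
have [Xx1 _] := X_restr HX (fun k => n1 <= k)%N Xx.
have hx1 : nm X x1 <= eps / 2 / (K + 1) by apply: Hn1.
have [Xd _] := cz_restr (fun k => n1 <= k)%N Xx; rewrite -/x1 in Xd.
set d := _ - _ in Xd.
have e2 : 0 < eps / 2 by lra.
have [n2 Hn2] := X_tail HX Xd e2.
exists (maxn n1 n2) => m n; rewrite geq_max -andbA => /and3P[n1m n2m mn].
pose B k := (m <= k < n)%N.
have -> : restr B (Omega x) = restr B (restr (fun k => k < n)%N (Omega x1)) - restr B d.
  apply/funext => k; rewrite !fctE /restr /B /d; case: (leqP m k) => mk /=; last by rewrite subrr.
  case: (k < n)%N; last by rewrite subrr.
  by rewrite !fctE /restr (leq_trans n1m mk) opprB addrC subrK.
have XB := X_restr HX B (X_fin HX n (Omega x1)).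
apply: le_trans (X_triangleB HX XB.1 (X_restr HX B Xd).1) _.
have hd : nm X (restr B d) <= eps / 2.
  by apply: Hn2 => k /andP[mk _]; exact: leq_trans mk.
have h1 : nm X (restr (fun k => k < n)%N (Omega x1)) <= eps / 2.
  apply: le_trans (H _ _ Xx1) _.
  apply: le_trans (ler_wpM2l K0 hx1) _.
  rewrite mulrA ler_pdivrMr; last lra.
  rewrite mulrC ler_pM2l //; lra.
by have := XB.2; lra.
Qed.

End Centralizer.

(** * Finite-dimensional subspaces seen through coordinates *)

(** Gaussian elimination: vectors and functionals in duality on a
    finite-dimensional space, where every functional depends on finitely many
    members of a given separating family. *)
Lemma finite_dim_dual_system (R : realType) (V : lmodType R) (c : nat -> V -> R)
    (clin : forall k (a : R) x y, c k (a *: x + y) = a * c k x + c k y)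
    (csep : forall x, (forall k, c k x = 0) -> x = 0) n (v : nat -> V) :
  exists (w : nat -> V) (g : nat -> V -> R) (m : nat) (h : nat -> nat -> R),
    (forall i x, g i x = \sum_(k < m) h i k * c k x) /\
    (forall a : nat -> R, let x := \sum_(i < n) a i *: v i in
       x = \sum_(i < n) g i x *: w i) /\
    (forall i, exists b : nat -> R, w i = \sum_(j < n) b j *: v j).
Proof.
have c0 k : c k 0 = 0.
  by have := clin k (-1) 0 0; rewrite scaler0 addr0 mulN1r addNr.
have clin' : forall k, exists f : {linear V -> R^o}, c k = f.
  move=> k; have H : linear (c k : V -> R^o) by move=> a x y; exact: clin.
  by pose cL := GRing.isLinear.Build R V R^o *:%R (c k) H;
    exists (HB.pack_for {linear V -> R^o} (c k : V -> R^o) cL).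
have cS k (r : nat) (F : 'I_r -> V) : c k (\sum_(i < r) F i) = \sum_(i < r) c k (F i).
  by have [f ->] := clin' k; rewrite linear_sum.
have cZ k a x : c k (a *: x) = a * c k x.
  by have := clin k a x 0; rewrite addr0 c0 addr0.
elim: n => [|n [w [g [m [h [gE [xE wE]]]]]]].
  exists (fun=> 0), (fun _ _ => 0), 0%N, (fun _ _ => 0); split=> [i x|].
    by rewrite big_ord0.
  by split=> [a /=|i]; [|exists (fun=> 0)]; rewrite !big_ord0.
have gD i a x y : g i (a *: x + y) = a * g i x + g i y.
  by rewrite !gE mulr_sumr -big_split; apply: eq_bigr => k _; rewrite clin /=; ring.
have xS (a : nat -> R) : let x := \sum_(i < n.+1) a i *: v i in
    (forall i, g i x = g i (\sum_(i < n) a i *: v i) + a n * g i (v n)) /\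
    x = \sum_(i < n) g i (\sum_(i < n) a i *: v i) *: w i + a n *: v n.
  by rewrite big_ord_recr /=; split=> [i|]; [rewrite addrC gD addrC|rewrite -xE].
(* the component of the new vector that the old system does not see *)
pose u := v n - \sum_(i < n) g i (v n) *: w i.
have [u0|/existsNP[k /eqP ck]] := pselect (forall k, c k u = 0).
  have {}u0 : v n = \sum_(i < n) g i (v n) *: w i by apply/subr0_eq/csep.
  exists (fun i => if (i < n)%N then w i else 0).
  exists g, m, h; split=> //; split=> [a x|i].
    rewrite big_ord_recr /= ltnn scaler0 addr0; have [gx xa] := xS a; rewrite [LHS]xa.
    rewrite {1}u0 scaler_sumr -big_split; apply: eq_bigr => i _ /=.
    by rewrite ltn_ord /x gx scalerDl scalerA.
  case: ltnP => ln.
    have [b ->] := wE i; exists (fun j => if (j < n)%N then b j else 0).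
    rewrite big_ord_recr /= ltnn scale0r addr0.
    by apply: eq_bigr => j _; rewrite ltn_ord.
  by exists (fun=> 0); rewrite big1 // => j _; rewrite scale0r.
pose m' := maxn m k.+1.
pose h0 i l := if (l < m)%N then h i l else 0.
have gE' i x : g i x = \sum_(l < m') h0 i l * c l x.
  rewrite gE (big_ord_widen m' (fun l => h i l * c l x)) ?leq_maxl // big_mkcond.
  by apply: eq_bigr => l _; rewrite /h0; case: ifP => _; rewrite ?mul0r.
pose hn l := (c k u)^-1 * ((l == k)%:R - \sum_(i < n) h0 i l * c k (w i)).
exists (fun i => if (i < n)%N then w i else u).
exists (fun i x => if (i < n)%N then g i x
  else (c k u)^-1 * (c k x - \sum_(i < n) g i x * c k (w i))).
exists m', (fun i l => if (i < n)%N then h0 i l else hn l); split=> [i x|].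
  case: ifP => _; first exact: gE'.
  rewrite /hn.
  under [RHS]eq_bigr => l _ do rewrite -mulrA.
  rewrite -mulr_sumr; congr (_ * _).
  under [RHS]eq_bigr => l _ do rewrite mulrBl.
  rewrite big_split /= sumrN; congr (_ - _).
    have km : (k < m')%N by rewrite leq_max ltnSn orbT.
    rewrite (bigD1 (Ordinal km)) //= eqxx mul1r big1 ?addr0 // => l lk.
    by case: eqP => [lk'|]; rewrite ?mul0r //; case/eqP: lk; apply/val_inj.
  under eq_bigr => i0 _ do rewrite gE' mulr_suml.
  rewrite exchange_big; apply: eq_bigr => l _; rewrite mulr_suml.
  by apply: eq_bigr => i0 _; ring.
split=> [a x|i]; last first.
  case: ltnP => ln.
    have [b ->] := wE i; exists (fun j => if (j < n)%N then b j else 0).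
    rewrite big_ord_recr /= ltnn scale0r addr0.
    by apply: eq_bigr => j _; rewrite ltn_ord.
  have /choice[b bE] := wE.
  exists (fun j => if (j < n)%N then - \sum_(i < n) g i (v n) * b i j else 1).
  rewrite big_ord_recr /= ltnn scale1r /u addrC; congr (_ + _).
  under [X in - X]eq_bigr => i0 _ do rewrite bE scaler_sumr.
  rewrite exchange_big -sumrN; apply: eq_bigr => j _ /=.
  by rewrite ltn_ord scaleNr scaler_suml; congr (- _); apply: eq_bigr => i0 _; rewrite scalerA.
rewrite big_ord_recr /= ltnn.
under eq_bigr => i _ do rewrite ltn_ord.
have xu : x - \sum_(i < n) g i x *: w i = a n *: u.
  have [gx xa] := xS a; rewrite [X in X - _]xa scalerBr scaler_sumr addrAC addrC.
  congr (_ + _); rewrite -sumrB -sumrN; apply: eq_bigr => i _.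
  by rewrite /x gx scalerDl opprD addrA subrr add0r scalerA.
have <- : c k (a n *: u) = c k x - \sum_(i < n) g i x * c k (w i).
  have cN y : c k (- y) = - c k y by rewrite -scaleN1r cZ mulN1r.
  have cD y z : c k (y + z) = c k y + c k z.
    by rewrite -[y]scale1r clin mul1r scale1r.
  rewrite -xu cD cN. congr (_ - _); rewrite cS.
  by apply: eq_bigr => i _; rewrite cZ.
by rewrite cZ mulrC mulfK // -xu addrC subrK.
Qed.

(** * The sequence space l1 is not reflexive *)

(** The limit along a free ultrafilter. *)
Lemma generalized_limit (R : realType) : exists L : (nat -> R) -> R,
  [/\ forall (a : R) u v c d, (forall n, `|u n| <= c) -> (forall n, `|v n| <= d) ->
        L (a *: u + v : nat -> R) = a * L u + L v,
      forall u c, (forall n, `|u n| <= c) -> `|L u| <= c &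
      forall u l m, (forall n, (m <= n)%N -> u n = l) -> L u = l].
Proof.
have [U [UU subU]] := ultraFilterLemma (@eventually_filter : ProperFilter \oo).
have PU := @ultra_proper _ _ UU.
have bcvg (u : nat -> R) c : (forall n, `|u n| <= c) -> cvg (u @ U).
  move=> uc.
  have [|p [_ cp]] := @segment_compact R (- c) c (u @ U) (fmap_proper_filter u PU).
    suff : U [set n | `[- c, c]%classic (u n)] by [].
    by apply: filterE => n /=; rewrite in_itv /= -ler_norml.
  apply/cvg_ex; exists p; apply/cvgrPdist_lt => eps e0.
  have [//|H] := in_ultra_setVsetC [set n | `|p - u n| < eps] UU.
  have [x [/=]] := cp [set x | ~ `|p - x| < eps] _ H (nbhsx_ballx p eps e0).
  by rewrite /ball /= => h1 h2.
exists (fun u => lim (u @ U)); split=> [a u v c d uc vd|u c uc|u l m uE].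
- apply/cvg_lim => //; apply: cvgD; last exact: (bcvg v d).
  by apply: cvgMr; exact: (bcvg u c).
- have cu := bcvg _ _ uc.
  have bn n : - c <= u n <= c by rewrite -ler_norml.
  rewrite ler_norml; apply/andP; split.
    by apply: limr_ge cu _; near=> n; case/andP: (bn n).
  by apply: limr_le cu _; near=> n; case/andP: (bn n).
- apply/cvg_lim => //; apply: cvg_near_cst; apply: subU.
  by exists m => // n /= mn; rewrite uE.
Unshelve. all: by end_near. Qed.

(** Membership by bounded partial sums turns the norm into a supremum, and every
    estimate into one on finite sums. *)
Definition l1_set (R : realType) : set (nat -> R) :=
  [set x : nat -> R | exists c, forall n, \sum_(k < n) `|x k| <= c].

Definition l1_norm (R : realType) (x : nat -> R) : R :=
  sup (range (fun n => \sum_(k < n) `|x k|)).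

Section L1Norm.
Context {R : realType}.
Implicit Types x y : nat -> R.

Lemma l1_partial x n : l1_set x -> \sum_(k < n) `|x k| <= l1_norm x.
Proof.
move=> [c xc]; apply: ub_le_sup; last by exists n.
by exists c => _ [m _ <-].
Qed.

Lemma l1_norm_le x c : (forall n, \sum_(k < n) `|x k| <= c) -> l1_norm x <= c.
Proof.
move=> xc; apply: ge_sup; first by exists (\sum_(k < 0) `|x k|); exists 0%N.
by move=> _ [n _ <-].
Qed.

Lemma l1_partialD x y n :
  \sum_(k < n) `|x k + y k| <= \sum_(k < n) `|x k| + \sum_(k < n) `|y k|.
Proof. by rewrite -big_split; apply: ler_sum => k _; exact: ler_normD. Qed.

Lemma l1_partialZ (a : R) x n :
  \sum_(k < n) `|a * x k| = `|a| * \sum_(k < n) `|x k|.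
Proof. by rewrite mulr_sumr; apply: eq_bigr => k _; rewrite normrM. Qed.

Lemma l1_set0 : @l1_set R 0.
Proof. by exists 0 => n; rewrite big1 // => k _; rewrite normr0. Qed.

Lemma l1_setD x y : l1_set x -> l1_set y -> l1_set (x + y).
Proof.
move=> [c xc] [d yd]; exists (c + d) => n.
by apply: le_trans (l1_partialD x y n) _; exact: lerD.
Qed.

Lemma l1_setZ a x : l1_set x -> l1_set (a *: x).
Proof.
move=> [c xc]; exists (`|a| * c) => n.
by apply: le_trans (_ : `|a| * \sum_(k < n) `|x k| <= _); [rewrite -l1_partialZ|rewrite ler_wpM2l].
Qed.

Lemma l1_coord x k : l1_set x -> `|x k| <= l1_norm x.
Proof.
move=> Lx; apply: le_trans (l1_partial k.+1 Lx).
by rewrite big_ord_recr /= lerDr sumr_ge0.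
Qed.

End L1Norm.

Definition l1_pred (R : realType) : {pred (nat -> R : lmodType R)} :=
  mem (@l1_set R).

Lemma l1_submod_closed (R : realType) : submod_closed (@l1_pred R).
Proof.
split; first by rewrite inE; exact: l1_set0.
by move=> a x y; rewrite !inE => Lx Ly; apply: l1_setD => //; exact: l1_setZ.
Qed.

HB.instance Definition _ (R : realType) :=
  GRing.isSubmodClosed.Build R _ (@l1_pred R) (@l1_submod_closed R).

Record l1 (R : realType) := L1 { l1f :> nat -> R; l1fP : l1f \in @l1_pred R }.

Section L1.
Context {R : realType}.

HB.instance Definition _ := [isSub for @l1f R].
HB.instance Definition _ := gen_eqMixin (l1 R).
HB.instance Definition _ := gen_choiceMixin (l1 R).
HB.instance Definition _ := [SubChoice_isSubLmodule of l1 R by <:].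

Lemma l1P (x : l1 R) : l1_set x.
Proof. by have := l1fP x; rewrite inE. Qed.

Let nrm (x : l1 R) : R := l1_norm x.

Lemma l1_ler_normD x y : nrm (x + y) <= nrm x + nrm y.
Proof.
apply: l1_norm_le => n; apply: le_trans (l1_partialD x y n) _.
by apply: lerD; apply: l1_partial; exact: l1P.
Qed.

Lemma l1_normrZ (a : R) x : nrm (a *: x) = `|a| * nrm x.
Proof.
have le b z : nrm (b *: z) <= `|b| * nrm z.
  apply: l1_norm_le => n; apply: le_trans (_ : `|b| * \sum_(k < n) `|z k| <= _).
    by rewrite -l1_partialZ.
  by rewrite ler_wpM2l // l1_partial //; exact: l1P.
apply/eqP; rewrite eq_le le /=.
have [->|a0] := eqVneq a 0.
  rewrite normr0 mul0r; apply: le_trans (l1_partial 0 (l1P _)).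
  by rewrite big_ord0.
rewrite -ler_pdivlMl ?normr_gt0 //; apply: le_trans (_ : nrm (a^-1 *: (a *: x)) <= _).
  by rewrite scalerA mulVf // scale1r.
by rewrite -normfV le.
Qed.

Lemma l1_normr0_eq0 x : nrm x = 0 -> x = 0.
Proof.
move=> x0; apply/val_inj/funext => k; have := l1_coord k (l1P x).
by rewrite -/(nrm x) x0 normr_le0 => /eqP.
Qed.

HB.instance Definition _ := Lmodule_isNormed.Build R (l1 R)
  l1_ler_normD l1_normrZ l1_normr0_eq0.

Lemma l1_normE (x : l1 R) : `|x| = l1_norm x.
Proof. by []. Qed.

Lemma l1_complete (F : set_system (l1 R)) : ProperFilter F -> cauchy F -> cvg F.
Proof.
move=> PF /cauchyP cF.
have cau eps : 0 < eps -> exists2 A : set (l1 R), F A &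
    forall x y, A x -> A y -> `|x - y| <= eps.
  move=> e0; have [|z Fz] := cF (eps / 2); first by rewrite divr_gt0.
  exists (ball z (eps / 2)) => // x y.
  rewrite -ball_normE /= => hx hy; apply: le_trans (ler_distD z x y) _.
  rewrite (distrC x z) (splitr eps); apply/ltW/ltrD => //.
pose co k (x : l1 R) : R := x k.
have cco k : cvg (co k @ F).
  apply: cauchy_cvg; apply/cauchyP => eps e0.
  have [|A FA HA] := cau (eps / 2); first by rewrite divr_gt0.
  have [x Ax] := filter_ex FA.
  exists (x k); rewrite -ball_normE /=.
  suff : F [set y : l1 R | `|x k - y k| < eps] by [].
  apply: filterS FA => y Ay /=; apply: (@le_lt_trans _ _ `|x - y|).
    by rewrite l1_normE; exact: (l1_coord k (l1P (x - y))).
  by apply: le_lt_trans (HA _ _ Ax Ay) _; lra.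
pose a k : R := lim (co k @ F).
have close eps x (A : set (l1 R)) : F A -> (forall y z, A y -> A z -> `|y - z| <= eps) ->
    A x -> forall n, \sum_(k < n) `|x k - a k| <= eps.
  move=> FA HA Ax n; apply: le_eps => d d0.
  pose d' := d / n.+1%:R.
  have d'0 : 0 < d' by rewrite divr_gt0.
  have [y [Ay Hy]] : exists y, A y /\ forall k, (k < n)%N -> `|a k - y k| < d'.
    suff : F (A `&` [set y | forall k, (k < n)%N -> `|a k - y k| < d']).
      by move=> /filter_ex[y [Ay Hy]]; exists y.
    apply: filterI => //.
    elim: (n) => [|m IH]; first by apply: filterE => y k.
    have /cvgrPdist_lt/(_ _ d'0) Fm : co m @ F --> a m by exact: cco.
    apply: filterS2 IH Fm => y h1 h2 k; rewrite ltnS leq_eqVlt => /predU1P[->//|].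
    exact: h1.
  apply: (@le_trans _ _ (\sum_(k < n) `|x k - y k| + \sum_(k < n) d')).
    rewrite -big_split; apply: ler_sum => k _ /=.
    apply: le_trans (ler_distD (y k) _ _) _; rewrite lerD2l distrC; exact/ltW/Hy.
  apply: lerD; first exact: le_trans (l1_partial n (l1P (x - y))) (HA _ _ Ax Ay).
  rewrite sumr_const card_ord /d' -[_ *+ n]mulr_natr -mulrA ler_piMr ?ltW //.
  by rewrite mulrC ltr_pdivrMr // mul1r ltr_nat.
have [A1 FA1 HA1] := cau 1 ltr01; have [x1 Ax1] := filter_ex FA1.
have La : l1_set a.
  have -> : a = (x1 : nat -> R) - (fun k => x1 k - a k).
    by apply/funext => k; rewrite fctE opprB addrC subrK.
  rewrite -scaleN1r; apply: l1_setD; first exact: l1P.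
  by apply: l1_setZ; exists 1; exact: (close 1 x1 A1).
have la : a \in @l1_pred R by rewrite inE.
apply/cvg_ex; exists (L1 la); apply/cvgrPdist_le => eps e0.
have [A FA HA] := cau eps e0; apply: filterS (FA) => x Ax.
by rewrite distrC l1_normE; apply: l1_norm_le; exact: (close eps x A).
Qed.

HB.instance Definition _ := Uniform_isComplete.Build (l1 R) l1_complete.

End L1.

Lemma sum_abs_e (R : realType) m n :
  \sum_(k < m) `|@e_ R n k| = (n < m)%:R.
Proof.
have [nm|mn] := ltnP n m.
  rewrite (bigD1 (Ordinal nm)) //= /e_ eqxx normr1 big1 ?addr0 // => k kn.
  by case: eqP => [kn'|]; rewrite ?normr0 //; case/eqP: kn; apply/val_inj.
rewrite big1 // => k _; rewrite /e_; case: eqP => [kn|]; rewrite ?normr0 //.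
by move: (ltn_ord k); rewrite kn ltnNge mn.
Qed.

Lemma l1_e_subproof (R : realType) n : @e_ R n \in @l1_pred R.
Proof.
by rewrite inE; exists 1 => m; rewrite sum_abs_e; case: ltnP => _; rewrite ?lexx ?ler01.
Qed.

(** Along the unit vector basis, a generalised limit is a functional on the
    dual that vanishes on the coordinate functionals but not on the functional
    summing all coordinates. *)
Theorem l1_not_reflexive (R : realType) : ~ reflexive_space (l1 R).
Proof.
move=> refl; have [L [Llin Lle Lcst]] := generalized_limit R.
pose e n : l1 R := L1 (l1_e_subproof R n).
have e1 n : `|e n| <= 1.
  by apply: l1_norm_le => m; rewrite sum_abs_e; case: ltnP => _; rewrite ?lexx ?ler01.
pose phi (f : l1 R -> R) : R := L (fun n => f (e n)).
have dual_le (f : l1 R -> R) : dual (l1 R) f -> forall n, `|f (e n)| <= nm (dual (l1 R)) f.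
  move=> [c [c0 _ fc]] n; apply: ub_le_sup; last by exists (e n) => //; exact: e1.
  exists c => _ [z /= z1 <-]; have [_] := fc z I.
  by move=> h; apply: le_trans h _; rewrite ler_piMr.
have [|z Hz] := refl phi.
  exists 1; split=> //.
    move=> a f g Df Dg; exact: Llin (dual_le f Df) (dual_le g Dg).
  by move=> f Df; split=> //; rewrite mul1r; apply: Lle; exact: dual_le.
have z0 : z = 0.
  apply/val_inj/funext => k /=.
  pose ck (x : l1 R) : R := x k.
  have Dck : dual (l1 R) ck.
    by exists 1; split=> // x _; split=> //; rewrite mul1r; apply: (l1_coord k (l1P x)).
  have := Hz _ Dck; rewrite /ck => <-; apply: (Lcst _ _ k.+1) => n kn.
  by rewrite /= /e_ ltn_eqF.
pose s (x : l1 R) : R := L (fun n => \sum_(k < n) x k).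
have sb (x : l1 R) n : `|\sum_(k < n) x k| <= `|x|.
  by apply: le_trans (ler_norm_sum _ _ _) _; exact: l1_partial (l1P x).
have Ds : dual (l1 R) s.
  exists 1; split=> // [a x y _ _|x _]; last first.
    by split=> //; rewrite mul1r; apply: Lle; exact: sb.
  rewrite /s -(Llin _ _ _ _ _ (sb x) (sb y)); congr (L _); apply/funext => n.
  by rewrite !fctE /= scaler_sumr -big_split.
have := Hz s Ds; rewrite z0 (_ : phi s = 1).
  rewrite (_ : s 0 = 0); first by move/eqP; rewrite oner_eq0.
  by apply: (Lcst _ _ 0%N) => n _; rewrite big1.
apply: (Lcst _ _ 0%N) => n _; apply: (Lcst _ _ n.+1) => m nm.
rewrite (bigD1 (Ordinal nm)) //= /e_ eqxx big1 ?addr0 // => k kn.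
by case: eqP => // kn'; case/eqP: kn; apply/val_inj.
Qed.

(** * Super-reflexive spaces are B-convex *)

(** Let m be the sum of the |a_i|. Then m times the signed sum with the signs of
    the a_i differs from the sum of the a_i x_i by the coefficients m - |a_i|
    only, whose sum is (n - 1) m. *)
Lemma james_l1 (R : realType) (V : lmodType R) (X : nspace V) n (r : R)
    (x : nat -> V) : is_normed X -> (forall i, X (x i) /\ nm X (x i) <= 1) ->
  (forall e : nat -> bool, (1 - r) * n%:R <= nm X (\sum_(i < n) (-1) ^+ e i *: x i)) ->
  0 <= r -> forall a : nat -> R,
  (1 - n%:R * r) * \sum_(i < n) `|a i| <= nm X (\sum_(i < n) a i *: x i).
Proof.
move=> nX xb H r0 a; have qX := normed_quasi nX.
have Xx i : X (x i) by case: (xb i).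
pose m := \sum_(i < n) `|a i|.
have m0 : 0 <= m by apply: sumr_ge0.
have am (i : 'I_n) : `|a i| <= m by rewrite /m (bigD1 i) //= lerDl sumr_ge0.
pose e i := a i < 0.
have sgna i : (-1) ^+ e i * `|a i| = a i.
  rewrite /e; case: ltrP => [h|h]; first by rewrite ltr0_norm // expr1 mulN1r opprK.
  by rewrite ger0_norm // expr0 mul1r.
have Xs (b : nat -> R) : X (\sum_(i < n) b i *: x i).
  by apply: (qn_sum qX) => i _; apply: (qnZ qX).
have E : m *: (\sum_(i < n) (-1) ^+ e i *: x i) =
    \sum_(i < n) a i *: x i + \sum_(i < n) ((-1) ^+ e i * (m - `|a i|)) *: x i.
  rewrite scaler_sumr -big_split; apply: eq_bigr => i _ /=.
  by rewrite scalerA -scalerDl mulrBr sgna addrC subrK mulrC.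
have h1 : nm X (m *: (\sum_(i < n) (-1) ^+ e i *: x i)) <=
    nm X (\sum_(i < n) a i *: x i) + \sum_(i < n) (m - `|a i|).
  rewrite E; apply: le_trans
    (normed_triangle nX (Xs a) (Xs (fun i => (-1) ^+ e i * (m - `|a i|)))) _.
  rewrite lerD2l; elim: (n) (am) => [|k IH] amk; first by rewrite !big_ord0 (qn_nm0 qX).
  rewrite !big_ord_recr /=; apply: le_trans (normed_triangle nX _ _) _.
  - by apply: (qn_sum qX) => i _; apply: (qnZ qX).
  - exact: (qnZ qX).
  apply: lerD; first by apply: IH => i; exact: (amk (widen_ord (leqnSn k) i)).
  have am' : 0 <= m - `|a k| by rewrite subr_ge0; exact: (amk ord_max).
  rewrite (qn_scale qX) // normrM normrX normrN1 expr1n mul1r (ger0_norm am').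
  by rewrite -[leRHS]mulr1 ler_wpM2l //; case: (xb k).
rewrite (qn_scale qX) ?(ger0_norm m0) in h1; last exact: (Xs (fun i => (-1) ^+ e i)).
have h2 := ler_wpM2l m0 (H e).
rewrite sumrB sumr_const card_ord -/m -[m *+ n]mulr_natr in h1.
apply: le_trans (_ : m * ((1 - r) * n%:R) - (m * n%:R - m) <= _); last lra.
rewrite le_eqVlt; apply/orP; left; apply/eqP; rewrite -/m; ring.
Qed.

Lemma l1_tail (R : realType) (w : l1 R) (d : R) : 0 < d ->
  exists n0, forall n m, (n0 <= n <= m)%N ->
    \sum_(k < m) `|w k| - \sum_(k < n) `|w k| <= d.
Proof.
move=> d0.
have [_ [n0 _ <-] hn0] : exists2 s, range (fun n => \sum_(k < n) `|w k|) s &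
    l1_norm w - d < s.
  apply: sup_adherent => //; split; first by exists (\sum_(k < 0) `|w k|); exists 0%N.
  by have [c Hc] := l1P w; exists c => _ [n _ <-].
exists n0 => n m /andP[n0n nm].
have := l1_partial m (l1P w).
suff : \sum_(k < n0) `|w k| <= \sum_(k < n) `|w k| by lra.
rewrite -(subnKC n0n) big_split_ord /= lerDl; exact: sumr_ge0.
Qed.

(** Otherwise X contains, for every n, vectors almost isometric to the unit
    vectors of an n-dimensional l1. Every finite-dimensional subspace of l1 is
    almost contained in the span of finitely many unit vectors, so that l1 would
    be finitely representable in X, hence reflexive. *)
Theorem super_reflexive_B_convex (R : realType) (V : lmodType R) (X : nspace V) :
  is_normed X -> super_reflexive X ->
  exists J (r : R), [/\ (0 < J)%N, 0 < r, r < 1 & signed_small X (2 ^ J) (r * 2 ^+ J)].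
Proof.
move=> nX sX; have qX := normed_quasi nX.
apply: contrapT => noJ; apply: (@l1_not_reflexive R); apply: sX.
move=> E [n [v ->]] eps eps0.
have sep (x : l1 R) : (forall k, x k = 0) -> x = 0.
  by move=> x0; apply/val_inj/funext => k /=; rewrite x0.
have [w [g [m [h [gE [xE _]]]]]] := @finite_dim_dual_system R (l1 R)
  (fun k x => x k) (fun k a x y => erefl) sep n
  (fun i => if insub i is Some j then v j else 0).
pose s := Num.min (1 / 2) (eps / (2 * (1 + eps))).
have s0 : 0 < s by rewrite lt_min; apply/andP; split; rewrite ?divr_gt0 // mulr_gt0 //; lra.
have s12 : s <= 1 / 2 by rewrite ge_min lexx.
have s2 : s * (2 * (1 + eps)) <= eps.
  by rewrite -ler_pdivlMr ?mulr_gt0 //; [rewrite ge_min lexx orbT|lra].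
pose G i := \sum_(k < m) `|h i k|.
have G0 i : 0 <= G i by apply: sumr_ge0.
have gG i x : `|g i x| <= G i * `|x|.
  rewrite gE mulr_suml; apply: le_trans (ler_norm_sum _ _ _) _.
  by apply: ler_sum => k _; rewrite normrM ler_wpM2l // (l1_coord k (l1P x)).
pose SG := \sum_(i < n) G i.
have SG0 : 0 <= SG by apply: sumr_ge0.
have [N0 HN0] : exists N0, forall N M i, (N0 <= N <= M)%N -> (i < n)%N ->
    \sum_(k < M) `|w i k| - \sum_(k < N) `|w i k| <= s / (SG + 1).
  have /choice[f Hf] i := @l1_tail R (w i) (s / (SG + 1)) ltac:(by rewrite divr_gt0 //; lra).
  exists (\sum_(i < n) f i)%N => N M i /andP[h1 h2] ni; apply: Hf; rewrite h2 andbT.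
  by apply: leq_trans h1; rewrite (bigD1 (Ordinal ni)) //= leq_addr.
pose J := N0.+1; pose N := (2 ^ J)%N.
have N0N : (N0 <= N)%N by apply: ltnW; apply: ltn_trans (ltnSn _) _; exact: ltn_expl.
have Npos : 0 < N%:R :> R by rewrite ltr0n expn_gt0.
pose r := s / N%:R.
have r0 : 0 < r by rewrite divr_gt0.
have rs : r <= s by rewrite ler_pdivrMr // ler_peMr ?(ltW s0) // ler1n expn_gt0.
have [x [xb xe]] : exists x : nat -> V, (forall i, X (x i) /\ nm X (x i) <= 1) /\
    forall e : nat -> bool, (1 - r) * N%:R <= nm X (\sum_(i < N) (-1) ^+ e i *: x i).
  apply: contrapT => Hx; apply: noJ; exists J, (1 - r); split=> //; try lra.
  move=> x xb; apply: contrapT => Hn; apply: Hx; exists x; split=> // e.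
  rewrite leNgt; apply/negP => He; apply: Hn; exists e.
  by rewrite -natrX; exact: ltW.
have low := james_l1 nX xb xe (ltW r0).
have rN : 1 - N%:R * r = 1 - s by rewrite /r mulrC divfK ?gt_eqF.
rewrite rN in low.
pose c := ((1 - s) ^+ 2)^-1.
have s1 : 0 < 1 - s by lra.
have c0 : 0 < c by rewrite invr_gt0 exprn_gt0.
exists (fun z : l1 R => c *: \sum_(k < N) z k *: x k); split=> [a z z' _ _|z Ez].
  rewrite scalerA mulrC -scalerA -scalerDr; congr (_ *: _).
  rewrite scaler_sumr -big_split; apply: eq_bigr => k _ /=.
  by rewrite scalerA -scalerDl.
have Xs : X (\sum_(k < N) z k *: x k).
  by apply: (qn_sum qX) => i _; apply: (qnZ qX); case: (xb i).
split; first exact: (qnZ qX).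
rewrite (qn_scale qX) // gtr0_norm //.
have up : nm X (\sum_(k < N) z k *: x k) <= \sum_(k < N) `|z k|.
  elim: (N) => [|k IH]; first by rewrite !big_ord0 (qn_nm0 qX).
  rewrite !big_ord_recr /=; apply: le_trans (normed_triangle nX _ _) _.
  - by apply: (qn_sum qX) => i _; apply: (qnZ qX); case: (xb i).
  - by apply: (qnZ qX); case: (xb k).
  apply: lerD => //; rewrite (qn_scale qX); last by case: (xb k).
  by rewrite ler_piMr //; case: (xb k).
have zN : `|z| <= \sum_(k < N) `|z k| + s * `|z|.
  apply: l1_norm_le => M.
  have [MN|NM] := leqP M N.
    apply: le_trans (_ : \sum_(k < N) `|z k| <= _); last by rewrite lerDl mulr_ge0 // ltW.
    by rewrite -(subnKC MN) big_split_ord /= lerDl sumr_ge0.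
  have zE : z = \sum_(i < n) g i z *: w i.
    have [a az] := Ez.
    have := xE (fun i => if insub i is Some j then a j else 0); rewrite /=.
    have -> : \sum_(i < n) (if insub (i : nat) is Some j then a j else 0) *:
        (if insub (i : nat) is Some j then v j else 0) = z.
      by rewrite az; apply: eq_bigr => i _; rewrite valK.
    by [].
  have zk k : `|z k| <= \sum_(i < n) `|g i z| * `|w i k|.
    have -> : z k = \sum_(i < n) g i z * w i k.
      rewrite {1}zE; elim: (n) => [|l IH]; first by rewrite !big_ord0.
      by rewrite !big_ord_recr /= -IH.
    by apply: le_trans (ler_norm_sum _ _ _) _; apply: ler_sum => i _; rewrite normrM.
  rewrite -(subnKC (ltnW NM)) big_split_ord /= lerD2l.
  apply: le_trans (_ : \sum_(l < M - N) \sum_(i < n) `|g i z| * `|w i (N + l)%N| <= _).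
    by apply: ler_sum => l _; exact: zk.
  rewrite exchange_big /=.
  apply: le_trans (_ : \sum_(i < n) G i * `|z| * (s / (SG + 1)) <= _).
    apply: ler_sum => i _; rewrite -mulr_sumr.
    apply: ler_pM => //; first exact: sumr_ge0.
    have := HN0 N M i; rewrite N0N (ltnW NM) => /(_ isT (ltn_ord i)).
    suff -> : \sum_(k < M) `|w i k| = \sum_(k < N) `|w i k| + \sum_(l < M - N) `|w i (N + l)%N|.
      by rewrite addrC addKr.
    by rewrite -[in LHS](subnKC (ltnW NM)) big_split_ord.
  rewrite -mulr_suml -mulr_suml -/SG.
  have -> : SG * `|z| * (s / (SG + 1)) = (SG / (SG + 1)) * (s * `|z|) by ring.
  rewrite ler_piMl ?mulr_ge0 ?(ltW s0) // ler_pdivrMr; lra.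
have z0 : 0 <= `|z| by [].
have zN' : (1 - s) * `|z| <= \sum_(k < N) `|z k| by lra.
apply/andP; split.
  rewrite /c ler_pdivlMl ?exprn_gt0 //.
  apply: le_trans (low z); rewrite expr2 -mulrA ler_wpM2l //; exact: ltW.
have h1 : nm X (\sum_(k < N) z k *: x k) <= `|z|.
  by apply: le_trans up _; exact: l1_partial (l1P z).
apply: le_trans (ler_wpM2l (ltW c0) h1) _; apply: ler_wpM2r => //.
rewrite /c invf_ple ?posrE ?exprn_gt0 //; last lra.
rewrite -[_^-1]mul1r ler_pdivrMr; last lra.
by have := sqr_ge0 s; rewrite !expr2; nra.
Qed.

(** * Convexity of twisted sums of B-convex spaces *)

Lemma geometric_beats_linear (R : realType) (r a b d : R) :
  0 < r -> r < 1 -> 0 <= a -> 0 <= b -> 0 < d ->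
  exists2 k, (0 < k)%N & r ^+ k * (a + b * k%:R) <= d.
Proof.
move=> r0 r1 a0 b0 d0; pose t := r^-1 - 1.
have t0 : 0 < t by rewrite subr_gt0 invf_gt1.
have bern k : 1 + k%:R * t <= r^-1 ^+ k.
  elim: k => [|k IH]; first by rewrite mul0r addr0 expr0.
  rewrite exprS -natr1; have -> : r^-1 = 1 + t by rewrite /t addrC subrK.
  have h : 0 <= 1 + t by lra.
  have := ler_wpM2l h IH; have -> : r^-1 = 1 + t by rewrite /t addrC subrK.
  have : 0 <= k%:R * t * t by rewrite !mulr_ge0 // ltW.
  lra.
pose M := (a + 2 * b) / (d * t ^+ 2).
have [k kM] : exists k : nat, M < k%:R.
  by exists (Num.truncn M).+1; have := truncnS_gt M.
exists (k.+1 + k.+1)%N => //.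
have k1 : 1 <= k.+1%:R :> R by rewrite ler1n.
have h1 : k.+1%:R * t <= r^-1 ^+ k.+1 by apply: le_trans (bern _); rewrite lerDr.
have h2 : (k.+1%:R * t) * (k.+1%:R * t) <= r^-1 ^+ k.+1 * r^-1 ^+ k.+1.
  by apply: ler_pM => //; rewrite mulr_ge0 // ltW.
rewrite exprD.
have kM' : M <= k.+1%:R by rewrite -natr1; lra.
have h3 : a + 2 * b <= k.+1%:R * (d * t ^+ 2).
  by rewrite -ler_pdivrMr // mulr_gt0 // exprn_gt0.
set K := k.+1%:R in k1 h1 h2 h3 *.
rewrite natrD -/K exprVn in h2 *.
have p0 : 0 < r ^+ k.+1 by rewrite exprn_gt0.
have h4 : r ^+ k.+1 * r ^+ k.+1 * ((K * t) * (K * t)) <= 1.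
  set p := r ^+ k.+1 in p0 h2 *.
  have -> : 1 = p * p * (p^-1 * p^-1) by field; rewrite gt_eqF.
  by rewrite ler_pM2l // mulr_gt0.
set P := r ^+ k.+1 * r ^+ k.+1 in h4 *.
have P0 : 0 <= P by rewrite mulr_ge0 // ltW.
have h5 : a + b * (K + K) <= d * (K * t * (K * t)).
  apply: le_trans (_ : (a + 2 * b) * K <= _).
    have : a <= a * K by rewrite ler_peMr.
    lra.
  have K0 : 0 <= K by lra.
  have := ler_wpM2r K0 h3; rewrite expr2; lra.
have := ler_wpM2l P0 h5; have := ler_wpM2l (ltW d0) h4; lra.
Qed.

Section TwistedConvex.
Context {R : realType} {X : nspace (nat -> R : lmodType R)}.
Hypothesis HX : sequence_space X.
Let nX := seqsp_quasi HX.
Context {Omega : (nat -> R) -> (nat -> R)} {D : R}.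
Hypothesis HO : centralizer_le X Omega D.
Local Notation Y := (twisted_sum X Omega).
Let qY := tw_quasi HX HO.
Let seq2 := ((nat -> R) * (nat -> R) : lmodType R)%type.

Let tv (p : seq2) : nat -> R := p.2 - Omega p.1.

Lemma tv_sign (b : bool) p : Y p -> tv ((-1) ^+ b *: p) = (-1) ^+ b *: tv p.
Proof. by case=> X1 _; rewrite /tv /= (cz_hom HO) // scalerBr. Qed.

Lemma tv_sum j t (p : nat -> seq2) : 0 <= t ->
  (forall i, Y (p i) /\ nm X (p i).1 <= t) ->
  nm X (tv (\sum_(i < 2 ^ j) p i)) <=
  nm X (\sum_(i < 2 ^ j) tv (p i)) + 3 * D * j%:R * 2 ^+ j * t.
Proof.
move=> t0 pt.
have [X1 n1] := cz_sum_dyadic HX HO j (x := fun i => (p i).1) t0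
  (fun i => conj (pt i).1.1 (pt i).2).
have -> : tv (\sum_(i < 2 ^ j) p i) = \sum_(i < 2 ^ j) tv (p i) -
    (Omega (\sum_(i < 2 ^ j) (p i).1) - \sum_(i < 2 ^ j) Omega (p i).1).
  rewrite /tv pair_sumE /= sumrB; move: (\sum_(i < _) (p i).2) (\sum_(i < _) Omega _).
  by move=> a b; rewrite opprB addrC !addrA subrK addrC.
apply: le_trans (X_triangleB HX _ X1) _; last by rewrite lerD2l.
by apply: (qn_sum nX) => i _; case: (pt i) => -[].
Qed.

(** Signs are chosen twice, on [2 ^ j] blocks of [2 ^ j] vectors: inside the
    blocks to make the first coordinates small, then between the blocks to make
    the second coordinates small; the quasi-linearity of [Omega] costs a factor
    of order [j] only, which the geometric decay in X absorbs. *)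
Theorem tw_convex : super_reflexive X -> exists2 K, 1 <= K & dyadic_convex Y K.
Proof.
move=> sX; have D0 := cz_ge0 HO.
have [J [r [J0 r0 r1 HJ]]] := super_reflexive_B_convex (seqsp_normed HX) sX.
pose kap := (2 * (1 + 3 * D))^-1.
have kap0 : 0 < kap by rewrite invr_gt0; lra.
have [k k0 Hk] : exists2 k, (0 < k)%N & r ^+ k * (2 + 6 * D * J%:R * k%:R) <= kap.
  by apply: geometric_beats_linear => //; rewrite !mulr_ge0.
pose j := (k * J)%N; pose m := (2 ^ j)%N.
have Hj := signed_small_iter nX r0 HJ k; rewrite -/j in Hj.
have p0 : 0 < r ^+ k by rewrite exprn_gt0.
have m0 : 0 < 2 ^+ j :> R by rewrite exprn_gt0.
apply: (@signed_small_convex _ _ _ _ qY (j + j) kap) => //.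
- by rewrite addn_gt0 muln_gt0 k0 J0.
- by rewrite /kap mulfV //; lra.
move=> y yb.
have [e1 He1] : exists e : nat -> nat -> bool, forall g,
    nm X (\sum_(l < m) (-1) ^+ e g l *: (y (g * m + l)%N).1) <= r ^+ k * 2 ^+ j.
  have /choice[e He] g := Hj (fun l => (y (g * m + l)%N).1) ltac:(
    by move=> l; have [[X1 X2] /= hn] := yb (g * m + l)%N; split=> //;
       apply: le_trans hn; rewrite lerDl (qn_ge0 nX)).
  by exists e.
pose z g l : seq2 := (-1) ^+ e1 g l *: y (g * m + l)%N.
pose U g : seq2 := \sum_(l < m) z g l.
have Yz g l : Y (z g l) by apply: (qnZ qY); case: (yb (g * m + l)%N).
have YU g : Y (U g) by apply: (qn_sum qY).
have U1 g : nm X (U g).1 <= r ^+ k * 2 ^+ j.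
  by rewrite /U pair_sumE /=; exact: He1.
pose t := 2 ^+ j * (1 + 3 * D * j%:R).
have t0 : 0 < t by rewrite mulr_gt0 // ltr_wpDr // !mulr_ge0.
have U2 g : nm X (tv (U g)) <= t.
  apply: le_trans (tv_sum j ler01 (p := z g) _) _.
    move=> l; split=> //; have [[X1 X2] /= hn] := yb (g * m + l)%N.
    have [_ ->] := qn_sign nX (e1 g l) X1.
    by apply: le_trans hn; rewrite lerDl (qn_ge0 nX).
  rewrite mulr1 /t mulrDr mulr1; apply: lerD; last by rewrite mulrC.
  apply: le_trans (X_sum HX (n := m) (v := fun l => tv (z g l)) _) _.
    by move=> l _; case: (Yz g l).
  apply: (@le_trans _ _ (\sum_(l < m) (1 : R))).
    apply: ler_sum => l _; have [[X1 X2] /= hn] := yb (g * m + l)%N.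
    rewrite /z tv_sign; last by split.
    have [_ ->] := qn_sign nX (e1 g l) X2.
    by apply: le_trans hn; rewrite lerDr (qn_ge0 nX).
  by rewrite sumr_const card_ord natrX.
have [|e2 He2] := signed_small_scale nX Hj (t := t) (x := fun g => tv (U g)) t0.
  by move=> g; split=> //; case: (YU g).
pose W g : seq2 := (-1) ^+ e2 g *: U g.
exists (fun i => e2 (i %/ m)%N (+) e1 (i %/ m)%N (i %% m)%N).
have -> : \sum_(i < 2 ^ (j + j)) (-1) ^+ (e2 (i %/ m)%N (+) e1 (i %/ m)%N (i %% m)%N) *: y i
    = \sum_(g < m) W g.
  rewrite expnD (sum_ord_mul m m
    (fun i => (-1) ^+ (e2 (i %/ m)%N (+) e1 (i %/ m)%N (i %% m)%N) *: y i)).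
  apply: eq_bigr => g _; rewrite /W /U scaler_sumr; apply: eq_bigr => l _.
  have mp : (0 < m)%N by rewrite expn_gt0.
  rewrite divnMDl // divn_small // addn0 modnMDl modn_small //.
  by rewrite signr_addb scalerA.
have YW g : Y (W g) by apply: (qnZ qY).
have W1 g : nm X (W g).1 <= r ^+ k * 2 ^+ j.
  by have [_ ->] := qn_sign nX (e2 g) (YU g).1.
have P0 : 0 <= r ^+ k * 2 ^+ j by rewrite ltW // mulr_gt0.
have n2 := tv_sum j P0 (p := W) (fun g => conj (YW g) (W1 g)).
have n3 : nm X (\sum_(g < m) tv (W g)) <= r ^+ k * 2 ^+ j * t.
  by under eq_bigr => g _ do rewrite /W tv_sign //.
have n1 : nm X (\sum_(g < m) W g).1 <= 2 ^+ j * (r ^+ k * 2 ^+ j).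
  rewrite pair_sumE /=.
  apply: le_trans (X_sum HX (n := m) (v := fun g => (W g).1) _) _.
    by move=> g _; case: (YW g).
  apply: (@le_trans _ _ (\sum_(g < m) r ^+ k * 2 ^+ j)); first by apply: ler_sum => g _.
  by rewrite sumr_const card_ord -[_ *+ m]mulr_natl natrX.
change (nm X (\sum_(g < m) W g).1 + nm X (tv (\sum_(g < m) W g)) <= kap * 2 ^+ (j + j)).
have MM : 0 <= 2 ^+ j * 2 ^+ j :> R by rewrite mulr_ge0 // ltW.
have := ler_wpM2r MM Hk; rewrite exprD.
have -> : 6 * D * J%:R * k%:R = 6 * D * j%:R by rewrite /j natrM; ring.
move: n1 n2 n3; rewrite /t; set M := 2 ^+ j; set P := r ^+ k; set jj := j%:R.
lra.
Qed.

End TwistedConvex.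

(** * Riesz products and the diagonal of an unconditional decomposition *)

Section Riesz.
Context {R : realType} {N : nat}.
Local Notation S := {ffun 'I_N -> bool}.

Lemma card_signs : #|S| = (2 ^ N)%N.
Proof. by rewrite card_ffun card_bool card_ord. Qed.

Lemma avg_prod (A : comNzRingType) (F : 'I_N -> bool -> A) :
  \sum_(e : S) \prod_(k < N) F k (e k) = \prod_(k < N) (F k false + F k true).
Proof.
rewrite -(bigA_distr_bigA (fun k b => F k b)).
by apply: eq_bigr => k _; rewrite big_bool addrC.
Qed.

Lemma avg_sign_sign (k l : 'I_N) :
  (2 ^+ N)^-1 * \sum_(e : S) (-1) ^+ e k * (-1) ^+ e l = (k == l)%:R :> R.
Proof.
have [->|kl] := eqVneq k l.
  under eq_bigr => e _ do rewrite -expr2 sqrr_sign.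
  by rewrite sumr_const card_signs -[_ *+ _]mulr_natl mulr1 natrX mulVf // expf_neq0.
pose F (i : 'I_N) (b : bool) : R :=
  (if i == k then (-1) ^+ b else 1) * (if i == l then (-1) ^+ b else 1).
have -> : \sum_(e : S) (-1) ^+ e k * (-1) ^+ e l = \sum_(e : S) \prod_(i < N) F i (e i).
  apply: eq_bigr => e _; rewrite big_split /=.
  by congr (_ * _); rewrite -big_mkcond big_pred1_eq.
rewrite avg_prod (bigD1 k) //= /F eqxx (negbTE kl) !mulr1 expr0 expr1 subrr mul0r mulr0 //.
Qed.

Definition sqmod (z : R[i]) : R := complex.Re z ^+ 2 + complex.Im z ^+ 2.

Lemma sqmodM (z w : R[i]) : sqmod (z * w) = sqmod z * sqmod w.
Proof. by case: z => a b; case: w => c d; rewrite /sqmod /=; ring. Qed.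

Lemma prod_1D_le (t : nat -> R) n :
  \sum_(k < n) t k ^+ 2 <= 1 ->
  (\prod_(k < n) (1 + t k ^+ 2)) * (1 - \sum_(k < n) t k ^+ 2) <= 1.
Proof.
elim: n => [|n IH]; first by rewrite !big_ord0 subr0 mulr1.
rewrite !big_ord_recr /=; set P := \prod_(_ < n) _; set s := \sum_(_ < n) _.
move=> h; have q0 := sqr_ge0 (t n); set q := t n ^+ 2 in q0 h *.
have {}IH : P * (1 - s) <= 1 by apply: IH; rewrite -/s; lra.
have P0 : 0 <= P by apply: prodr_ge0 => k _; rewrite addr_ge0 // sqr_ge0.
have s0 : 0 <= s by apply: sumr_ge0 => k _; exact: sqr_ge0.
have sq : 0 <= s + q by apply: addr_ge0.
have : 0 <= P * (q * (s + q)) by apply/mulr_ge0/mulr_ge0.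
lra.
Qed.

(** The imaginary part of the Riesz product of the 1 + i eps_k t_k is a bounded
    function of the signs whose correlation with eps_k is t_k. *)
Lemma riesz (rho : R) (b : nat -> R) : 0 <= rho ->
  \sum_(k < N) b k ^+ 2 <= rho ^+ 2 ->
  exists g : S -> R, (forall e, `|g e| <= 4 * rho) /\
    forall k : 'I_N, (2 ^+ N)^-1 * \sum_(e : S) (-1) ^+ e k * g e = b k.
Proof.
rewrite le_eqVlt => /predU1P[<-|rho0] hb.
  exists (fun=> 0); split=> [e|k]; first by rewrite normr0 mulr0.
  rewrite big1 ?mulr0 => [|e _]; last by rewrite mulr0.
  have : b k ^+ 2 <= 0.
    rewrite expr0n /= in hb; apply: le_trans hb; rewrite (bigD1 k) //= lerDl.
    by apply: sumr_ge0 => i _; exact: sqr_ge0.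
  by rewrite exprn_even_le0 //= => /eqP ->.
pose t k := b k / (2 * rho).
have r2 : 2 * rho != 0 by rewrite gt_eqF // mulr_gt0.
have bt k : b k = 2 * rho * t k by rewrite /t mulrC divfK.
have ht : \sum_(k < N) t k ^+ 2 <= 1 / 4.
  have : \sum_(k < N) b k ^+ 2 = (4 * rho ^+ 2) * \sum_(k < N) t k ^+ 2.
    by rewrite mulr_sumr; apply: eq_bigr => k _; rewrite bt; ring.
  move=> E; rewrite E in hb; have p : 0 < 4 * rho ^+ 2 by rewrite mulr_gt0 // exprn_gt0.
  rewrite -(ler_pM2l p); apply: le_trans hb _; lra.
have one : \sum_(k < N) t k ^+ 2 <= 1 by lra.
have P2 : \prod_(k < N) (1 + t k ^+ 2) <= 4.
  have := prod_1D_le one.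
  have P0 : 0 <= \prod_(k < N) (1 + t k ^+ 2).
    by apply: prodr_ge0 => k _; rewrite addr_ge0 // sqr_ge0.
  nra.
pose f (k : 'I_N) (c : bool) : R[i] := Complex 1 ((-1) ^+ c * t k).
pose G (e : S) : R[i] := \prod_(k < N) f k (e k).
have sqG e : sqmod (G e) = \prod_(k < N) (1 + t k ^+ 2).
  rewrite /G (big_morph sqmod sqmodM (_ : sqmod 1 = 1)); last by rewrite /sqmod /=; ring.
  by apply: eq_bigr => k _; rewrite /sqmod /= exprMn sqrr_sign; ring.
exists (fun e => 2 * rho * complex.Im (G e)); split=> [e|k].
  rewrite normrM gtr0_norm ?mulr_gt0 //.
  have : complex.Im (G e) ^+ 2 <= 2 ^+ 2.
    have := sqG e; rewrite /sqmod; have := sqr_ge0 (complex.Re (G e)); lra.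
  rewrite -real_normK ?num_real // ler_sqr ?nnegrE // => h.
  have -> : 4 * rho = 2 * rho * 2 by ring.
  by rewrite ler_pM2l // mulr_gt0.
pose h (i : 'I_N) (c : bool) : R[i] := (if i == k then Complex ((-1) ^+ c) 0 else 1) * f i c.
have hE (e : S) : \prod_(i < N) h i (e i) = Complex ((-1) ^+ e k) 0 * G e.
  by rewrite big_split /= -/(G e) -big_mkcond big_pred1_eq.
have sumh i : h i false + h i true = (Complex 2 0) * (if i == k then Complex 0 (t k) else 1).
  rewrite /h /f; case: eqP => [->|_]; apply/eqP; rewrite eq_complex /=; apply/andP; split;
    apply/eqP; rewrite ?expr0 ?expr1; ring.
have ImM (x : R) (z : R[i]) : complex.Im (Complex x 0 * z) = x * complex.Im z.
  by case: z => p q /=; rewrite mul0r addr0.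
have pow2 n : \prod_(i < n) Complex (2 : R) 0 = Complex (2 ^+ n) 0.
  elim: n => [|n IH]; first by rewrite big_ord0 expr0.
  rewrite big_ord_recr /= IH exprS; apply/eqP; rewrite eq_complex /=; apply/andP; split;
    apply/eqP; ring.
have key : \sum_(e : S) (-1) ^+ e k * complex.Im (G e) = 2 ^+ N * t k.
  have <- : complex.Im (\sum_(e : S) \prod_(i < N) h i (e i)) =
    \sum_(e : S) (-1) ^+ e k * complex.Im (G e).
    pose im (z : R[i]) := complex.Im z; rewrite -/(im _).
    have imD : {morph im : x y / x + y} by case=> a1 b1 [a2 b2].
    rewrite (big_morph im imD (erefl : im 0 = 0)).
    by apply: eq_bigr => e _; rewrite hE /im ImM.
  rewrite avg_prod; under eq_bigr => i _ do rewrite sumh.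
  by rewrite big_split /= pow2 -big_mkcond big_pred1_eq ImM.
under eq_bigr => e _ do rewrite mulrCA.
rewrite -mulr_sumr key [RHS]bt mulrCA; congr (_ * _).
by rewrite mulKf // expf_neq0.
Qed.

(** Khintchine's inequality follows from the Riesz product by duality. *)
Lemma khintchine (a : nat -> R) :
  Num.sqrt (\sum_(k < N) a k ^+ 2) <=
  4 * ((2 ^+ N)^-1 * \sum_(e : S) `|\sum_(k < N) (-1) ^+ e k * a k|).
Proof.
set s := \sum_(k < N) _; have s0 : 0 <= s by apply: sumr_ge0 => k _; exact: sqr_ge0.
have [rho0|] := eqVneq (Num.sqrt s) 0.
  by rewrite rho0 !mulr_ge0 ?invr_ge0 ?exprn_ge0 // sumr_ge0.
set rho := Num.sqrt s => rho0.
have rp : 0 < rho by rewrite lt_neqAle eq_sym rho0 sqrtr_ge0.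
have rr : rho ^+ 2 = s by rewrite sqr_sqrtr.
have [g [gb gc]] := @riesz rho a (ltW rp) ltac:(by rewrite rr).
have E : s = (2 ^+ N)^-1 * \sum_(e : S) g e * \sum_(k < N) (-1) ^+ e k * a k.
  under [in RHS]eq_bigr => e _ do rewrite mulr_sumr.
  rewrite exchange_big mulr_sumr; apply: eq_bigr => k _ /=.
  rewrite expr2 -{1}gc -mulrA mulr_suml; congr (_ * _); apply: eq_bigr => e _; ring.
rewrite -(ler_pM2l rp) -expr2 rr {1}E.
have -> : rho * (4 * ((2 ^+ N)^-1 * \sum_(e : S) `|\sum_(k < N) (-1) ^+ e k * a k|)) =
  (2 ^+ N)^-1 * \sum_(e : S) (4 * rho) * `|\sum_(k < N) (-1) ^+ e k * a k|.
  by rewrite -mulr_sumr; ring.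
rewrite ler_wpM2l ?invr_ge0 ?exprn_ge0 //; apply: ler_sum => e _.
by apply: le_trans (ler_norm _) _; rewrite normrM ler_wpM2r.
Qed.

(** Any shrinking of the coefficients of a Rademacher sum is the restriction of
    the Walsh expansion of a function bounded by the first absolute moment. *)
Lemma bounded_with_signs (a a' : nat -> R) : (forall k, `|a' k| <= `|a k|) ->
  exists g : S -> R,
  (forall e, `|g e| <= 16 * ((2 ^+ N)^-1 * \sum_(e : S) `|\sum_(k < N) (-1) ^+ e k * a k|)) /\
  forall k : 'I_N, (2 ^+ N)^-1 * \sum_(e : S) (-1) ^+ e k * g e = a' k.
Proof.
move=> aa'; have [|g [gb gc]] := @riesz (Num.sqrt (\sum_(k < N) a k ^+ 2)) a' (sqrtr_ge0 _).
  rewrite sqr_sqrtr; last by apply: sumr_ge0 => k _; exact: sqr_ge0.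
  by apply: ler_sum => k _;
    rewrite -[leLHS]real_normK ?num_real // -[leRHS]real_normK ?num_real // ler_sqr ?nnegrE.
exists g; split=> // e; apply: le_trans (gb e) _.
have := khintchine a; lra.
Qed.

End Riesz.

Definition sgn_seq (R : realType) N (e : {ffun 'I_N -> bool}) (k : nat) : R :=
  if insub k is Some i then (-1) ^+ e i else 0.

Lemma sgn_seq_le1 (R : realType) N (e : {ffun 'I_N -> bool}) k :
  `|sgn_seq R e k| <= 1.
Proof.
by rewrite /sgn_seq; case: insubP => [i _ _|_]; rewrite ?normr0 // normrX normrN1 expr1n.
Qed.

Lemma sgn_seqE (R : realType) N (e : {ffun 'I_N -> bool}) (k : 'I_N) :
  sgn_seq R e k = (-1) ^+ e k.
Proof. by rewrite /sgn_seq valK. Qed.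

Lemma sgn_seq0 (R : realType) N (e : {ffun 'I_N -> bool}) k :
  (N <= k)%N -> sgn_seq R e k = 0.
Proof. by move=> Nk; rewrite /sgn_seq insubF // ltnNge Nk. Qed.

Section Blocks.
Context {R : realType} {X : nspace (nat -> R : lmodType R)}.
Hypothesis HX : sequence_space X.
Context {Omega : (nat -> R) -> (nat -> R)} {D : R}.
Hypothesis HO : centralizer_le X Omega D.
Local Notation Y := (twisted_sum X Omega).
Let qY := tw_quasi HX HO.
Let seq2 := ((nat -> R) * (nat -> R) : lmodType R)%type.
Context {K : R}.
Hypothesis K1 : 1 <= K.
Hypothesis HK : dyadic_convex Y K.

Definition functional N (al be : nat -> nat -> R) (p : seq2) (j : nat) : R :=
  \sum_(k < N) (p.1 k * al k j + p.2 k * be k j).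

(** The finite form of unconditional convergence, for the sum of the rank one
    operators sending p to the multiple [functional N al be p j] of y j. *)
Definition unconditional_sum (C : R) N M (al be : nat -> nat -> R)
    (y : nat -> seq2) : Prop :=
  forall t : nat -> R, (forall j, `|t j| <= 1) -> forall p, Y p ->
  (forall k, (N <= k)%N -> p.1 k = 0 /\ p.2 k = 0) ->
  nm Y (\sum_(j < M) (t j * functional N al be p j) *: y j) <= C * nm Y p.

Definition block_operator N M (al be : nat -> nat -> R) (y : nat -> seq2)
    (t : nat -> nat -> R) (p : seq2) : seq2 :=
  (restr (fun k => k < N)%N (fun k => \sum_(j < M)
     t k j * (p.1 k * al k j + p.2 k * be k j) * (y j).1 k),
   restr (fun k => k < N)%N (fun k => \sum_(j < M)
     t k j * (p.1 k * al k j + p.2 k * be k j) * (y j).2 k)).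

(** The coefficients of the rank one operators can be chosen independently on
    every 2-dimensional block: Rademacher averages of absolute values control
    square functions, and Riesz products turn a square function back into an
    average. *)
Theorem block_operator_bounded C N M al be y t p : 0 <= C ->
  (forall j, Y (y j)) -> unconditional_sum C N M al be y ->
  (forall k j, `|t k j| <= 1) -> Y p ->
  Y (block_operator N M al be y t p) /\
  nm Y (block_operator N M al be y t p) <=
    K * ((1 + D) * (16 * (K * (C * ((1 + D) * nm Y p))))).
Proof.
move=> C0 Yy HC t1 Yp; have D0 := cz_ge0 HO.
have D1 : 0 <= 1 + D by lra.
have K0 : 0 <= K by apply: le_trans K1.
pose S := {ffun 'I_N -> bool}.
have cardS : #|S| = (2 ^ N)%N by exact: card_signs.
pose a j k := p.1 k * al k j + p.2 k * be k j.
pose Sp (e : S) : seq2 := (sgn_seq R e \* p.1, sgn_seq R e \* p.2).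
have Sp_in e : Y (Sp e) /\ nm Y (Sp e) <= (1 + D) * nm Y p.
  by have := tw_mul HX HO (@sgn_seq_le1 R N e) Yp; rewrite mul1r.
have phiE e j : functional N al be (Sp e) j = \sum_(k < N) (-1) ^+ e k * a j k.
  by apply: eq_bigr => k _; rewrite /= sgn_seqE /a; ring.
set T0 := (1 + D) * nm Y p.
have T00 : 0 <= T0 by rewrite mulr_ge0 ?(qn_ge0 qY) //; lra.
have step1 e (u : nat -> R) : (forall j, `|u j| <= 1) ->
    nm Y (\sum_(j < M) (u j * functional N al be (Sp e) j) *: y j) <= C * T0.
  move=> u1; have [YS nS] := Sp_in e; apply: le_trans (HC u u1 _ YS _) _.
    by move=> k Nk; rewrite /= sgn_seq0 // !mul0r.
  exact: ler_wpM2l.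
have Ysum (u : nat -> R) : Y (\sum_(j < M) u j *: y j).
  by apply: (qn_sum qY) => j _; apply: (qnZ qY).
pose c j := (2 ^+ N)^-1 * \sum_(e : S) `|\sum_(k < N) (-1) ^+ e k * a j k|.
have step2 (u : nat -> R) : (forall j, `|u j| <= 1) ->
    nm Y (\sum_(j < M) (u j * c j) *: y j) <= K * (C * T0).
  move=> u1.
  pose s e j := Num.sg (functional N al be (Sp e) j).
  have -> : \sum_(j < M) (u j * c j) *: y j = (2 ^+ N)^-1 *: \sum_(e : S)
      \sum_(j < M) ((u j * s e j) * functional N al be (Sp e) j) *: y j.
    rewrite exchange_big scaler_sumr; apply: eq_bigr => j _ /=.
    rewrite -scaler_suml scalerA; congr (_ *: _); rewrite /c mulrCA; congr (_ * _).
    by rewrite mulr_sumr; apply: eq_bigr => e _; rewrite -phiE normrEsg mulrA.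
  apply: (dyadic_convex_avg qY HK (T := S) cardS (x := fun e => \sum_(j < M)
    ((u j * s e j) * functional N al be (Sp e) j) *: y j)); first exact: mulr_ge0.
  move=> e; split; first exact: (Ysum (fun j => u j * s e j * functional N al be (Sp e) j)).
  apply: (step1 e (fun j => u j * s e j)) => j.
  by rewrite normrM mulr_ile1 // /s normr_sg lern1 leq_b1.
have /choice[g Hg] j := @bounded_with_signs R N (a j) (fun k => t k j * a j k)
  ltac:(by move=> k; rewrite normrM ler_piMl).
have c0 j : 0 <= c j by rewrite mulr_ge0 ?invr_ge0 ?exprn_ge0 // sumr_ge0.
pose v e : seq2 := \sum_(j < M) g j e *: y j.
have nv e : nm Y (v e) <= 16 * (K * (C * T0)).
  pose u j := g j e / (16 * c j).
  have u1 j : `|u j| <= 1.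
    have := (Hg j).1 e; rewrite -/(c j) /u normrM normfV (ger0_norm (_ : 0 <= 16 * c j));
      last by rewrite mulr_ge0.
    have [->|cj] := eqVneq (c j) 0; first by rewrite mulr0 invr0 mulr0.
    by rewrite ler_pdivrMr ?mul1r // mulr_gt0 // lt_neqAle eq_sym cj c0.
  have ug j : g j e = 16 * (u j * c j).
    have := (Hg j).1 e; rewrite -/(c j) /u.
    have [->|cj _] := eqVneq (c j) 0; last by field.
    by rewrite !mulr0 normr_le0 => /eqP ->.
  have -> : v e = 16 *: \sum_(j < M) (u j * c j) *: y j.
    by rewrite scaler_sumr; apply: eq_bigr => j _; rewrite scalerA -ug.
  rewrite (qn_scale qY) ?ger0_norm //; first by rewrite ler_pM2l // step2.
  exact: (Ysum (fun j => u j * c j)).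
pose w e : seq2 := (sgn_seq R e \* (v e).1, sgn_seq R e \* (v e).2).
have w_in e : Y (w e) /\ nm Y (w e) <= (1 + D) * (16 * (K * (C * T0))).
  have [Yw nw] := tw_mul HX HO (@sgn_seq_le1 R N e) (Ysum (fun j => g j e)).
  split=> //; apply: le_trans nw _; rewrite mul1r.
  exact: (ler_wpM2l D1 (nv e)).
suff -> : block_operator N M al be y t p = (2 ^+ N)^-1 *: \sum_(e : S) w e.
  split; first by apply: (qnZ qY); apply: (qn_sum qY) => e _; case: (w_in e).
  apply: (dyadic_convex_avg qY HK (T := S) cardS (x := w)) => //.
  by do 3 (apply: mulr_ge0 => //); exact: mulr_ge0.
have coord (f : nat -> nat -> R) k :
    restr (fun k => k < N)%N
      (fun k => \sum_(j < M) t k j * (p.1 k * al k j + p.2 k * be k j) * f j k) k =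
    (2 ^+ N)^-1 * \sum_(e : S) sgn_seq R e k * \sum_(j < M) g j e * f j k.
  rewrite /restr; case: ltnP => kN; last first.
    by rewrite big1 ?mulr0 // => e _; rewrite sgn_seq0 ?mul0r.
  under [in RHS]eq_bigr => e _ do rewrite mulr_sumr.
  rewrite exchange_big mulr_sumr; apply: eq_bigr => j _ /=.
  have := (Hg j).2 (Ordinal kN); rewrite /= -/(a j k) => <-.
  rewrite -mulrA mulr_suml; congr (_ * _); apply: eq_bigr => e _.
  by rewrite -[k in sgn_seq R e k]/(nat_of_ord (Ordinal kN)) sgn_seqE; ring.
have vE e : v e = (\sum_(j < M) g j e *: (y j).1, \sum_(j < M) g j e *: (y j).2).
  by rewrite /v pair_sumE.
rewrite pair_sumE; apply/pair_equal_spec; split; apply/funext => k.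
  rewrite (coord (fun j => (y j).1)) /=;
    rewrite [RHS](_ : _ = (2 ^+ N)^-1 * (\sum_(e : S) (w e).1) k) //.
  congr (_ * _); rewrite fct_sumE; apply: eq_bigr => e _.
  by rewrite /w vE /= fct_sumE.
rewrite (coord (fun j => (y j).2)) /=;
  rewrite [RHS](_ : _ = (2 ^+ N)^-1 * (\sum_(e : S) (w e).2) k) //.
congr (_ * _); rewrite fct_sumE; apply: eq_bigr => e _.
by rewrite /w vE /= fct_sumE.
Qed.

End Blocks.

(** * Rigidity *)

Section Core.
Context {R : realType} {X : nspace (nat -> R : lmodType R)}.
Hypothesis HX : sequence_space X.
Let nX := seqsp_quasi HX.
Context {Omega : (nat -> R) -> (nat -> R)} {D : R}.
Hypothesis HO : centralizer_le X Omega D.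
Hypothesis He : forall k, X (Omega (@e_ R k)) /\
  nm X (Omega (@e_ R k)) <= D * nm X (@e_ R k).

Context {N : nat} {B : pred nat} {m q : nat -> R} {d K1 K2 : R}.
Hypothesis BN : forall k, B k -> (k < N)%N.
Hypothesis mB : forall k, B k -> 1 / 2 <= m k.
Hypothesis m0 : forall k, ~~ B k -> m k = 0.
Hypothesis q0 : forall k, ~~ B k -> q k = 0.
Hypothesis qd : forall k, `|q k| <= d.
Let V x := q \* Omega x.
Hypothesis V_in : forall x, X x -> X (V x) /\ nm X (V x) <= K2 * nm X x.
Hypothesis V_id : forall x, X x -> X (m \* Omega x + Omega (V x)) /\
  nm X (m \* Omega x + Omega (V x)) <= K1 * nm X x.
Hypothesis d_small : 512 * d * (K1 + D * K2 + D + 1) <= 1.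

Let d0 : 0 <= d. Proof. exact: le_trans (qd 0%N). Qed.
Let D0 : 0 <= D. Proof. exact: (cz_ge0 HO). Qed.

Let K1_ge0 : 0 <= K1.
Proof.
have [h1 h2] := V_id (X_e HX 0); have := qn_ge0 nX h1.
by have := nm_e_gt0 HX 0 => h3 h4; rewrite -(pmulr_lge0 _ h3) (le_trans h4).
Qed.

Let K2_ge0 : 0 <= K2.
Proof.
have [h1 h2] := V_in (X_e HX 0); have := qn_ge0 nX h1.
by have := nm_e_gt0 HX 0 => h3 h4; rewrite -(pmulr_lge0 _ h3) (le_trans h4).
Qed.

Lemma V_mul x u c : X x -> (forall k, `|u k| <= c) ->
  nm X (V (u \* x) - u \* V x) <= d * (D * c * nm X x).
Proof.
move=> Xx uc; have [X1 n1] := cz_mul HO Xx uc.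
have -> : V (u \* x) - u \* V x = q \* (Omega (u \* x) - u \* Omega x).
  by apply/funext => k; rewrite /V !fctE /=; ring.
by apply: le_trans (X_mul HX X1 qd).2 _; rewrite ler_wpM2l.
Qed.

Lemma V_restr b x : X x -> nm X (V (restr b x) - restr b (V x)) <= d * (D * nm X x).
Proof.
move=> Xx; have := @V_mul x (fun k => (b k)%:R) 1 Xx; rewrite mulr1 !restrE; apply.
by move=> k; case: (b k); rewrite ?normr1 ?normr0.
Qed.

Lemma V_add x y : X x -> X y ->
  nm X (V (x + y)) <= nm X (V x) + nm X (V y) + d * (3 * D * (nm X x + nm X y)).
Proof.
move=> Xx Xy; have [X1 n1] := cz_add HX HO Xx Xy.
have [[Xa _] [Xb _]] := (V_in Xx, V_in Xy).
have -> : V (x + y) = (V x + V y) + q \* (Omega (x + y) - Omega x - Omega y).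
  by apply/funext => k; rewrite /V !fctE /=; ring.
have [Xq nq] := X_mul HX X1 qd.
apply: le_trans (X_triangle HX (qnD nX Xa Xb) Xq) _.
apply: lerD; first exact: X_triangle.
by apply: le_trans nq _; rewrite ler_wpM2l.
Qed.

(** Multiplication by the small q makes the bounded map of [V_id] small. *)
Lemma V_V x : X x -> X (V (V x) + m \* V x) /\
  nm X (V (V x) + m \* V x) <= d * (K1 * nm X x).
Proof.
move=> Xx; have [X1 n1] := V_id Xx.
have -> : V (V x) + m \* V x = q \* (m \* Omega x + Omega (V x)).
  by apply/funext => k; rewrite /V !fctE /=; ring.
have [X2 n2] := X_mul HX X1 qd; split=> //.
by apply: le_trans n2 _; rewrite ler_wpM2l.
Qed.

(** Let x be a counterexample of minimal support. Splitting off one coordinate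
    shows that w = V x is at most three times larger than allowed. Where |w| is at
    most |x| / 8, w is u x for a small multiplier u, so that V w is close to u w
    there; as V w is also close to - m w with m at least 1/2, this part of w
    is negligible. Hence V x', for the restriction x' of x to the other
    coordinates, is almost as large as w, whereas |x'| is at most 8 |w|. The
    vector x' is shorter than x, thus of smaller support, and it is a
    counterexample too. *)
Lemma V_small n x : X x -> (forall k, (n <= k)%N -> x k = 0) ->
  nm X (V x) <= 1 / 64 * nm X x.
Proof.
set t : R := 1 / 64; pose s : R := 1 / 8.
have [c] := ubnP (count (fun k => x k != 0) (iota 0 n)).
elim: c x => // c IH x; rewrite ltnS => cx Xx xn.
have [x0|[k0 xk0]] : x = 0 \/ exists k, x k != 0.
  have [x0|/existsNP[k /eqP xk]] := pselect (forall k, x k = 0); last by right; exists k.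
  by left; apply/funext.
  have -> : V x = 0 by rewrite x0 /V (cz_0 HX HO); apply/funext => k; rewrite /= mulr0.
  by rewrite (qn_nm0 nX) mulr_ge0 ?(qn_ge0 nX) // /t; lra.
have k0n : (k0 < n)%N by rewrite ltnNge; apply/negP => /xn h; rewrite h eqxx in xk0.
have nx0 : 0 < nm X x.
  rewrite lt_neqAle (qn_ge0 nX) // andbT; apply/eqP => /esym/(qn_eq0 nX Xx) x0.
  by rewrite x0 eqxx in xk0.
have count_lt b k1 : ~~ b k1 -> x k1 != 0 ->
    (count (fun k => restr b x k != 0%R) (iota 0 n) < c)%N.
  move=> bk1 xk1; apply: leq_trans cx.
  have k1n : (k1 < n)%N by rewrite ltnNge; apply/negP => /xn h; rewrite h eqxx in xk1.
  rewrite -!size_filter.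
  have uf (a : pred nat) : uniq (seq.filter a (iota 0 n)) by rewrite filter_uniq // iota_uniq.
  have : uniq (k1 :: seq.filter (fun k => restr b x k != 0%R) (iota 0 n)).
    by rewrite /= uf andbT mem_filter /restr (negbTE bk1) eqxx.
  move/uniq_leq_size; apply => k; rewrite inE => /predU1P[->|].
    by rewrite mem_filter xk1 mem_iota.
  rewrite !mem_filter /restr => /andP[+ ->]; rewrite andbT.
  by case: ifP => //; rewrite eqxx.
have supp b k : (n <= k)%N -> restr b x k = 0.
  by move=> nk; rewrite /restr; case: ifP => // _; exact: xn.
have ds : d * (K1 + D * K2 + D) <= 1 / 512.
  have : 512 * d * (K1 + D * K2 + D + 1) = 512 * (d * (K1 + D * K2 + D)) + 512 * d by ring.
  move: d_small d0; lra.
have dD : d * D <= 1 / 512.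
  have : 0 <= d * (K1 + D * K2) by rewrite mulr_ge0 // addr_ge0 // mulr_ge0.
  lra.
rewrite leNgt; apply/negP => big.
set w := V x in big *.
have [Xw nw] := V_in Xx; rewrite -/(V x) -/w in Xw nw.
have w3 : nm X w <= 3 * t * nm X x.
  pose y := restr (pred1 k0) x; pose z := restr (predC1 k0) x.
  have xyz : x = y + z.
    by apply/funext => k; rewrite !fctE /y /z /restr /=; case: eqP => _; rewrite ?addr0 ?add0r.
  have [Xy ny] := X_restr HX (pred1 k0) Xx; have [Xz nz] := X_restr HX (predC1 k0) Xx.
  have hz : nm X (V z) <= t * nm X z.
    by apply: IH Xz (supp _) => //; apply: (count_lt _ k0); rewrite /= ?eqxx.
  have hy : nm X (V y) <= t * nm X x.
    have -> : V y = q \* (x k0 *: Omega (@e_ R k0)).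
      by rewrite /V /y restr1 (cz_hom HO) //; exact: X_e.
    have [XOe nOe] := He k0.
    apply: le_trans (X_mul HX (qnZ nX (x k0) XOe) qd).2 _.
    rewrite (qn_scale nX) //; have h1 := ler_wpM2l (normr_ge0 (x k0)) nOe.
    have h2 := nm_coord HX k0 Xx.
    have h3 := ler_wpM2l d0 h1; have h4 := ler_wpM2l (mulr_ge0 d0 D0) h2.
    have h5 := ler_wpM2r (ltW nx0) dD; rewrite /t; lra.
  have := V_add Xy Xz; rewrite -xyz -/w.
  have h6 : d * (3 * D * (nm X y + nm X z)) <= 6 * (d * D) * nm X x.
    have -> : 6 * (d * D) * nm X x = d * (3 * D * (nm X x + nm X x)) by ring.
    by rewrite !ler_wpM2l ?mulr_ge0 // lerD.
  have h7 := ler_wpM2r (ltW nx0) dD.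
  rewrite -/y in ny; rewrite -/z in nz; move: hz hy h6 h7; rewrite /t; lra.
pose F k := `|w k| <= s * `|x k|.
pose u k := if F k && (x k != 0) then w k / x k else 0.
have us k : `|u k| <= s.
  rewrite /u; case: ifP => [/andP[Fk xk]|_]; last by rewrite normr0 /s; lra.
  by rewrite normrM normfV ler_pdivrMr ?normr_gt0.
have Fw : restr F w = u \* x.
  apply/funext => k; rewrite /restr /u /=; case: ifP => Fk /=; last by rewrite mul0r.
  case: eqP => [xk|/eqP xk]; last by rewrite divfK.
  by move: Fk; rewrite /F xk normr0 mulr0 normr_le0 mul0r => /eqP.
have [XFw nFw] := X_restr HX F Xw.
have [XVFw _] := V_in XFw.
have [XVw _] := V_in Xw.
have [XuV _] := X_mul HX Xw us.
have [XVV nVV] := V_V Xx; rewrite -/w in XVV nVV.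
have E : m \* restr F w = restr F (V w + m \* w)
   + (V (restr F w) - restr F (V w)) - (V (u \* x) - u \* w) - u \* w.
  rewrite -Fw; apply/funext => k; rewrite !fctE /= /restr; case: (F k); rewrite ?fctE /=; ring.
have hF : nm X (restr F w) <= 2 * nm X (m \* restr F w).
  have Xm : X (m \* restr F w).
    have [cm cmP] : exists c, forall k, `|m k| <= c.
      exists (\sum_(k < N) `|m k|) => k; have [Bk|/m0 ->] := boolP (B k);
        last by rewrite normr0 sumr_ge0.
      by rewrite (bigD1 (Ordinal (BN Bk))) //= lerDl sumr_ge0.
    exact: (X_mul HX XFw cmP).1.
  rewrite -[2]ger0_norm // -(qn_scale nX) //; apply: (nm_le HX); first exact: (qnZ nX).
  move=> k; rewrite [X in _ <= `|X|](_ : _ = 2 * (m k * restr F w k)) //.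
  have [Bk|nBk] := boolP (B k).
    rewrite mulrA normrM ler_peMl // ger0_norm; have := mB Bk; lra.
  have -> : restr F w k = 0 by rewrite /restr /w /V /= q0 // mul0r if_same.
  by rewrite !mulr0.
have hFw : nm X (restr F w) <= 3 * (d * (K1 + D * K2 + D)) * nm X x.
  have huw : nm X (u \* w) <= s * nm X (restr F w).
    have -> : u \* w = u \* restr F w.
      by apply/funext => k; rewrite /= /restr /u; case: (F k); rewrite //= !mul0r.
    exact: (X_mul HX XFw us).2.
  have e1 := V_restr F Xw; have e2 := V_mul Xx us; rewrite -/w in e2.
  have [XF1 nF1] := X_restr HX F XVV.
  have [XFV _] := X_restr HX F XVw.
  have Xa := qnB nX XVFw XFV.
  have Xb : X (V (u \* x) - u \* w) by rewrite -Fw; exact: (qnB nX).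
  have := X_triangleB HX (qnB nX (qnD nX XF1 Xa) Xb) XuV.
  rewrite -E; have := X_triangleB HX (qnD nX XF1 Xa) Xb.
  have := X_triangle HX XF1 Xa.
  have h1 : d * (D * nm X w) <= d * (D * (K2 * nm X x)) by rewrite !ler_wpM2l.
  have h2 : d * (D * s * nm X x) <= d * (D * nm X x).
    by rewrite ler_wpM2l // ler_wpM2r ?(ltW nx0) // ler_piMr // /s; lra.
  have h3 : 0 <= d * (K1 + D * K2 + D) * nm X x.
    by rewrite !mulr_ge0 ?addr_ge0 ?mulr_ge0 // ltW.
  move: hF huw e1 e2 nF1 nVV h1 h2 h3; rewrite /s; lra.
pose x' := restr (fun k => ~~ F k) x.
have [Xx' _] := X_restr HX (fun k => ~~ F k) Xx; rewrite -/x' in Xx'.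
have nx' : nm X x' <= 8 * nm X w.
  rewrite -[8]ger0_norm // -(qn_scale nX) //; apply: (nm_le HX); first exact: (qnZ nX).
  move=> k; rewrite [X in _ <= `|X|](_ : _ = 8 * w k) // normrM ger0_norm //.
  rewrite /x' /restr /F /s; case: ifP; last by rewrite normr0 mulr_ge0.
  by rewrite -ltNge; lra.
have x'x : nm X x' < nm X x by move: nx' w3; rewrite /t; lra.
have hx' : nm X (V x') <= t * nm X x'.
  have [k1 /andP[Fk1 xk1]] : exists k, F k && (x k != 0).
    apply: contrapT => none; move: x'x; rewrite (_ : x' = x) ?ltxx //.
    apply/funext => k; rewrite /x' /restr; case: ifP => // /negbFE Fk.
    by have [->//|xk] := eqVneq (x k) 0; case: none; exists k; rewrite Fk.
  by apply: IH Xx' (supp _) => //; apply: (count_lt _ k1); rewrite // Fk1.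
have e3 := V_restr (fun k => ~~ F k) Xx; rewrite -/x' -/w in e3.
have [XFc _] := X_restr HX (fun k => ~~ F k) Xw.
have wsplit : w = restr F w + restr (fun k => ~~ F k) w.
  by apply/funext => k; rewrite !fctE /restr; case: (F k); rewrite /= ?addr0 ?add0r.
have h1 : nm X w <= nm X (restr F w) + nm X (restr (fun k => ~~ F k) w).
  by rewrite {1}wsplit; exact: X_triangle.
have [XVx' _] := V_in Xx'.
have h2 := X_le_dist HX XFc XVx'.
rewrite (qn_distC nX XFc XVx') in h2.
have h3 := ler_wpM2r (ltW nx0) ds; have h4 := ler_wpM2r (ltW nx0) dD.
move: big hFw hx' x'x nx' w3 h1 h2 e3 h3 h4; rewrite /t; lra.
Qed.

Lemma restr_crude x : X x ->
  nm X (restr B (Omega x)) <= 2 * D * N%:R * nm X x.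
Proof.
move=> Xx.
have -> : restr B (Omega x) = restr B (restr (fun k => k < N)%N (Omega x)).
  by apply/funext => k; rewrite /restr; case: ifP => // /BN ->.
apply: le_trans (X_restr HX B (X_fin HX N _)).2 _.
rewrite -sum_e; apply: le_trans (X_sum HX (n := N) (v := fun k => Omega x k *: @e_ R k) _) _.
  by move=> k _; apply: (qnZ nX); exact: X_e.
apply: (@le_trans _ _ (\sum_(k < N) 2 * D * nm X x)); last first.
  by rewrite sumr_const card_ord -[_ *+ N]mulr_natl le_eqVlt; apply/orP; left; apply/eqP; ring.
apply: ler_sum => k _; rewrite -restr1.
have [X1 n1] := cz_restr HO (pred1 (k : nat)) Xx.
have [XO nO] := He k.
rewrite restr1 (cz_hom HO) ?X_e // in X1 n1; last exact: X_e.
have XxO := qnZ nX (x k) XO.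
have Xr : X (restr (pred1 (k : nat)) (Omega x)).
  by rewrite restr1; apply: (qnZ nX); exact: X_e.
have := X_le_dist HX Xr XxO; rewrite (qn_distC nX Xr XxO) (qn_scale nX) //.
have h1 := ler_wpM2l (normr_ge0 (x k)) nO.
have h2 := ler_wpM2l D0 (nm_coord HX k Xx).
move: h1 h2 n1; lra.
Qed.

(** Up to a bounded term, [Omega x] is - m^-1 Omega (V x), and [V x] is small:
    each use of this identity halves the distance of the crude bound to the one
    claimed. *)
Lemma restr_bounded x : X x -> (forall k, (N <= k)%N -> x k = 0) ->
  nm X (restr B (Omega x)) <= 4 * K1 * nm X x.
Proof.
pose M0 := 2 * D * N%:R.
have step i y : X y -> (forall k, (N <= k)%N -> y k = 0) ->
    nm X (restr B (Omega y)) <= (4 * K1 + (1 / 2) ^+ i * M0) * nm X y.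
  elim: i y => [|i IH] y Xy yN.
    apply: le_trans (restr_crude Xy) _; apply: ler_wpM2r; first exact: (qn_ge0 nX).
    by rewrite expr0 mul1r lerDr mulr_ge0.
  have [XV nV] := V_in Xy.
  have VN k : (N <= k)%N -> V y k = 0.
    by move=> Nk; rewrite /V /= q0 ?mul0r //; apply/negP => /BN; rewrite ltnNge Nk.
  have h1 := IH _ XV VN.
  have h2 := V_small Xy yN.
  have [Xi ni] := V_id Xy.
  have [XBi nBi] := X_restr HX B Xi.
  have XBV : X (restr B (Omega (V y))).
    have -> : restr B (Omega (V y)) = restr B (restr (fun k => k < N)%N (Omega (V y))).
      by apply/funext => k; rewrite /restr; case: ifP => // /BN ->.
    exact: (X_restr HX B (X_fin HX N _)).1.
  have h3 : nm X (restr B (Omega y)) <=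
      2 * nm X (restr B (m \* Omega y + Omega (V y)) - restr B (Omega (V y))).
    have XX := qnB nX XBi XBV.
    rewrite -[2]ger0_norm // -(qn_scale nX) //; apply: (nm_le HX); first exact: (qnZ nX).
    move=> k; rewrite [X in _ <= `|X|](_ : _ = 2 * (restr B (m \* Omega y + Omega (V y)) k -
      restr B (Omega (V y)) k)) //.
    rewrite /restr; case: ifP => Bk; last by rewrite normr0.
    rewrite fctE /= addrK mulrA normrM ler_peMl // ger0_norm; have := mB Bk; lra.
  have h4 := X_triangleB HX XBi XBV.
  have c0 : 0 <= 4 * K1 + (1 / 2) ^+ i * M0.
    by rewrite addr_ge0 ?mulr_ge0 ?exprn_ge0 //; lra.
  have h5 := ler_wpM2l c0 h2.
  rewrite exprS; have ny := qn_ge0 nX Xy.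
  have h6 : 0 <= K1 * nm X y by rewrite mulr_ge0.
  have h7 : 0 <= (1 / 2) ^+ i * M0 * nm X y by rewrite !mulr_ge0 ?exprn_ge0 //; lra.
  move: h1 h3 h4 h5 h6 h7 ni nBi; set P := (1 / 2) ^+ i * M0.
  have -> : 1 / 2 * (1 / 2) ^+ i * M0 = 1 / 2 * P by rewrite /P; ring.
  lra.
move=> Xx xN; apply: le_eps => eps e0.
have M1 : 0 <= M0 * nm X x by rewrite !mulr_ge0 // (qn_ge0 nX).
have [|||||k _ hk] := @geometric_beats_linear R (1 / 2) (M0 * nm X x) 0 eps; try lra.
apply: le_trans (step k _ Xx xN) _; move: hk; rewrite mul0r addr0; lra.
Qed.

End Core.

Section Rigidity.
Context {R : realType} {X : nspace (nat -> R : lmodType R)}.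
Hypothesis HX : sequence_space X.
Let nX := seqsp_quasi HX.
Context {Omega : (nat -> R) -> (nat -> R)} {D : R}.
Hypothesis HO : centralizer_le X Omega D.
Hypothesis Oe : forall k, Omega (@e_ R k) k = 0.
Local Notation Y := (twisted_sum X Omega).

Lemma cz_e0 k : X (Omega (@e_ R k)) /\ nm X (Omega (@e_ R k)) <= D * nm X (@e_ R k).
Proof. by have := cz_e HX HO k; rewrite Oe scale0r subr0. Qed.

(** Suppose that, on the blocks k < N, the matrices [[p, q], [r, s]] of index j
    have rank one and all their combinations with coefficients in [-1, 1] are
    bounded on Y. On the blocks where the q's are not small, the signs of the q's
    as coefficients give an operator whose first component on (x, Omega x) is
    bounded and contains a large multiple of Omega x. On the others p s = q r
    makes p and s almost disjoint as functions of j. Coefficients 1 where |p|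
    dominates and 0 elsewhere then give an operator whose diagonal entries have a
    difference m of at least 1/2; that it preserves the graph of Omega up to
    bounded terms is the almost-eigenvalue equation for V = q Omega solved
    above. *)
Theorem rank_one_rigidity (Kb : R) : 0 <= Kb -> exists K5 : R,
  forall (N M : nat) (p q r s : nat -> nat -> R),
  (forall k j, p k j * s k j = q k j * r k j) ->
  (forall k, (k < N)%N -> 3 / 4 <= \sum_(j < M) p k j) ->
  let c (t f : nat -> nat -> R) := restr (fun k => k < N)%N
    (fun k => \sum_(j < M) t k j * f k j) in
  (forall t : nat -> nat -> R, (forall k j, `|t k j| <= 1) -> forall x y, Y (x, y) ->
    Y (c t p \* x + c t q \* y, c t r \* x + c t s \* y) /\
    nm Y (c t p \* x + c t q \* y, c t r \* x + c t s \* y) <= Kb * nm Y (x, y)) ->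
  forall x, X x -> (forall k, (N <= k)%N -> x k = 0) ->
  nm X (restr (fun k => k < N)%N (Omega x)) <= K5 * nm X x.
Proof.
move=> Kb0; have D0 := cz_ge0 HO.
pose KK := Kb * (1 + D) * (1 + D); pose K2 := Kb + KK.
pose K1 := Kb + KK + 3 * D * (KK + K2) + D * KK.
have KK0 : 0 <= KK by rewrite !mulr_ge0 //; lra.
have K20 : 0 <= K2 by apply: addr_ge0.
have K10 : 0 <= K1 by rewrite /K1 !addr_ge0 ?mulr_ge0 ?addr_ge0 //.
pose L := K1 + D * K2 + D + KK + 1.
have L1 : 1 <= L.
  have : 0 <= D * K2 by rewrite mulr_ge0.
  by rewrite /L; move: K10 KK0 D0; lra.
pose d := (512 * L)^-1.
have Lp : 0 < 512 * L by lra.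
have d0 : 0 < d by rewrite invr_gt0.
have dL : 512 * d * L = 1.
  have aux (u v : R) : 0 < u * v -> u * (u * v)^-1 * v = 1.
    by move=> uv; rewrite mulrAC divff // gt_eqF.
  exact: aux Lp.
exists (d^-1 * K2 + 4 * K1) => N M p q r s rank trace c bnd.
have cN t f k : ~~ (k < N)%N -> c t f k = 0 by rewrite /c /restr => /negbTE ->.
have cE t f k : (k < N)%N -> c t f k = \sum_(j < M) t k j * f k j by rewrite /c /restr => ->.
have ce (f : nat -> R) k : f \* @e_ R k = f k *: @e_ R k.
  apply/funext => i; rewrite [RHS](_ : _ = f k * @e_ R k i) //= /e_.
  by case: eqP => [->|_]; rewrite ?mulr0.
have Xc t f k : X (c t f k *: @e_ R k) by apply: (qnZ nX); exact: X_e.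
(* Testing the operators on unit vectors bounds their entries. *)
have pb t k : (forall k j, `|t k j| <= 1) -> `|c t p k| <= KK /\ `|c t r k| <= KK.
  move=> t1; have [Oin On] := cz_e0 k.
  have ek := nm_e_gt0 HX k.
  have Ye : Y (@e_ R k, 0).
    by split => /=; [exact: X_e|rewrite sub0r; exact: (qnN nX)].
  have [] := bnd t t1 _ _ Ye.
  rewrite !ce (_ : c t q \* 0 = 0); last by apply/funext => i; rewrite /= mulr0.
  rewrite (_ : c t s \* 0 = 0); last by apply/funext => i; rewrite /= mulr0.
  rewrite !addr0 => -[/= X1 X2]; rewrite sub0r (qn_nmN nX) //.
  rewrite (cz_hom HO _ (X_e HX k)) in X2 *.
  have n1 := qn_ge0 nX X1; have n2 := qn_ge0 nX X2.
  move=> h; have h1 : nm X (@e_ R k) + nm X (Omega (@e_ R k)) <= (1 + D) * nm X (@e_ R k) by lra.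
  have h2 := ler_wpM2l Kb0 h1.
  have h3 : nm X (c t p k *: @e_ R k) <= Kb * (1 + D) * nm X (@e_ R k) by lra.
  have Kb1 : 0 <= Kb * (1 + D) by rewrite mulr_ge0 //; lra.
  rewrite (qn_scale nX) in h3; last exact: X_e.
  rewrite ler_pM2r // in h3.
  split; first by apply: le_trans h3 _; rewrite /KK ler_peMr //; lra.
  have XpO := qnZ nX (c t p k) Oin.
  have := X_le_dist HX (Xc t r k) XpO.
  rewrite !(qn_scale nX) //; last exact: X_e.
  rewrite (qn_scale nX) in h; last exact: X_e.
  have h4 : `|c t p k| * nm X (Omega (@e_ R k)) <= `|c t p k| * (D * nm X (@e_ R k)).
    by rewrite ler_wpM2l.
  move=> h5; rewrite -(ler_pM2r ek).
  have h6 : 0 <= `|c t p k| * nm X (@e_ R k) by rewrite mulr_ge0 // ltW.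
  have h7 : D * (`|c t p k| * nm X (@e_ R k)) <= D * (Kb * (1 + D) * nm X (@e_ R k)).
    by rewrite ler_wpM2l // ler_wpM2r // ltW.
  rewrite /KK; lra.
have qb t k : (forall k j, `|t k j| <= 1) -> `|c t q k| <= KK.
  move=> t1; have [Ye ne] := tw_fiber HX HO (X_e HX k).
  have [] := bnd t t1 _ _ Ye.
  rewrite ne => -[/= X1 X2] h.
  have n2 := qn_ge0 nX X2; rewrite /= in X1 X2 n2.
  have ek := nm_e_gt0 HX k.
  have h1 : nm X (c t p \* 0 + c t q \* @e_ R k) <= Kb * nm X (@e_ R k) by lra.
  rewrite (_ : c t p \* 0 = 0) ?add0r ?ce in h1; last by apply/funext => i; rewrite /= mulr0.
  rewrite (qn_scale nX) ?ler_pM2r // in h1; last exact: X_e.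
  have : Kb <= Kb * (1 + D) by rewrite ler_peMr //; lra.
  have : Kb * (1 + D) <= KK by rewrite /KK ler_peMr ?mulr_ge0 //; lra.
  lra.
have sgb (f : nat -> nat -> R) k j : `|Num.sg (f k j)| <= 1.
  by rewrite normr_sg lern1 leq_b1.
have abs_sum (f : nat -> nat -> R) k : (k < N)%N ->
    c (fun k j => Num.sg (f k j)) f k = \sum_(j < M) `|f k j|.
  by move=> kN; rewrite cE //; apply: eq_bigr => j _; rewrite -normrEsg.
pose aq k := \sum_(j < M) `|q k j|.
pose B1 k := (k < N)%N && (d <= aq k).
pose B2 k := (k < N)%N && (aq k < d).
have case1 x : X x -> nm X (restr B1 (Omega x)) <= d^-1 * K2 * nm X x.
  move=> Xx.
  pose t k j := if B1 k then Num.sg (q k j) else 0.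
  have t1 k j : `|t k j| <= 1 by rewrite /t; case: ifP => _; rewrite ?normr0.
  have tq k : c t q k = if B1 k then aq k else 0.
    have [kN|kN] := boolP (k < N)%N; last by rewrite cN // /B1 (negbTE kN).
    rewrite cE //; case: ifP => Bk.
      by apply: eq_bigr => j _; rewrite /t Bk -normrEsg.
    by rewrite big1 // => j _; rewrite /t Bk mul0r.
  have [Yx nx] := tw_graph HX (Omega := Omega) Xx.
  have [] := bnd t t1 _ _ Yx; rewrite nx => -[/= X1 X2] h.
  have n2 := qn_ge0 nX X2; rewrite /= in X1 X2 n2.
  have h1 : nm X (c t p \* x + c t q \* Omega x) <= Kb * nm X x by lra.
  have [X3 n3] := X_mul HX Xx (fun k => (pb t k t1).1).
  have X4 := qnB nX X1 X3.
  have n4 := X_triangleB HX X1 X3.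
  rewrite addrAC subrr add0r in X4 n4.
  have di : 0 <= d^-1 by rewrite invr_ge0 ltW.
  apply: (@le_trans _ _ (nm X (d^-1 *: (c t q \* Omega x)))).
    apply: (nm_le HX); first exact: (qnZ nX).
    move=> k; rewrite [X in _ <= `|X|](_ : _ = d^-1 * (c t q k * Omega x k)) // tq /restr.
    case: ifP => Bk; last by rewrite normr0.
    rewrite mulrA normrM ler_peMl // ger0_norm; last by rewrite mulr_ge0 // sumr_ge0.
    by rewrite mulrC ler_pdivlMr // mul1r; case/andP: Bk.
  rewrite (qn_scale nX) // ger0_norm // -mulrA ler_wpM2l // /K2; lra.
(* For small q, p s = q r makes s small where |s| <= |p|, and p elsewhere. *)
pose t k j := if B2 k && (`|s k j| <= `|p k j|) then 1 else 0 : R.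
have t1 k j : `|t k j| <= 1 by rewrite /t; case: ifP => _; rewrite ?normr0 ?normr1.
have t0 f k : ~~ B2 k -> c t f k = 0.
  move=> Bk; have [kN|kN] := boolP (k < N)%N; last by rewrite cN.
  by rewrite cE // big1 // => j _; rewrite /t (negbTE Bk) mul0r.
pose m k := c t p k - c t s k.
have m_half k : B2 k -> 1 / 2 <= m k.
  move=> Bk; have /andP[kN qk] := Bk.
  have rk : \sum_(j < M) `|r k j| <= KK.
    rewrite -abs_sum //; apply: le_trans (ler_norm _) _.
    exact: (pb (fun k j => Num.sg (r k j)) k (sgb r)).2.
  pose la := 16 * KK + 16.
  have la0 : 0 < la by rewrite /la; lra.
  (* The weight la plays the small q off against the bounded r. *)
  have amgm j (a : R) : `|a| * `|a| <= `|q k j| * `|r k j| ->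
      `|a| <= la * `|q k j| + `|r k j| / la.
    move=> h; rewrite -ler_sqr ?nnegrE ?addr_ge0 ?mulr_ge0 ?invr_ge0 ?(ltW la0) //.
    rewrite !expr2; apply: le_trans h _.
    set u := `|q k j|; set v := `|r k j|.
    have u0 : 0 <= u by exact: normr_ge0.
    have v0 : 0 <= v by exact: normr_ge0.
    have -> : (la * u + v / la) * (la * u + v / la) = (la * u) ^+ 2 + 2 * (u * v) + (v / la) ^+ 2.
      by field; rewrite gt_eqF.
    have := sqr_ge0 (la * u); have := sqr_ge0 (v / la).
    have : 0 <= u * v by exact: mulr_ge0.
    lra.
  have eta : \sum_(j < M) (la * `|q k j| + `|r k j| / la) <= 1 / 8.
    rewrite big_split /= -mulr_sumr -mulr_suml -/(aq k).
    have h1 : la * aq k <= la * d by rewrite ler_wpM2l // ltW.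
    have h2 : la * d <= 1 / 32.
      have h3 : (16 * KK + 16) * d <= 16 * (L * d).
        have -> : 16 * (L * d) = (16 * L) * d by ring.
        rewrite ler_wpM2r ?(ltW d0) // /L.
        have : 0 <= D * K2 by rewrite mulr_ge0.
        by move: K10 D0; lra.
      have h4 : 512 * (L * d) = 1 by rewrite [L * d]mulrC mulrA.
      rewrite /la; lra.
    have h3 : (\sum_(j < M) `|r k j|) / la <= 1 / 16.
      rewrite ler_pdivrMr // /la; lra.
    lra.
  have hs : c t s k <= 1 / 8.
    rewrite cE //; apply: le_trans eta; apply: ler_sum => j _.
    rewrite /t Bk /=; case: ifP => h; last first.
      by rewrite mul0r addr_ge0 ?mulr_ge0 ?invr_ge0 // ltW.
    rewrite mul1r; apply: le_trans (ler_norm _) _; apply: amgm.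
    by rewrite -[leRHS]normrM -rank normrM ler_wpM2r.
  have hp : 3 / 4 - 1 / 8 <= c t p k.
    have := trace k kN.
    suff : \sum_(j < M) p k j - c t p k <= 1 / 8 by lra.
    rewrite cE // -sumrB; apply: le_trans eta; apply: ler_sum => j _.
    rewrite /t Bk /=; case: ifP => h.
      by rewrite mul1r subrr addr_ge0 ?mulr_ge0 ?invr_ge0 // ltW.
    rewrite mul0r subr0; apply: le_trans (ler_norm _) _; apply: amgm.
    rewrite -[leRHS]normrM -rank normrM ler_wpM2l // ltW // ltNge h //.
  by rewrite /m; lra.
have m0 k : ~~ B2 k -> m k = 0 by move=> Bk; rewrite /m !t0 // subrr.
have qd k : `|c t q k| <= d.
  have [Bk|Bk] := boolP (B2 k); last by rewrite t0 // normr0 ltW.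
  have /andP[kN qk] := Bk; apply: le_trans (ltW qk); rewrite cE //.
  apply: le_trans (ler_norm_sum _ _ _) _; apply: ler_sum => j _.
  by rewrite normrM ler_piMl.
have graph x : X x -> [/\ X (c t p \* x + c t q \* Omega x),
    nm X (c t p \* x + c t q \* Omega x) <= Kb * nm X x,
    X (c t r \* x + c t s \* Omega x - Omega (c t p \* x + c t q \* Omega x)) &
    nm X (c t r \* x + c t s \* Omega x - Omega (c t p \* x + c t q \* Omega x)) <= Kb * nm X x].
  move=> Xx; have [Yx nx] := tw_graph HX (Omega := Omega) Xx.
  have [] := bnd t t1 _ _ Yx; rewrite nx => -[/= X1 X2] h.
  have n1 := qn_ge0 nX X1; have n2 := qn_ge0 nX X2.
  by split=> //; rewrite /= in n1 n2; lra.
have V_in x : X x -> X (c t q \* Omega x) /\ nm X (c t q \* Omega x) <= K2 * nm X x.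
  move=> Xx; have [X1 h1 _ _] := graph x Xx.
  have [X3 n3] := X_mul HX Xx (fun k => (pb t k t1).1).
  have X4 := qnB nX X1 X3; have n4 := X_triangleB HX X1 X3.
  rewrite addrAC subrr add0r in X4 n4.
  by split=> //; rewrite /K2; lra.
have V_id x : X x -> X (m \* Omega x + Omega (c t q \* Omega x)) /\
    nm X (m \* Omega x + Omega (c t q \* Omega x)) <= K1 * nm X x.
  move=> Xx; have [X1 h1 X2 h2] := graph x Xx.
  have [XV nV] := V_in x Xx.
  have [Xp np] := X_mul HX Xx (fun k => (pb t k t1).1).
  have [Xr nr] := X_mul HX Xx (fun k => (pb t k t1).2).
  have [Xa na] := cz_add HX HO Xp XV.
  have [Xm nm_] := cz_mul HO Xx (fun k => (pb t k t1).1).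
  set z := c t p \* x + c t q \* Omega x in X1 h1 X2 h2 Xa na.
  have -> : m \* Omega x + Omega (c t q \* Omega x) =
     c t r \* x - (c t r \* x + c t s \* Omega x - Omega z)
     - (Omega z - Omega (c t p \* x) - Omega (c t q \* Omega x))
     - (Omega (c t p \* x) - c t p \* Omega x).
    apply/funext => k; rewrite !fctE /= /m; ring.
  have X3 := qnB nX Xr X2; have X4 := qnB nX X3 Xa; have X5 := qnB nX X4 Xm.
  split=> //; apply: le_trans (X_triangleB HX X4 Xm) _.
  have := X_triangleB HX X3 Xa; have := X_triangleB HX Xr X2.
  have D3 : 0 <= 3 * D by lra.
  have := ler_wpM2l D3 (lerD np nV).
  by rewrite /K1; lra.
move=> x Xx xN.
have d_small : 512 * d * (K1 + D * K2 + D + 1) <= 1.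
  apply: le_trans (_ : 512 * d * L <= 1); last by rewrite dL.
  apply: ler_wpM2l; first exact: mulr_ge0 (ler0n _ _) (ltW d0).
  by rewrite /L; move: KK0; lra.
have case2 := restr_bounded HX HO cz_e0 (fun k (Bk : B2 k) => proj1 (andP Bk)) m_half m0
  (fun k => t0 q k) qd V_in V_id d_small Xx xN.
have -> : restr (fun k => k < N)%N (Omega x) =
    restr B1 (restr (fun k => k < N)%N (Omega x)) + restr B2 (restr (fun k => k < N)%N (Omega x)).
  apply/funext => k; rewrite !fctE /restr /B1 /B2; case: (k < N)%N => /=;
    last by rewrite ?if_same addr0.
  by case: ltP => _; rewrite ?addr0 ?add0r.
have XN := X_fin HX N (Omega x).
apply: le_trans (X_triangle HX (X_restr HX B1 XN).1 (X_restr HX B2 XN).1) _.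
have r1 : restr B1 (restr (fun k => k < N)%N (Omega x)) = restr B1 (Omega x).
  by apply/funext => k; rewrite /restr /B1; case: (k < N)%N.
have r2 : restr B2 (restr (fun k => k < N)%N (Omega x)) = restr B2 (Omega x).
  by apply/funext => k; rewrite /restr /B2; case: (k < N)%N.
rewrite r1 r2 mulrDl; apply: lerD => //; exact: case1.
Qed.

End Rigidity.

(** * From rank one sums, or a projection, to a bounded perturbation *)

Section Bounded.
Context {R : realType} {X : nspace (nat -> R : lmodType R)}.
Hypothesis HX : sequence_space X.
Let nX := seqsp_quasi HX.
Context {Omega : (nat -> R) -> (nat -> R)} {D : R}.
Hypothesis HO : centralizer_le X Omega D.
Local Notation Y := (twisted_sum X Omega).
Let qY := tw_quasi HX HO.
Let seq2 := ((nat -> R) * (nat -> R) : lmodType R)%type.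

(** The common consequence of local unconditional structure and of the
    existence of an unconditional basis: the identity of the span of the first
    N coordinates is, up to a harmless error on first coordinates, an
    unconditionally bounded sum of rank one operators. *)
Definition uniform_unconditional_sums : Prop :=
  exists2 C, 0 <= C & forall N, exists M (al be : nat -> nat -> R) (y : nat -> seq2),
  [/\ forall j, Y (y j),
      forall k, (k < N)%N -> 3 / 4 <= \sum_(j < M) al k j * (y j).1 k &
      unconditional_sum (X := X) (Omega := Omega) C N M al be y].

(** Letting the coefficients depend on the block keeps only the 2 x 2 diagonal
    blocks of the rank one operators, which are themselves of rank one. *)
Theorem bounded_of_unconditional_sums K : 1 <= K -> dyadic_convex Y K ->
  (forall k, Omega (@e_ R k) k = 0) -> uniform_unconditional_sums ->
  exists K' : R, forall x, X x -> X (Omega x) /\ nm X (Omega x) <= K' * nm X x.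
Proof.
move=> K1 HK Oe [C C0 HC]; have D0 := cz_ge0 HO.
pose Kb := K * ((1 + D) * (16 * (K * (C * (1 + D))))).
have Kb0 : 0 <= Kb.
  have D1 : 0 <= 1 + D by lra.
  have K0 : 0 <= K by lra.
  by rewrite /Kb; do 4 (apply: mulr_ge0 => //); exact: mulr_ge0.
have [K5 H5] := rank_one_rigidity HX HO Oe Kb0.
exists (`|K5| + D); apply: (cz_bounded_of_truncations HX HO) => N x Xx.
have [M [al [be [y [Yy tr uc]]]]] := HC N.
have [Xx1 nx1] := X_restr HX (fun k => k < N)%N Xx.
set x1 := restr _ x in Xx1 nx1.
have h5 : nm X (restr (fun k => k < N)%N (Omega x1)) <= `|K5| * nm X x.
  apply: (@le_trans _ _ (K5 * nm X x1)); last first.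
    apply: (@le_trans _ _ (`|K5| * nm X x1)).
      by apply: ler_wpM2r; [exact: (qn_ge0 nX)|exact: ler_norm].
    exact: ler_wpM2l.
  apply: (H5 N M (fun k j => al k j * (y j).1 k) (fun k j => be k j * (y j).1 k)
    (fun k j => al k j * (y j).2 k) (fun k j => be k j * (y j).2 k)) => //.
  - by move=> k j; ring.
  - move=> t t1 a b Yab.
    have := block_operator_bounded HX HO K1 HK C0 Yy uc t1 Yab.
    have -> : K * ((1 + D) * (16 * (K * (C * ((1 + D) * nm Y (a, b)))))) = Kb * nm Y (a, b).
      by rewrite /Kb; ring.
    suff -> : block_operator N M al be y t (a, b) =
      (restr (fun k => k < N)%N (fun k => \sum_(j < M) t k j * (al k j * (y j).1 k)) \* a +
       restr (fun k => k < N)%N (fun k => \sum_(j < M) t k j * (be k j * (y j).1 k)) \* b,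
       restr (fun k => k < N)%N (fun k => \sum_(j < M) t k j * (al k j * (y j).2 k)) \* a +
       restr (fun k => k < N)%N (fun k => \sum_(j < M) t k j * (be k j * (y j).2 k)) \* b) by [].
    rewrite /block_operator; apply/pair_equal_spec; split; apply/funext => k;
      rewrite !fctE /restr /=; case: (k < N)%N; rewrite ?mul0r ?addr0 //;
      rewrite !mulr_suml -big_split; apply: eq_bigr => j _ /=; ring.
  - by move=> k Nk; rewrite /x1 /restr ltnNge Nk.
have [Xd nd] := cz_restr HO (fun k => k < N)%N Xx; rewrite -/x1 in Xd nd.
have [Xd' nd'] := X_restr HX (fun k => k < N)%N Xd.
have E : restr (fun k => k < N)%N (Omega x) = restr (fun k => k < N)%N (Omega x1) -
    restr (fun k => k < N)%N (Omega x1 - restr (fun k => k < N)%N (Omega x)).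
  apply/funext => k; rewrite !fctE /restr ?fctE; case: ifP => kN; last by rewrite subr0.
  by rewrite opprB addrC subrK.
rewrite E; apply: le_trans (X_triangleB HX (X_fin HX N _) Xd') _.
by rewrite mulrDl; apply: lerD => //; apply: le_trans nd.
Qed.

Lemma tw_unit k : Y (@e_ R k, 0).
Proof.
split=> /=; first exact: X_e.
have [X1 _] := cz_e HX HO k; rewrite sub0r; apply: (qnN nX).
set a := Omega (@e_ R k) k *: _ in X1.
by rewrite -(subrK a (Omega (@e_ R k))); apply: (qnD nX) => //; apply: (qnZ nX); exact: X_e.
Qed.

(** Averaging a projection over the sign changes of coordinates makes it
    diagonal, and a diagonal projection onto the fiber is (x, y) |-> (0, y - b x). *)
Theorem bounded_of_complemented :
  complemented Y [set p : seq2 | p.1 = 0 /\ X p.2] ->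
  exists b (K : R), forall x, X x ->
    X (Omega x - b \* x) /\ nm X (Omega x - b \* x) <= K * nm X x.
Proof.
case=> P [[c [c0 Plin Pb]] PP Pim]; have D0 := cz_ge0 HO.
have Pin p : Y p -> (P p).1 = 0 /\ X (P p).2.
  move=> Yp; suff : [set p : seq2 | p.1 = 0 /\ X p.2] (P p) by [].
  by rewrite -Pim; exists p.
have Pfib y : X y -> P (0, y) = (0, y).
  move=> Xy; have : [set p : seq2 | p.1 = 0 /\ X p.2] (0, y) by [].
  by rewrite -Pim => -[w Yw <-]; exact: PP.
have P0 : P 0 = 0.
  by have := Plin (-1) 0 0 (qn_0 qY) (qn_0 qY); rewrite scaler0 addr0 scaleN1r addNr.
have Psum n (v : nat -> seq2) : (forall k, Y (v k)) ->
    P (\sum_(k < n) v k) = \sum_(k < n) P (v k).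
  move=> Yv; elim: n => [|n IH]; first by rewrite !big_ord0.
  rewrite !big_ord_recr /= addrC -[v n]scale1r Plin //; last by apply: (qn_sum qY).
  by rewrite !scale1r IH addrC.
pose rho k := (P (@e_ R k, 0)).2.
pose b k := - rho k k.
exists b, (c * ((1 + D) * (1 + D))).
apply: (cz_bounded_of_truncations HX (cz_shift HO b)) => N x Xx.
have [Yx nx] := tw_graph HX (Omega := Omega) Xx.
pose z : seq2 := (restr (fun k => k < N)%N x, restr (fun k => k < N)%N (Omega x)).
have [Yz nz] : Y z /\ nm Y z <= (1 + D) * nm X x.
  by rewrite -nx; exact: (tw_restr HX HO (fun k => k < N)%N Yx).
pose S := {ffun 'I_N -> bool}.
pose Sz (e : S) : seq2 := (sgn_seq R e \* z.1, sgn_seq R e \* z.2).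
have Sz_in e : Y (Sz e) /\ nm Y (Sz e) <= (1 + D) * ((1 + D) * nm X x).
  have [h1 h2] := tw_mul HX HO (@sgn_seq_le1 R N e) Yz; split=> //.
  by apply: le_trans h2 _; rewrite mul1r ler_wpM2l //; lra.
pose u (e : S) := sgn_seq R e \* (P (Sz e)).2.
have nu e : X (u e) /\ nm X (u e) <= c * ((1 + D) * (1 + D)) * nm X x.
  have [YS nS] := Sz_in e; have [P1 P2] := Pin _ YS; have [YP nP] := Pb _ YS.
  have [Xu hu] := X_mul HX P2 (@sgn_seq_le1 R N e); split=> //.
  apply: le_trans hu _; rewrite mul1r.
  have -> : nm X (P (Sz e)).2 = nm Y (P (Sz e)).
    by rewrite /= P1 (cz_0 HX HO) subr0 (qn_nm0 nX) add0r.
  by apply: le_trans nP _; rewrite -mulrA ler_wpM2l // -mulrA.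
have PSz e k : (P (Sz e)).2 k = \sum_(i < N) sgn_seq R e i * (x i * rho i k + Omega x i * @e_ R i
  k).
  pose v i : seq2 := sgn_seq R e i *: (x i *: ((@e_ R i, 0) : seq2) + Omega x i *: ((0, @e_ R i)
    : seq2)).
  have Y0e i : Y (0, @e_ R i) by case: (tw_fiber HX HO (X_e HX i)).
  have Yv i : Y (v i).
    by apply: (qnZ qY); apply: (qn_lin qY); [exact: tw_unit|apply: (qnZ qY)].
  have -> : Sz e = \sum_(i < N) v i.
    rewrite pair_sumE /= /Sz; apply/pair_equal_spec; split.
      under eq_bigr => i _ do rewrite scaler0 addr0 scalerA.
      rewrite (sum_e N (fun i => sgn_seq R e i * x i)); apply/funext => i.
      by rewrite /= /restr; case: ifP => //; rewrite mulr0.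
    under eq_bigr => i _ do rewrite scaler0 add0r scalerA.
    rewrite (sum_e N (fun i => sgn_seq R e i * Omega x i)); apply/funext => i.
    by rewrite /= /restr; case: ifP => //; rewrite mulr0.
  rewrite Psum // pair_sumE /= fct_sumE; apply: eq_bigr => i _.
  have -> : P (v i) = sgn_seq R e i *: (x i *: P (@e_ R i, 0) + Omega x i *: P (0, @e_ R i)).
    have h0 : forall a p, Y p -> P (a *: p) = a *: P p.
      by move=> a p Yp; have := Plin a p 0 Yp (qn_0 qY); rewrite P0 !addr0.
    rewrite /v h0; last by apply: (qn_lin qY); [exact: tw_unit|apply: (qnZ qY)].
    rewrite Plin; [|exact: tw_unit|exact: (qnZ qY)].
    by rewrite h0.
  by rewrite (Pfib _ (X_e HX i)).
have E : restr (fun k => k < N)%N (Omega x - b \* x) = (2 ^+ N)^-1 *: \sum_(e : S) u e.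
  apply/funext => k; rewrite [RHS](_ : _ = (2 ^+ N)^-1 * (\sum_(e : S) u e) k) // fct_sumE.
  rewrite /restr; case: ltnP => kN; last first.
    by rewrite big1 ?mulr0 // => e _; rewrite /u /= sgn_seq0 ?mul0r.
  rewrite /u /=.
  under eq_bigr => e _ do rewrite PSz mulr_sumr.
  rewrite exchange_big mulr_sumr /= (bigD1 (Ordinal kN)) //= [X in _ = _ + X]big1 ?addr0.
    under eq_bigr => e _ do rewrite mulrA.
    rewrite -mulr_suml mulrA.
    have := @avg_sign_sign R N (Ordinal kN) (Ordinal kN); rewrite eqxx.
    under eq_bigr => e _ do rewrite -!sgn_seqE /=.
    by move=> ->; rewrite mul1r !fctE /= /b /e_ eqxx mulr1 mulNr opprK addrC mulrC.
  move=> i ik.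
  under eq_bigr => e _ do rewrite mulrA.
  rewrite -mulr_suml mulrA.
  have := @avg_sign_sign R N (Ordinal kN) i; rewrite eq_sym (negbTE ik).
  under eq_bigr => e _ do rewrite -!sgn_seqE /=.
  by move=> ->; rewrite mul0r.
rewrite E (qn_scale nX); last by apply: (qn_sum nX) => e _; case: (nu e).
rewrite ger0_norm ?invr_ge0 ?exprn_ge0 // ler_pdivrMl ?exprn_gt0 //.
have : nm X (\sum_(e : S) u e) <= \sum_(e : S) nm X (u e).
  apply: (big_ind2 (fun a s => X a /\ nm X a <= s) _ _ _).2 => //.
  - by rewrite (qn_nm0 nX); split=> //; exact: (qn_0 nX).
  - move=> a s a' s' [Xa na] [Xa' na']; split; first exact: (qnD nX).
    by apply: le_trans (X_triangle HX Xa Xa') _; exact: lerD.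
  - by move=> e _; split=> //; case: (nu e).
move/le_trans; apply; apply: (@le_trans _ _ (\sum_(e : S) c * ((1 + D) * (1 + D)) * nm X x)).
  by apply: ler_sum => e _; case: (nu e).
by rewrite sumr_const card_signs -[_ *+ (2 ^ N)%N]mulr_natl natrX.
Qed.

End Bounded.

(** * Finite-dimensional Banach lattices have a basis of atoms *)

Lemma max_parts (R : realType) (r : R) :
  r = Num.max r 0 - Num.max (- r) 0 /\ Num.max r 0 + Num.max (- r) 0 = `|r|.
Proof.
have /orP[h|h] := le_total 0 r.
  have h' : - r <= 0 by lra.
  by rewrite (max_idPl h) (max_idPr h') ger0_norm // subr0 addr0.
have h' : 0 <= - r by lra.
by rewrite (max_idPr h) (max_idPl h') ler0_norm // sub0r add0r opprK.
Qed.

Section Lattice.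
Context {R : realType} {L : vectType R} {le : L -> L -> Prop}
  {join : L -> L -> L} {N : L -> R}.
Hypothesis HL : is_banach_lattice le join N.
Let refl := lattice_refl HL.
Let anti := lattice_anti HL.
Let trans := lattice_trans HL.
Let addr := lattice_add HL.

Lemma lat_sub x y : le x y <-> le 0 (y - x).
Proof.
split=> h; first by have := addr (- x) h; rewrite subrr.
by have := addr x h; rewrite subrK add0r.
Qed.

Lemma lat_subr x y : le x y -> le 0 (y - x).
Proof. by move/lat_sub. Qed.

Lemma lat_add x y z w : le x y -> le z w -> le (x + z) (y + w).
Proof.
move=> xy zw; apply: (trans (y := y + z)); first exact: addr.
by rewrite ![y + _]addrC; exact: addr.
Qed.

Lemma lat_scale (a : R) x y : 0 <= a -> le x y -> le (a *: x) (a *: y).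
Proof.
move=> a0 /lat_sub h; apply/lat_sub; rewrite -scalerBr; exact: (lattice_scale HL).
Qed.

Lemma lat_scale_le (a b : R) x : a <= b -> le 0 x -> le (a *: x) (b *: x).
Proof.
move=> ab x0; apply/lat_sub; rewrite -scalerBl; apply: (lattice_scale HL) => //.
by rewrite subr_ge0.
Qed.

Lemma lat_add0 x y : le 0 x -> le 0 y -> le 0 (x + y).
Proof. by move=> x0 y0; rewrite -[0]addr0; exact: lat_add. Qed.

Lemma lat_sum0 n (v : nat -> L) : (forall i, (i < n)%N -> le 0 (v i)) ->
  le 0 (\sum_(i < n) v i).
Proof.
elim: n => [|n IH] H; first by rewrite big_ord0; exact: refl.
rewrite big_ord_recr /=; apply: lat_add0; last exact: H.
by apply: IH => i /ltnW; exact: H.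
Qed.

Lemma lat_le_addr x y : le 0 y -> le x (x + y).
Proof. by move=> y0; apply/lat_sub; rewrite addrC addKr. Qed.

Definition lpos x := join x 0.

Lemma lpos_ge x : le x (lpos x). Proof. exact: (lattice_joinl HL). Qed.
Lemma lpos_ge0 x : le 0 (lpos x). Proof. exact: (lattice_joinr HL). Qed.
Lemma lpos_least x z : le x z -> le 0 z -> le (lpos x) z.
Proof. exact: (lattice_join_least HL). Qed.

Lemma lpos_sub x : lpos x - lpos (- x) = x.
Proof.
suff -> : lpos x = lpos (- x) + x by rewrite addrC addKr.
apply: anti.
  apply: lpos_least; first by have := addr x (lpos_ge0 (- x)); rewrite add0r.
  by have := addr x (lpos_ge (- x)); rewrite addNr.
rewrite -[X in le _ X](subrK x); apply: addr; apply: lpos_least.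
  by have := addr (- x) (lpos_ge0 x); rewrite add0r.
by have := addr (- x) (lpos_ge x); rewrite subrr.
Qed.

(** Disjointness of positive elements, without meets. *)
Definition ldisj a b := forall z, le z a -> le z b -> le z 0.

Lemma ldisj_sym a b : ldisj a b -> ldisj b a.
Proof. by move=> ab z zb za; exact: ab. Qed.

Lemma ldisj_le a b a' b' : ldisj a b -> le a' a -> le b' b -> ldisj a' b'.
Proof. by move=> ab a'a b'b z za zb; apply: ab; [exact: trans za _|exact: trans zb _]. Qed.

Lemma ldisj_pos x : ldisj (lpos x) (lpos (- x)).
Proof.
move=> z z1 z2.
have h1 : le x (lpos x - z).
  have e : lpos x = lpos (- x) + x by apply/eqP; rewrite addrC -subr_eq lpos_sub.
  by apply/lat_sub; rewrite e addrAC addrK; exact: lat_subr.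
have h2 : le 0 (lpos x - z) by exact: lat_subr.
have := lpos_least h1 h2 => /lat_sub; rewrite addrC addKr => h3.
by apply/lat_sub; rewrite sub0r.
Qed.

Lemma ldisjD v a b : le 0 v -> le 0 a -> le 0 b -> ldisj v a -> ldisj v b -> ldisj v (a + b).
Proof.
move=> v0 a0 b0 va vb z zv zab.
have pv : le (lpos z) v by apply: lpos_least.
have pab : le (lpos z) (a + b) by apply: lpos_least => //; exact: lat_add0.
apply: (trans (lpos_ge z)); apply: va => //.
apply/lat_sub; have /lat_sub : le (lpos z - a) 0; last by rewrite sub0r opprB.
apply: vb.
  by apply: trans pv; apply/lat_sub; rewrite opprB addrC subrK.
by have := addr (- a) pab; rewrite (addrC a) addrK.
Qed.

Lemma ldisjZ v a (t : R) : le 0 v -> le 0 a -> 0 <= t -> ldisj v a -> ldisj v (t *: a).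
Proof.
move=> v0 a0 t0 va z zv zta.
pose s := (t + 1)^-1.
have t1 : 0 < t + 1 by lra.
have s0 : 0 < s by rewrite invr_gt0.
have : le (s *: z) 0.
  apply: va.
    apply: trans (lat_scale (ltW s0) zv) _; rewrite -[X in le _ X]scale1r.
    by apply: lat_scale_le => //; rewrite /s invf_le1 //; lra.
  apply: trans (lat_scale (ltW s0) zta) _; rewrite scalerA -[X in le _ X]scale1r.
  by apply: lat_scale_le => //; rewrite /s mulrC ler_pdivrMr // mul1r; lra.
move=> /(lat_scale (ltW t1)); rewrite scalerA /s divff ?gt_eqF // scale1r scaler0 //.
Qed.

Lemma ldisj_sum v n (a : nat -> L) : le 0 v -> (forall i, (i < n)%N -> le 0 (a i)) ->
  (forall i, (i < n)%N -> ldisj v (a i)) -> ldisj v (\sum_(i < n) a i).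
Proof.
move=> v0; elim: n => [|n IH] a0 va; first by rewrite big_ord0; by [].
rewrite big_ord_recr /=; apply: ldisjD => //.
- by apply: lat_sum0 => i /ltnW; exact: a0.
- exact: a0.
- by apply: IH => i /ltnW; [exact: a0|exact: va].
- exact: va.
Qed.

(** The positive part of a + b - x lies below both a and b. *)
Lemma ldisj_sum_le a b x : le 0 a -> le 0 b -> ldisj a b -> le a x -> le b x ->
  le (a + b) x.
Proof.
move=> a0 b0 ab ax bx.
have : le (lpos (a + b - x)) 0.
  apply: ab; apply: lpos_least => //; apply/lat_sub.
    have -> : a - (a + b - x) = x - b by rewrite -addrA opprD addrA subrr add0r opprB.
    exact: lat_subr.
  have -> : b - (a + b - x) = x - a by rewrite [a + b]addrC -addrA opprD addrA subrr add0r opprB.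
  exact: lat_subr.
move=> /(trans (lpos_ge _)) /(addr x); rewrite subrK add0r //.
Qed.

Lemma lat_norm_mono a b : le 0 a -> le a b -> N a <= N b.
Proof.
move=> a0 ab; apply: (lattice_norm HL).
apply: (trans (y := b)); last exact: (lattice_joinl HL).
apply: (lattice_join_least HL) => //; apply: (trans (y := 0)); last exact: (trans a0 ab).
by apply/lat_sub; rewrite sub0r opprK.
Qed.

Let qN := normed_quasi (lattice_normed HL).

Lemma lat_N0 x : 0 <= N x.
Proof. by have := qn_ge0 qN (x := x) I. Qed.

Lemma lat_NZ (a : R) x : N (a *: x) = `|a| * N x.
Proof. exact: (qn_scale qN a (x := x)). Qed.

Lemma lat_N_eq0 x : N x = 0 -> x = 0.
Proof. exact: (qn_eq0 qN (x := x)). Qed.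

(** The positive part of y - x lies below every multiple of v, so that its norm
    vanishes. *)
Lemma lat_archimedean v x y : le 0 v ->
  (forall eps : R, 0 < eps -> le y (x + eps *: v)) -> le y x.
Proof.
move=> v0 H.
have N_le eps : 0 < eps -> N (lpos (y - x)) <= 0 + eps.
  move=> e0; pose d := eps / (N v + 1).
  have Nv := lat_N0 v.
  have d0 : 0 < d by rewrite divr_gt0 //; lra.
  rewrite add0r; apply: (@le_trans _ _ (N (d *: v))).
    apply: lat_norm_mono; first exact: lpos_ge0.
    apply: lpos_least; last by apply: (lattice_scale HL) => //; exact: ltW.
    by have := addr (- x) (H d d0); rewrite (addrC x) addrK.
  rewrite lat_NZ gtr0_norm // /d mulrAC ler_pdivrMr; last lra.
  by rewrite ler_pM2l //; lra.
have : N (lpos (y - x)) = 0 by apply/eqP; rewrite eq_le lat_N0 (le_eps N_le).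
move=> /lat_N_eq0 p0; have := lpos_ge (y - x); rewrite p0 => /(addr x).
by rewrite subrK add0r.
Qed.

Definition lsystem n (e : nat -> L) : Prop :=
  (forall i, (i < n)%N -> le 0 (e i) /\ e i <> 0) /\
  (forall i j, (i < n)%N -> (j < n)%N -> i <> j -> ldisj (e i) (e j)).

Lemma lsystem_free n e (c : nat -> R) : lsystem n e ->
  \sum_(i < n) c i *: e i = 0 -> forall i, (i < n)%N -> c i = 0.
Proof.
move=> [e0 ed] s0 j jn; apply: contrapT => /eqP cj.
have [ej0 ejn] := e0 j jn; apply: ejn; apply: anti => //.
pose a i := if i == j then 0 else (`|c i / c j|) *: e i.
have a0 i : (i < n)%N -> le 0 (a i).
  move=> ni; rewrite /a; case: eqP => _; first exact: refl.
  by apply: (lattice_scale HL) => //; case: (e0 i ni).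
apply: (@ldisj_sum (e j) n a ej0 a0 _ (e j)) => //.
  move=> i ni; rewrite /a; case: eqP => [_|ij]; first by [].
  by apply: ldisjZ => //; [case: (e0 i ni)|apply: ed => // /esym].
have -> : e j = \sum_(i < n) (if i == j :> nat then 0 else (- (c i / c j)) *: e i).
  rewrite (bigD1 (Ordinal jn)) //= eqxx add0r.
  move: s0; rewrite (bigD1 (Ordinal jn)) //= => /(congr1 (fun x => (c j)^-1 *: x)).
  rewrite scalerDr scalerA mulVf // scale1r scaler0 => /eqP; rewrite addr_eq0 => /eqP ->.
  rewrite scaler_sumr -sumrN; apply: eq_bigr => i ij.
  have -> : (i == j :> nat) = false by apply/negbTE; apply: contraNneq ij => h; apply/eqP/val_inj.
  by rewrite scalerA scaleNr mulrC.
have H (i : 'I_n) : le (if i == j :> nat then 0 else (- (c i / c j)) *: e i) (a i).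
  rewrite /a; case: eqP => _; first exact: refl.
  by apply: lat_scale_le; [rewrite -normrN ler_norm|case: (e0 i (ltn_ord i))].
by apply: (big_ind2 le) => [|? ? ? ? h1 h2|i _]; [exact: refl|exact: lat_add|exact: H].
Qed.

Lemma lsystem_dim n e : lsystem n e -> (n <= \dim {: L})%N.
Proof.
move=> Se; pose X := [tuple e i | i < n].
have fX : free X.
  apply/freeP => k; under eq_bigr => i _ do rewrite -tnth_nth tnth_mktuple.
  move=> s0 i; pose c j := if insub j is Some i then k i else 0.
  have := @lsystem_free n e c Se _ i (ltn_ord i); rewrite /c valK; apply.
  by rewrite -[RHS]s0; apply: eq_bigr => j _; rewrite valK.
have /eqP dX : \dim <<X>> == size X by [].
by rewrite -(size_tuple X) -dX; apply: dimvS; exact: subvf.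
Qed.

Lemma lsystem_max : exists n e, lsystem n e /\ forall e', ~ lsystem n.+1 e'.
Proof.
have ex : exists n, (fun n => `[< exists e, lsystem n e >]) n.
  by exists 0%N; apply/asboolP; exists (fun=> 0); split.
have ub : forall n, `[< exists e, lsystem n e >] -> (n <= \dim {: L})%N.
  by move=> n /asboolP[e]; exact: lsystem_dim.
case: (ex_maxnP ex ub) => n /asboolP[e Se] max; exists n, e; split=> // e' Se'.
by have := max n.+1 (introT (asboolP _) (ex_intro _ e' Se')); rewrite ltnn.
Qed.

(** The supremum is attained because the order is Archimedean. *)
Lemma lat_sup_scale e x : le 0 e -> e <> 0 -> le 0 x ->
  exists l : R, [/\ 0 <= l, le (l *: e) x & forall t, le (t *: e) x -> t <= l].
Proof.
move=> e0 en x0.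
have Ne : 0 < N e.
  by rewrite lt_neqAle lat_N0 andbT; apply/eqP => /esym/lat_N_eq0.
pose S := [set t : R | 0 <= t /\ le (t *: e) x].
have S0 : S 0 by split=> //; rewrite scale0r.
have Sb t : S t -> t <= N x / N e.
  move=> [t0 tx]; rewrite ler_pdivlMr // -[t]ger0_norm // -lat_NZ.
  by apply: lat_norm_mono => //; exact: (lattice_scale HL).
have Sub : has_ubound S by exists (N x / N e) => t /Sb.
have l0 : 0 <= sup S by exact: ub_le_sup.
exists (sup S); split=> //.
  apply: (lat_archimedean (v := e)) => // eps eps0.
  have [t [t0 tx] lt] := @sup_adherent R S eps eps0 (conj (ex_intro _ 0 S0) Sub).
  apply: (trans (y := (t + eps) *: e)).
    by apply: lat_scale_le => //; lra.
  by rewrite scalerDl; exact: addr.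
move=> t tx; have [t0|t0] := lerP 0 t; first exact: ub_le_sup.
by apply: le_trans (ltW t0) l0.
Qed.

Section MaximalSystem.
Context {n : nat} {e : nat -> L}.
Hypothesis Se : lsystem n e.
Hypothesis Smax : forall e', ~ lsystem n.+1 e'.

(** The members of a maximal disjoint system are atoms: were x not comparable
    with some t e_i, the positive and negative parts of x - t e_i would replace
    e_i in a larger system. *)
Lemma lat_atom i x : (i < n)%N -> le 0 x -> le x (e i) ->
  exists2 l : R, 0 <= l & x = l *: e i.
Proof.
move=> ni x0 xe; have [e0 ed] := Se; have [ei0 ein] := e0 i ni.
have dich t : 0 <= t -> le x (t *: e i) \/ le (t *: e i) x.
  move=> t0; pose u := lpos (x - t *: e i); pose w := lpos (- (x - t *: e i)).
  have [u0|un] := pselect (u = 0).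
    by left; have := lpos_ge (x - t *: e i); rewrite -/u u0 => /(addr (t *: e i));
      rewrite subrK add0r.
  have [w0|wn] := pselect (w = 0).
    right; have := lpos_ge (- (x - t *: e i)); rewrite -/w w0 opprB => /(addr x).
    by rewrite subrK add0r.
  have te0 : le 0 (t *: e i) by exact: (lattice_scale HL).
  have ux : le u (e i).
    apply: lpos_least => //; apply: (trans (y := x)) => //.
    by apply/lat_sub; rewrite opprB addrC subrK.
  have wt : le w (t *: e i).
    apply: lpos_least => //; rewrite opprB.
    by apply/lat_sub; rewrite opprB addrC subrK.
  apply: False_ind; apply: (@Smax (fun k => if k == i then u else if k == n then w else e k));
    split.
    move=> k; rewrite ltnS leq_eqVlt => kn.
    case: eqP => _; first by split=> //; exact: lpos_ge0.
    case: eqP kn => [_ _|_ /= kn]; first by split=> //; exact: lpos_ge0.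
    exact: e0.
  have uw : ldisj u w by exact: ldisj_pos.
  have eu k : (k < n)%N -> k <> i -> ldisj (e k) u.
    by move=> kn ki; apply: (ldisj_le (ed k i kn ni ki)).
  have ew k : (k < n)%N -> k <> i -> ldisj (e k) w.
    move=> kn ki; apply: (@ldisj_le (e k) (t *: e i)) => //.
    by apply: ldisjZ => //; [case: (e0 k kn)|exact: ed].
  move=> k j; rewrite !ltnS (leq_eqVlt k) (leq_eqVlt j).
  case: (k =P i) => [->|ki]; case: (j =P i) => [->|ji] //.
    case: (j =P n) => //= jn _ jn' _; apply: ldisj_sym; exact: eu.
    case: (k =P n) => //= kn kn' _ _; [exact: ldisj_sym|exact: eu].
  case: (k =P n) => [->|kn] /=; case: (j =P n) => [->|jn] //= hk hj kj.
  - by apply: ldisj_sym; exact: ew.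
  - exact: ew.
  - exact: ed.
have [l [l0 lx lmax]] := lat_sup_scale ei0 ein x0.
exists l => //; apply: anti => //.
apply: (lat_archimedean (v := e i)) => // eps eps0; rewrite -scalerDl.
have [|//|h] := dich (l + eps); first by lra.
by have := lmax _ h; lra.
Qed.

Lemma lat_decompose_pos x : le 0 x -> exists c : nat -> R, x = \sum_(i < n) c i *: e i.
Proof.
move=> x0; have [e0 ed] := Se.
have /choice[c Hc] i : exists l : R, (i < n)%N ->
    [/\ 0 <= l, le (l *: e i) x & forall t, le (t *: e i) x -> t <= l].
  have [ni|ni] := boolP (i < n)%N; last by exists 0.
  by have [ei0 ein] := e0 i ni; have [l Hl] := lat_sup_scale ei0 ein x0; exists l.
exists c; pose y k := \sum_(i < k) c i *: e i.
have ce0 i : (i < n)%N -> le 0 (c i *: e i).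
  by move=> ni; have [c0 _ _] := Hc i ni; apply: (lattice_scale HL) => //; case: (e0 i ni).
have yx k : (k <= n)%N -> le (y k) x.
  elim: k => [|k IH] kn; first by rewrite /y big_ord0.
  rewrite /y big_ord_recr /=; have [ck0 ckx _] := Hc k kn.
  apply: ldisj_sum_le => //.
  - by apply: (lat_sum0 (v := fun i => c i *: e i)) => i ik; apply: ce0; apply: ltn_trans kn.
  - exact: ce0.
  - apply/ldisj_sym/(ldisj_sum (a := fun i => c i *: e i)); first exact: ce0.
      by move=> i ik; apply: ce0; apply: ltn_trans kn.
    move=> i ik; have ni : (i < n)%N by apply: ltn_trans kn.
    have [ci0 _ _] := Hc i ni; have [ei0 _] := e0 i ni; have [ek0 _] := e0 k kn.
    apply: ldisjZ => //; first exact: ce0.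
    apply/ldisj_sym/ldisjZ => //; apply: ed => // h; by move: ik; rewrite h ltnn.
  - exact/IH/ltnW.
pose x' := x - y n.
have x'0 : le 0 x' by apply: lat_subr; exact: yx.
have [x'z|x'n] := pselect (x' = 0); first exact: subr0_eq.
have dis i : (i < n)%N -> ldisj x' (e i).
  move=> ni z zx' ze; have [ei0 ein] := e0 i ni.
  have p1 : le (lpos z) x' by apply: lpos_least.
  have p2 : le (lpos z) (e i) by apply: lpos_least.
  have [mu mu0 pz] := lat_atom ni (lpos_ge0 z) p2.
  have [ci0 cix cmax] := Hc i ni.
  have : c i + mu <= c i.
    apply: cmax; rewrite scalerDl -pz.
    apply: (trans (y := y n + x')); last by rewrite /x' addrC subrK.
    apply: lat_add p1; rewrite /y (bigD1 (Ordinal ni)) //=; apply: lat_le_addr.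
    by apply: big_ind => // [a b|k _]; [exact: lat_add0|exact: ce0].
  move=> h; have m0 : mu = 0 by lra.
  by have := lpos_ge z; rewrite pz m0 scale0r.
apply: False_ind; apply: (@Smax (fun k => if k == n then x' else e k)); split=> [k|k j];
  rewrite ?ltnS (leq_eqVlt k) ?(leq_eqVlt j).
  by case: eqP => //= _ kn; exact: e0.
case: (k =P n) => [->|kn] /=; case: (j =P n) => [->|jn] //= hk hj kj.
- exact: dis.
- by apply: ldisj_sym; exact: dis.
- exact: ed.
Qed.

Lemma lat_decompose x : exists c : nat -> R, x = \sum_(i < n) c i *: e i.
Proof.
have [c cE] := lat_decompose_pos (lpos_ge0 x).
have [d dE] := lat_decompose_pos (lpos_ge0 (- x)).
exists (fun i => c i - d i).
rewrite -{1}(lpos_sub x) cE dE -sumrB; apply: eq_bigr => i _.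
by rewrite scalerBl.
Qed.

(** The members being disjoint, the modulus of a combination has the moduli of
    its coefficients as coefficients, and the norm is monotone in the modulus. *)
Lemma lat_multiplier (t c : nat -> R) : (forall i, `|t i| <= 1) ->
  N (\sum_(i < n) (t i * c i) *: e i) <= N (\sum_(i < n) c i *: e i).
Proof.
move=> t1; have [e0 ed] := Se; apply: (lattice_norm HL).
set x := \sum_(i < n) c i *: e i; set z := join x (- x).
have xz : le x z by exact: (lattice_joinl HL).
have nxz : le (- x) z by exact: (lattice_joinr HL).
have z0 : le 0 z.
  have := lat_add xz nxz; rewrite subrr -mulr2n -scaler_nat => h.
  have i2 : 0 <= 2^-1 :> R by lra.
  by have := lat_scale i2 h; rewrite scaler0 scalerA mulVf // scale1r.
have ei0 i : (i < n)%N -> le 0 (e i) by move=> ni; case: (e0 i ni).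
pose pc i := Num.max (c i) 0; pose nc i := Num.max (- c i) 0.
have pc0 i : 0 <= pc i by rewrite le_max lexx orbT.
have nc0 i : 0 <= nc i by rewrite le_max lexx orbT.
pose p := \sum_(i < n) pc i *: e i; pose q := \sum_(i < n) nc i *: e i.
have sc0 (f : nat -> R) i : (forall i, 0 <= f i) -> (i < n)%N -> le 0 (f i *: e i).
  by move=> f0 ni; apply: (lattice_scale HL) => //; exact: ei0.
have p0 : le 0 p by apply: (lat_sum0 (v := fun i => pc i *: e i)) => i; exact: sc0.
have q0 : le 0 q by apply: (lat_sum0 (v := fun i => nc i *: e i)) => i; exact: sc0.
have xpq : x = p - q.
  rewrite /x /p /q -sumrB; apply: eq_bigr => i _; rewrite -scalerBl; congr (_ *: _).
  by rewrite /pc /nc; case: (max_parts (c i)).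
have pq : ldisj p q.
  apply: (ldisj_sum (a := fun i => nc i *: e i)) => // i ni; first exact: sc0.
  apply/ldisj_sym/(ldisj_sum (a := fun i => pc i *: e i)) => [|j nj|j nj]; first exact: sc0.
    exact: sc0.
  have [->|/eqP ji] := eqVneq j i; last first.
    apply: ldisjZ => //; [exact: sc0|exact: ei0|].
    by apply/ldisj_sym/ldisjZ => //; [exact: ei0|exact: ei0|exact: ed].
  have [ci|ci] := lerP 0 (c i).
    have -> : nc i = 0 by rewrite /nc; apply/max_idPr; lra.
    by rewrite scale0r; apply: ldisj_sym.
  have -> : pc i = 0 by rewrite /pc; apply/max_idPr; lra.
  by rewrite scale0r; by [].
have pz : le p z.
  have h1 : le (lpos (p - z)) p.
    by apply: lpos_least => //; apply/lat_sub; rewrite opprB addrC subrK.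
  have h2 : le (lpos (p - z)) q.
    apply: lpos_least => //; apply/lat_sub.
    have -> : q - (p - z) = z - x by rewrite xpq !opprB addrCA.
    exact: lat_subr.
  by have := trans (lpos_ge _) (pq _ h1 h2) => /(addr z); rewrite subrK add0r.
have qz : le q z.
  have h1 : le (lpos (q - z)) q.
    by apply: lpos_least => //; apply/lat_sub; rewrite opprB addrC subrK.
  have h2 : le (lpos (q - z)) p.
    apply: lpos_least => //; apply/lat_sub.
    have -> : p - (q - z) = z - (- x) by rewrite xpq opprK opprB addrCA.
    exact: lat_subr.
  by have := trans (lpos_ge _) (pq _ h2 h1) => /(addr z); rewrite subrK add0r.
apply: (trans (y := p + q)); last exact: ldisj_sum_le.
have pqE : p + q = \sum_(i < n) `|c i| *: e i.
  rewrite /p /q -big_split; apply: eq_bigr => i _ /=; rewrite -scalerDl; congr (_ *: _).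
  by rewrite /pc /nc; case: (max_parts (c i)).
have bound (f : nat -> R) : (forall i, f i <= `|c i|) -> le (\sum_(i < n) f i *: e i) (p + q).
  move=> fc; rewrite pqE; apply: (big_ind2 le) => [|? ? ? ? h1 h2|i _];
    [exact: refl|exact: lat_add|].
  by apply: lat_scale_le => //; exact: ei0.
have tc i : `|t i * c i| <= `|c i| by rewrite normrM ler_piMl.
apply: (lattice_join_least HL); first by apply: (bound (fun i => t i * c i)) => i;
  apply: le_trans (ler_norm _) _.
rewrite -sumrN; under eq_bigr => i _ do rewrite -scaleNr.
by apply: (bound (fun i => - (t i * c i))) => i; apply: le_trans (ler_norm _) _; rewrite normrN.
Qed.

End MaximalSystem.

(** A maximal disjoint system exists because disjoint elements are independent,
    and it spans: what remains of a positive x after removal of its largest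
    multiples of the members is disjoint from all of them. *)
Theorem finite_lattice_coordinates : exists n (e : nat -> L) (phi : nat -> L -> R),
  [/\ forall j (a : R) x y, (j < n)%N -> phi j (a *: x + y) = a * phi j x + phi j y,
      forall x, x = \sum_(j < n) phi j x *: e j &
      forall (t : nat -> R) x, (forall j, `|t j| <= 1) ->
        N (\sum_(j < n) (t j * phi j x) *: e j) <= N x].
Proof.
have [n [e [Se Smax]]] := lsystem_max.
have /choice[c cE] := lat_decompose Se Smax.
exists n, e, (fun j x => c x j); split=> [j a x y nj|x|t x t1].
- apply/eqP; rewrite -subr_eq0; apply/eqP.
  apply: (lsystem_free Se (c := fun j => c (a *: x + y) j - (a * c x j + c y j))) => //.
  under eq_bigr => i _ do rewrite scalerBl scalerDl -scalerA.
  by rewrite sumrB big_split /= -scaler_sumr -!cE subrr.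
- exact: cE.
- by have := lat_multiplier Se (c x) t1; rewrite -cE.
Qed.

End Lattice.

(** * Local unconditional structure *)

Section LUST.
Context {R : realType} {X : nspace (nat -> R : lmodType R)}.
Hypothesis HX : sequence_space X.
Let nX := seqsp_quasi HX.
Context {Omega : (nat -> R) -> (nat -> R)} {D : R}.
Hypothesis HO : centralizer_le X Omega D.
Local Notation Y := (twisted_sum X Omega).
Let qY := tw_quasi HX HO.
Let seq2 := ((nat -> R) * (nat -> R) : lmodType R)%type.

(** Factored through a finite-dimensional lattice, the identity of the span of
    the first N coordinates is the sum of the rank one operators given by the
    atoms of that lattice. *)
Theorem unconditional_sums_of_lust : local_unconditional_structure Y ->
  uniform_unconditional_sums (X := X) (Omega := Omega).
Proof.
case=> C HC; exists `|C| => // N.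
pose f k : seq2 := (@e_ R k, 0).
pose g k : seq2 := (0, @e_ R k).
have Yf k : Y (f k) by exact: (tw_unit HX HO).
have Yg k : Y (g k) by case: (tw_fiber HX HO (X_e HX k)).
pose v (i : 'I_(N + N)) : seq2 := match fintype.split i with inl k => f k | inr k => g k end.
pose E := [set x | exists a : 'I_(N + N) -> R, x = \sum_(i < N + N) a i *: v i].
have Yv i : Y (v i) by rewrite /v; case: (fintype.split i) => k; [exact: Yf|exact: Yg].
have EY : E `<=` carrier Y.
  by move=> _ [a ->]; apply: (qn_sum qY) => i _; exact: (qnZ qY).
have Esum (a b : nat -> R) : E (\sum_(k < N) (a k *: f k + b k *: g k)).
  exists (fun i => match fintype.split i with inl k => a k | inr k => b k end).
  rewrite big_split_ord /= big_split /=; congr (_ + _); apply: eq_bigr => k _.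
    by rewrite /v (unsplitK (inl k)).
  by rewrite /v (unsplitK (inr k)).
have [L [le [join [NL [HL [A [B [cA [cB [[cA0 Alin Ab] [cB0 Blin Bb] cAB BA]]]]]]]]]] :=
  HC E EY (ex_intro _ _ (ex_intro _ v erefl)).
have [n [e [phi [phiL phiE phit]]]] := finite_lattice_coordinates HL.
have Ef k : (k < N)%N -> E (f k).
  move=> kN; have := Esum (fun i => (i == k)%:R) (fun=> 0).
  rewrite (bigD1 (Ordinal kN)) //= eqxx scale1r scale0r addr0 big1 ?addr0 // => i ik.
  have -> : (i == k :> nat) = false by apply/negbTE; apply: contraNneq ik => h; apply/eqP/val_inj.
  by rewrite !scale0r addr0.
have Eg k : (k < N)%N -> E (g k).
  move=> kN; have := Esum (fun=> 0) (fun i => (i == k)%:R).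
  rewrite (bigD1 (Ordinal kN)) //= eqxx scale1r scale0r add0r big1 ?addr0 // => i ik.
  have -> : (i == k :> nat) = false by apply/negbTE; apply: contraNneq ik => h; apply/eqP/val_inj.
  by rewrite !scale0r addr0.
have E0 : E 0.
  have := Esum (fun=> 0) (fun=> 0); rewrite big1 // => i _; by rewrite !scale0r addr0.
have A0 : A 0 = 0.
  by have := Alin (-1) 0 0 E0 E0; rewrite scaler0 addr0 scaleN1r addNr.
have ED x y : E x -> E y -> E (x + y).
  move=> [a ->] [b ->]; exists (fun i => a i + b i).
  by rewrite -big_split; apply: eq_bigr => i _; rewrite scalerDl.
have EZ (c : R) x : E x -> E (c *: x).
  move=> [a ->]; exists (fun i => c * a i).
  by rewrite scaler_sumr; apply: eq_bigr => i _; rewrite scalerA.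
have AZ (c : R) x : E x -> A (c *: x) = c *: A x.
  by move=> Ex; have := Alin c x 0 Ex E0; rewrite A0 !addr0.
have AD x y : E x -> E y -> A (x + y) = A x + A y.
  by move=> Ex Ey; have := Alin 1 x y Ex Ey; rewrite !scale1r.
have B0 : B 0 = 0.
  by have := Blin (-1) 0 0 I I; rewrite scaler0 addr0 scaleN1r addNr.
have Bsum (a : nat -> R) : B (\sum_(j < n) a j *: e j) = \sum_(j < n) a j *: B (e j).
  elim: (n) => [|m IH]; first by rewrite !big_ord0.
  by rewrite !big_ord_recr /= addrC Blin // IH addrC.
have phiD j x y : (j < n)%N -> phi j (x + y) = phi j x + phi j y.
  by move=> jn; have := phiL j 1 x y jn; rewrite scale1r mul1r.
have phi0 j : (j < n)%N -> phi j 0 = 0.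
  by move=> jn; have := phiL j (-1) 0 0 jn; rewrite scaler0 addr0 mulN1r addNr.
have phiZ j (c : R) x : (j < n)%N -> phi j (c *: x) = c * phi j x.
  by move=> jn; have := phiL j c x 0 jn; rewrite phi0 // !addr0.
exists n, (fun k j => phi j (A (f k))), (fun k j => phi j (A (g k))), (fun j => B (e j)); split.
- by move=> j; case: (Bb (e j) I).
- move=> k kN.
  have h : \sum_(j < n) phi j (A (f k)) *: B (e j) = f k.
    by rewrite -(Bsum (fun j => phi j (A (f k)))) -phiE BA //; exact: Ef.
  have := congr1 (fun p : seq2 => p.1 k) h.
  rewrite pair_sumE /= fct_sumE /= => ->.
  by rewrite /e_ eqxx ler_pdivrMr // mul1r ler_nat.
move=> t t1 p Yp p0.
have pE : p = \sum_(k < N) (p.1 k *: f k + p.2 k *: g k) by exact: pair_expansion.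
have Ep : E p by rewrite pE; exact: Esum.
have phip j : (j < n)%N ->
    functional N (fun k j => phi j (A (f k))) (fun k j => phi j (A (g k))) p j = phi j (A p).
  move=> jn; rewrite /functional [in RHS]pE.
  suff H : forall m, (m <= N)%N -> E (\sum_(k < m) (p.1 k *: f k + p.2 k *: g k)) /\
    phi j (A (\sum_(k < m) (p.1 k *: f k + p.2 k *: g k))) =
    \sum_(k < m) (p.1 k * phi j (A (f k)) + p.2 k * phi j (A (g k))).
    by have [_ ->] := H N (leqnn N).
  elim=> [|m IH] mN; first by rewrite !big_ord0 A0 phi0.
  have [Es Is] := IH (ltnW mN).
  have E1 := EZ (p.1 m) _ (Ef m mN); have E2 := EZ (p.2 m) _ (Eg m mN).
  rewrite !big_ord_recr /=; split; first by apply: (ED _ _ Es); exact: ED.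
  rewrite AD //; last exact: ED.
  by rewrite phiD // Is AD // phiD // !AZ ?phiZ //; [exact: Eg|exact: Ef].
under eq_bigr => j _ do rewrite phip //.
rewrite -(Bsum (fun j => t j * phi j (A p))).
have [_ h1] := Bb (\sum_(j < n) (t j * phi j (A p)) *: e j) I.
have h2 := phit t (A p) t1.
have [_ h3] := Ab p Ep.
have Yp0 := qn_ge0 qY Yp.
apply: le_trans h1 _; apply: (@le_trans _ _ (cB * (cA * nm Y p))).
  by apply: ler_wpM2l => //; apply: le_trans h2 h3.
rewrite mulrA; apply: ler_wpM2r => //; rewrite mulrC.
by apply: le_trans cAB _; exact: ler_norm.
Qed.

End LUST.

Lemma lust_isomorphic (R : realType) (V W : lmodType R) (Q Q' : R)
    (E : nspace V) (F : nspace W) :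
  quasi_normed Q E -> quasi_normed Q' F -> isomorphic E F ->
  local_unconditional_structure F -> local_unconditional_structure E.
Proof.
move=> qE qF [T [T' [[c [c0 Tl Tb]] [c' [c'0 T'l T'b]] T'T TT']]] [C HC].
exists (c * c' * `|C|) => G GE [n [v Gv]].
have Gv' i : G (v i).
  rewrite Gv; exists (fun j => (j == i)%:R).
  rewrite (bigD1 i) //= eqxx scale1r big1 ?addr0 // => j ji.
  by rewrite (negbTE ji) scale0r.
have Ev i : E (v i) by exact: GE.
have T0 : T 0 = 0.
  by have := Tl (-1) 0 0 (qn_0 qE) (qn_0 qE); rewrite scaler0 addr0 scaleN1r addNr.
have Tsum (a : 'I_n -> R) : T (\sum_(i < n) a i *: v i) = \sum_(i < n) a i *: T (v i).
  suff [] : E (\sum_(i < n) a i *: v i) /\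
    T (\sum_(i < n) a i *: v i) = \sum_(i < n) a i *: T (v i) by [].
  apply: (big_ind2 (fun x y => E x /\ T x = y)) => [|x y x' y' [Ex <-] [Ex' <-]|i _].
  - by split=> //; exact: (qn_0 qE).
  - split; first exact: (qnD qE).
    by rewrite -[x in LHS]scale1r Tl // scale1r.
  - split; first exact: (qnZ qE).
    by rewrite -[_ *: v i]addr0 Tl ?T0 ?addr0 //; exact: (qn_0 qE).
pose H := [set y | exists a : 'I_n -> R, y = \sum_(i < n) a i *: T (v i)].
have TG x : G x -> H (T x) by rewrite Gv => -[a ->]; exists a.
have HF : H `<=` carrier F.
  by move=> _ [a ->]; apply: (qn_sum qF) => i _; apply: (qnZ qF); case: (Tb (v i) (Ev i)).
have [L [le [join [NL [HL [A [B [cA [cB [[cA0 Alin Ab] [cB0 Blin Bb] cAB BA]]]]]]]]]] :=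
  HC H HF (ex_intro _ _ (ex_intro _ _ erefl)).
exists L, le, join, NL; split=> //.
exists (A \o T), (T' \o B), (cA * c), (c' * cB); split.
- split; first exact: mulr_ge0.
    by move=> a x y Gx Gy /=; rewrite Tl ?Alin //; [exact: TG|exact: TG|exact: GE|exact: GE].
  move=> x Gx; split=> //=; have [_ h1] := Ab _ (TG x Gx); have [_ h2] := Tb _ (GE x Gx).
  by apply: le_trans h1 _; rewrite -mulrA; apply: ler_wpM2l.
- split; first exact: mulr_ge0.
    move=> a x y _ _ /=; rewrite Blin // T'l //; [by case: (Bb x I)|by case: (Bb y I)].
  move=> x _; have [FB h1] := Bb x I; have [ET h2] := T'b _ FB; split=> //=.
  by apply: le_trans h2 _; rewrite -mulrA; apply: ler_wpM2l.
- have -> : cA * c * (c' * cB) = c * c' * (cA * cB) by ring.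
  apply: ler_wpM2l; first exact: mulr_ge0.
  by apply: le_trans cAB _; exact: ler_norm.
- by move=> x Gx /=; rewrite BA ?T'T //; [exact: GE|exact: TG].
Qed.

Section DirectSumLUST.
Context {R : realType} {X : nspace (nat -> R : lmodType R)}.
Hypothesis HX : sequence_space X.
Let nX := seqsp_quasi HX.
Let seq2 := ((nat -> R) * (nat -> R) : lmodType R)%type.
Local Notation XX := (direct_sum X X).

Lemma direct_sum_quasi : quasi_normed 1 XX.
Proof.
split=> //.
- by split; exact: (qn_0 nX).
- by move=> a [x y] [x' y'] [/= Xx Xy] [/= Xx' Xy']; split=> /=; exact: (qn_lin nX).
- move=> [x y] [x' y'] [/= Xx Xy] [/= Xx' Xy']; rewrite mul1r.
  have := X_triangle HX Xx Xx'; have := X_triangle HX Xy Xy'; lra.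
- by move=> a [x y] [/= Xx Xy]; rewrite !(qn_scale nX) // mulrDr.
- move=> [x y] [/= Xx Xy] h; have := qn_ge0 nX Xx; have := qn_ge0 nX Xy => h1 h2.
  have -> : x = 0 by apply: (qn_eq0 nX) => //; lra.
  by have -> : y = 0 by apply: (qn_eq0 nX) => //; lra.
Qed.

(** Truncation maps a finite-dimensional subspace almost isometrically into the
    lattice spanned by finitely many unit vectors; the error is a combination of
    functionals that see the truncated vector only, and can be added back on the
    way out of the lattice. *)
Theorem direct_sum_lust : local_unconditional_structure XX.
Proof.
have qXX := direct_sum_quasi.
exists 2 => E EX [n [v Ev]].
pose c k (p : seq2) := if odd k then p.2 k./2 else p.1 k./2.
have csep p : (forall k, c k p = 0) -> p = 0.
  case: p => x y H; apply/pair_equal_spec; split; apply/funext => k.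
    by have := H k.*2; rewrite /c odd_double doubleK.
  by have := H k.*2.+1; rewrite /c /= odd_double /= uphalf_double.
have clin k (a : R) p p' : c k (a *: p + p') = a * c k p + c k p'.
  by rewrite /c; case: odd.
have [w [g [m [h [gE [xE wE]]]]]] := finite_dim_dual_system clin csep n
  (fun i => if insub i is Some j then v j else 0).
have Ew i : E (w i).
  have [b ->] := wE i; rewrite Ev; exists (fun j => b j).
  by apply: eq_bigr => j _; rewrite valK.
have Exp x : E x -> x = \sum_(i < n) g i x *: w i.
  rewrite Ev => -[a ax].
  have := xE (fun i => if insub i is Some j then a j else 0); rewrite /=.
  have -> : \sum_(i < n) (if insub (i : nat) is Some j then a j else 0) *:
      (if insub (i : nat) is Some j then v j else 0) = x.
    by rewrite ax; apply: eq_bigr => i _; rewrite valK.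
  by [].
pose P N (p : seq2) : seq2 := (restr (fun k => k < N)%N p.1, restr (fun k => k < N)%N p.2).
have XXP N p : XX (P N p) by split; exact: X_fin.
have gP i N p : (m <= N)%N -> g i (P N p) = g i p.
  move=> mN; rewrite !gE; apply: eq_bigr => k _; congr (_ * _).
  have kN : (k./2 < N)%N by move: (ltn_ord k) mN; lia.
  by rewrite /c /P /= /restr; case: odd; rewrite kN.
have glin i (a : R) p p' : g i (a *: p + p') = a * g i p + g i p'.
  by rewrite !gE mulr_sumr -big_split; apply: eq_bigr => k _; rewrite clin /=; ring.
pose G i := \sum_(k < m) `|h i k| / nm X (@e_ R k./2).
have G0 i : 0 <= G i by apply: sumr_ge0 => k _; rewrite mulr_ge0 // invr_ge0 ltW // (nm_e_gt0 HX).
have gG i p : XX p -> `|g i p| <= G i * nm XX p.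
  case=> X1 X2; rewrite gE mulr_suml; apply: le_trans (ler_norm_sum _ _ _) _.
  apply: ler_sum => k _; rewrite normrM -mulrA ler_wpM2l // mulrC ler_pdivlMr ?(nm_e_gt0 HX) //.
  have := nm_coord HX k./2 X1; have := nm_coord HX k./2 X2.
  have := qn_ge0 nX X1; have := qn_ge0 nX X2.
  by rewrite /c /=; case: odd; lra.
pose SG := \sum_(i < n) G i.
have SG0 : 0 <= SG by apply: sumr_ge0.
have [N mN HN] : exists2 N, (m <= N)%N & forall i, (i < n)%N -> nm XX (w i - P N (w i)) <= (SG +
  1)^-1.
  have eps0 : 0 < (SG + 1)^-1 / 2 by rewrite divr_gt0 // invr_gt0; lra.
  have /choice[f Hf] i : exists n0, forall N, (n0 <= N)%N -> nm XX (w i - P N (w i)) <= (SG + 1)^-1.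
    have [X1 X2] := EX _ (Ew i).
    have [n1 H1] := X_expand HX X1 eps0; have [n2 H2] := X_expand HX X2 eps0.
    exists (maxn n1 n2) => N; rewrite geq_max => /andP[h1 h2].
    have := H1 N h1; have := H2 N h2.
    by rewrite (qn_distC nX (X_fin HX N _) X1) (qn_distC nX (X_fin HX N _) X2) /=; lra.
  exists (m + \sum_(i < n) f i)%N; first exact: leq_addr.
  move=> i ni; apply: Hf; rewrite (bigD1 (Ordinal ni)) //= addnCA; exact: leq_addr.
pose L := 'M[R]_(2, N).
pose ent (M : L) (b : 'I_2) (k : nat) : R := if insub k is Some i then M b i else 0.
pose J (M : L) : seq2 := (ent M 0, ent M 1).
have entE M b : ent M b = restr (fun k => k < N)%N (ent M b).
  by apply/funext => k; rewrite /restr /ent; case: insubP => [i -> //|/negbTE -> //].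
have XXJ M : XX (J M) by split; rewrite /= entE; exact: X_fin.
have Jlin (a : R) M M' : J (a *: M + M') = a *: J M + J M'.
  apply/pair_equal_spec; split; apply/funext => k.
    rewrite [RHS](_ : _ = a * ent M 0 k + ent M' 0 k) // /ent; case: insubP => [i _ _|_].
      by rewrite !mxE.
    by rewrite mulr0 addr0.
  rewrite [RHS](_ : _ = a * ent M 1 k + ent M' 1 k) // /ent; case: insubP => [i _ _|_].
    by rewrite !mxE.
  by rewrite mulr0 addr0.
pose le_ (M M' : L) : Prop := forall b i, M b i <= M' b i.
pose join_ (M M' : L) : L := \matrix_(b, i) Num.max (M b i) (M' b i).
have HL : is_banach_lattice le_ join_ (fun M => nm XX (J M)).
  split.
  - by move=> M b i.
  - move=> M M' h1 h2; apply/matrixP => b i; apply/eqP; rewrite eq_le; apply/andP; split;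
    [exact: h1|exact: h2].
  - by move=> M1 M2 M3 h1 h2 b i; exact: le_trans (h1 b i) (h2 b i).
  - by move=> M1 M2 M3 h1 b i; rewrite !mxE lerD2r.
  - by move=> a M a0 h1 b i; have := h1 b i; rewrite !mxE => ?; rewrite mulr_ge0.
  - by move=> M M' b i; rewrite mxE le_max lexx.
  - by move=> M M' b i; rewrite mxE le_max lexx orbT.
  - by move=> M M' M'' h1 h2 b i; rewrite mxE ge_max h1 h2.
  - split=> //.
    + move=> M M' _ _; have JD := Jlin 1 M M'; rewrite !scale1r in JD.
      change (nm XX (J (M + M')) <= nm XX (J M) + nm XX (J M')); rewrite JD.
      by have := qn_triangle qXX (XXJ M) (XXJ M'); rewrite mul1r.
    + move=> a M _; change (nm XX (J (a *: M)) = `|a| * nm XX (J M)).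
      have J0 : J 0 = 0.
        apply/pair_equal_spec; split; apply/funext => k /=; rewrite /ent;
        by case: insubP => // i; rewrite mxE.
      by have := Jlin a M 0; rewrite J0 !addr0 => ->; exact: (qn_scale qXX).
    + move=> M _ /(qn_eq0 qXX (XXJ M)) JM; apply/matrixP => b i; rewrite mxE.
      have [h1 h2] : ent M 0 = 0 /\ ent M 1 = 0 by case: JM.
      have entK b1 : ent M b1 i = M b1 i by rewrite /ent valK.
      have [->|->] : b = 0 \/ b = 1.
        by case: b => [[|[|//]] hb]; [left|right]; exact/val_inj.
        by rewrite -(entK 0) h1.
      by rewrite -(entK 1) h2.
  - move=> M M' h1.
    have abs_le b i : `|M b i| <= `|M' b i|.
      have := h1 b i; rewrite !mxE.
      have mx (x : R) : Num.max x (- x) = `|x|.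
        by have /orP[x0|x0] := le_total 0 x; [rewrite ger0_norm //; apply/max_idPl;
          lra|rewrite ler0_norm //; apply/max_idPr; lra].
      by rewrite !mx.
    have ent_le b k : `|ent M b k| <= `|ent M' b k|.
      by rewrite /ent; case: insubP => [i _ _|_] //.
    apply: lerD; apply: (nm_le HX) => //=; rewrite entE; exact: X_fin.
pose A (p : seq2) : L := \matrix_(b, i) (if b == 0 then p.1 (i : nat) else p.2 (i : nat)).
have JA p : J (A p) = P N p.
  apply/pair_equal_spec; split; apply/funext => k; rewrite /restr /ent;
    case: insubP => [i -> <-|/negbTE ->] //; by rewrite mxE.
pose B (M : L) : seq2 := J M + \sum_(i < n) g i (J M) *: (w i - P N (w i)).
have XXd i : XX (w i - P N (w i)) by apply: (qnB qXX) => //; exact: EX.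
exists L, le_, join_, (fun M => nm XX (J M)); split=> //.
exists A, B, 1, 2; split; last first.
- move=> x Ex; rewrite /B JA.
  under eq_bigr => i _ do rewrite gP // scalerBr.
  rewrite sumrB -Exp //.
  have -> : \sum_(i < n) g i x *: P N (w i) = P N x.
    rewrite {2}(Exp x Ex) /P !pair_sumE /=; apply/pair_equal_spec; split; apply/funext => k;
      rewrite /restr !fct_sumE /=; case: ifP => kN.
    - by apply: eq_bigr => i _;
      rewrite [LHS](_ : _ = g i x * restr (fun k => k < N)%N (w i).1 k) // /restr kN.
    - by rewrite big1 // => i _;
      rewrite [LHS](_ : _ = g i x * restr (fun k => k < N)%N (w i).1 k) // /restr kN mulr0.
    - by apply: eq_bigr => i _;
      rewrite [LHS](_ : _ = g i x * restr (fun k => k < N)%N (w i).2 k) // /restr kN.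
    - by rewrite big1 // => i _;
      rewrite [LHS](_ : _ = g i x * restr (fun k => k < N)%N (w i).2 k) // /restr kN mulr0.
  by rewrite addrC subrK.
- by rewrite mul1r.
- split=> //.
    move=> a M M' _ _; rewrite /B Jlin.
    under eq_bigr => i _ do rewrite glin scalerDl -scalerA.
    rewrite big_split /= -scaler_sumr scalerDr.
    by rewrite addrACA.
  move=> M _; have XB : XX (\sum_(i < n) g i (J M) *: (w i - P N (w i))).
    by apply: (qn_sum qXX) => i _; apply: (qnZ qXX).
  split; first exact: (qnD qXX).
  have := qn_triangle qXX (XXJ M) XB; rewrite mul1r => /le_trans; apply.
  have -> : 2 * nm (full_space (fun M0 : L => nm XX (J M0))) M = nm XX (J M) + nm XX (J M).
    by rewrite /=; ring.
  rewrite lerD2l.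
  suff H : nm XX (\sum_(i < n) g i (J M) *: (w i - P N (w i))) <= \sum_(i < n) G i * nm XX (J M)
    * (SG + 1)^-1.
    apply: le_trans H _; rewrite -mulr_suml -mulr_suml -/SG mulrAC ler_piMl ?(qn_ge0 qXX) //.
    by rewrite ler_pdivrMr; lra.
  apply: (big_ind2 (fun a s => XX a /\ nm XX a <= s) _ _ _).2 => //.
  - by rewrite (qn_nm0 qXX); split=> //; exact: (qn_0 qXX).
  - move=> a s a' s' [Xa na] [Xa' na']; split; first exact: (qnD qXX).
    by have := qn_triangle qXX Xa Xa'; rewrite mul1r => /le_trans; apply; exact: lerD.
  - move=> i _; split; first exact: (qnZ qXX).
    rewrite (qn_scale qXX) //; apply: ler_pM => //; first exact: (qn_ge0 qXX).
      exact: gG.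
    exact: HN.
- split=> //.
    move=> a x y _ _; apply/matrixP => b i; rewrite !mxE; by case: eqP.
  move=> x Ex; split=> //=; rewrite mul1r -[ent _ 0]/((J (A x)).1) -[ent _ 1]/((J (A x)).2) JA /=.
  have [X1 X2] := EX _ Ex.
  by apply: lerD; exact: (nm_restr_lt HX).
Qed.

End DirectSumLUST.

(** * Comparable complete quasi-norms are equivalent *)

Section Baire.
Context {R : realType} {V : lmodType R} {Q P : R} {E F : nspace V}.
Hypothesis qE : quasi_normed Q E.
Hypothesis cE : is_complete E.
Hypothesis qF : quasi_normed P F.
Hypothesis cF : is_complete F.
Hypothesis FE : forall x, F x <-> E x.
Context {c : R}.
Hypothesis Ec : forall x, E x -> nm E x <= c * nm F x.

Let A (n : nat) x := E x /\ nm F x <= n%:R.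

(** Baire's theorem for the closures in E of the balls A n: otherwise nested
    balls of E avoiding them one by one would have a common point. *)
Lemma quasi_baire : exists n x0 (r : R), [/\ E x0, 0 < r &
  forall y, E y -> nm E (y - x0) <= r -> forall eta, 0 < eta ->
  exists2 a, A n a & nm E (y - a) <= eta].
Proof.
have Q1 := qn_ge1 qE; apply: contrapT => H.
have /choice[step Hstep] (s : nat * (V * R)) : exists p : V * R,
    E s.2.1 -> 0 < s.2.2 -> [/\ E p.1, nm E (p.1 - s.2.1) <= s.2.2, 0 < p.2 &
      forall a, A s.1 a -> p.2 < nm E (p.1 - a)].
  apply: contrapT => Hs; apply: H; case: s Hs => n [x r] /= Hs; exists n, x, r.
  have [Ex|nEx] := pselect (E x); last by case: Hs; exists (x, r).
  have [r0|nr0] := pselect (0 < r); last by case: Hs; exists (x, r).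
  split=> // y Ey yx eta eta0; apply: contrapT => Ha; apply: Hs.
  exists (y, eta) => _ _; split=> //= a Aa; rewrite ltNge; apply/negP => h.
  by apply: Ha; exists a.
pose next i (p : V * R) : V * R := let q := step (i, p) in
  (q.1, Num.min (p.2 / (2 * Q)) (q.2 / (3 * Q * Q))).
pose st := fix st i : V * R := if i is j.+1 then next j (st j) else (0, 1).
have Q3 : 0 < 3 * Q * Q by rewrite !mulr_gt0 //; lra.
have st_ok i : E (st i).1 /\ 0 < (st i).2.
  elim: i => [|i [IH1 IH2]]; first by split=> //; exact: (qn_0 qE).
  have [h1 h2 h3 h4] := Hstep (i, st i) IH1 IH2.
  split=> //=; rewrite lt_min !divr_gt0 //; lra.
pose x i := (st i).1; pose rho i := (st i).2.
have Ex i : E (x i) by case: (st_ok i).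
have rho0 i : 0 < rho i by case: (st_ok i).
have x_step i : nm E (x i.+1 - x i) <= rho i.
  by have [] := Hstep (i, st i) (Ex i) (rho0 i).
have rho_step i : rho i.+1 <= rho i / (2 * Q) by rewrite /rho /= ge_min lexx.
have far i a : A i a -> 3 * Q * Q * rho i.+1 < nm E (x i.+1 - a).
  move=> Aa; have [_ _ _ h] := Hstep (i, st i) (Ex i) (rho0 i).
  apply: le_lt_trans (h a Aa); rewrite mulrC -ler_pdivlMr //.
  by rewrite /rho /= ge_min lexx orbT.
have x_far j l : nm E (x (j + l)%N - x j) <= 2 * Q * rho j.
  elim: l j => [|l IH] j.
    by rewrite addn0 subrr (qn_nm0 qE) !mulr_ge0 // ?ltW //; lra.
  rewrite -(subrKA (x j.+1)) addnS -addSn.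
  apply: le_trans (qn_triangle qE _ _) _; [exact: (qnB qE)|exact: (qnB qE)|].
  have := IH j.+1; have := x_step j; have := rho_step j.
  rewrite ler_pdivlMr; last lra.
  move=> h1 h2 h3; have -> : 2 * Q * rho j = Q * (2 * rho j) by ring.
  by rewrite ler_pM2l; lra.
have rho_small eps : 0 < eps -> exists j, 2 * Q * (2 * Q * rho j) <= eps.
  move=> e0.
  have rj j : rho j <= (1 / 2) ^+ j.
    elim: j => [|j IH]; first by rewrite /rho expr0.
    apply: le_trans (rho_step j) _; rewrite exprS ler_pdivrMr; last lra.
    have h : 0 <= (1 / 2) ^+ j :> R by rewrite exprn_ge0 //; lra.
    apply: le_trans IH _; nra.
  have [|||||j _ hj] := @geometric_beats_linear R (1 / 2) (4 * Q * Q) 0 eps; try lra.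
  exists j; move: hj; rewrite mul0r addr0 => hj; apply: le_trans hj.
  have Q2 : 0 <= 4 * Q * Q by rewrite !mulr_ge0 //; lra.
  have := ler_wpM2l Q2 (rj j); lra.
have [|y Ey yx] := cE (v := x) Ex.
  move=> eps e0; have [|j hj] := rho_small (eps / 2); first by lra.
  exists j => m n jm jn.
  rewrite -(subrKA (x j)); apply: le_lt_trans (qn_triangle qE _ _) _.
  - exact: (qnB qE).
  - exact: (qnB qE).
  have h1 := x_far j (m - j)%N; have h2 := x_far j (n - j)%N.
  rewrite subnKC // in h1; rewrite subnKC // in h2.
  rewrite (qn_distC qE (Ex j) (Ex n)).
  have : Q * (nm E (x m - x j) + nm E (x n - x j)) <= Q * (2 * Q * rho j + 2 * Q * rho j).
    by rewrite ler_pM2l ?lerD //; lra.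
  lra.
have near_y j : nm E (x j - y) <= 3 * Q * Q * rho j.
  have /cvg0P/(_ (rho j) (rho0 j))[n0 Hn0] := yx.
  have := Hn0 (j + n0)%N (leq_addl _ _).
  rewrite ger0_norm; last by apply: (qn_ge0 qE); exact: (qnB qE).
  move=> h1; rewrite -(subrKA (x (j + n0)%N)); apply: le_trans (qn_triangle qE _ _) _;
    [exact: (qnB qE)|exact: (qnB qE)|].
  rewrite (qn_distC qE (Ex j) (Ex _)); have h2 := x_far j n0.
  have -> : 3 * Q * Q * rho j = Q * (3 * Q * rho j) by ring.
  rewrite ler_pM2l; last lra.
  have := rho0 j; nra.
have := far (Num.truncn (nm F y)).+1 y; rewrite ltNge near_y => /(_ _)/negP; case=> //.
by split=> //; have := truncnS_gt (nm F y); rewrite -natr1; lra.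
Qed.

(** Some ball of F is E-dense in a ball of E. Every vector is then, by successive
    approximation in E, the sum of an F-convergent series. *)
Theorem comparable_complete_equivalent :
  exists C : R, forall x, E x -> nm F x <= C * nm E x.
Proof.
have Q1 := qn_ge1 qE; have P1 := qn_ge1 qF.
have [n [x0 [r [Ex0 r0 H]]]] := quasi_baire.
pose M := 2 * P * n%:R / r.
have P0 : 0 <= P by lra.
have M0 : 0 <= M by rewrite divr_ge0 ?(ltW r0) // !mulr_ge0.
have dens z t eta : E z -> 0 < t -> nm E z <= t -> 0 < eta ->
    exists2 w, E w /\ nm F w <= M * t & nm E (z - w) <= eta.
  move=> Ez t0 zt eta0; pose k := r / t.
  have k0 : 0 < k by rewrite divr_gt0.
  pose d := eta * k / (2 * Q).
  have Q2 : 0 < 2 * Q by lra.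
  have d0 : 0 < d by apply: divr_gt0 => //; exact: mulr_gt0.
  have Ekz := qnZ qE k Ez.
  have [||a [Ea na] ha] := H (x0 + k *: z) _ _ d d0; first exact: (qnD qE).
    rewrite addrAC subrr add0r.
    rewrite (qn_scale qE) // gtr0_norm // /k mulrAC ler_pdivrMr //.
    by rewrite ler_pM2l.
  have [||a' [Ea' na'] ha'] := H x0 _ _ d d0 => //.
    by rewrite subrr (qn_nm0 qE) ltW.
  exists (k^-1 *: (a - a')).
    split; first by apply: (qnZ qE); exact: (qnB qE).
    rewrite (qn_scale qF); last by apply/FE; exact: (qnB qE).
    rewrite gtr0_norm ?invr_gt0 // ler_pdivrMl //.
    apply: le_trans (qn_nmB qF _ _) _; [exact/FE|exact/FE|].
    have -> : k * (M * t) = P * (n%:R + n%:R) by rewrite /k /M; field; rewrite !gt_eqF.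
    by rewrite ler_pM2l ?lerD //; lra.
  have -> : z - k^-1 *: (a - a') = k^-1 *: ((x0 + k *: z - a) - (x0 - a')).
    have -> : (x0 + k *: z - a) - (x0 - a') = k *: z - (a - a').
      rewrite (opprB x0 a') (addrC x0) (addrAC _ x0) -(addrA _ x0) (addrC x0) subrK.
      by rewrite opprB -addrA (addrC (- a)).
    by rewrite [RHS]scalerBr scalerA mulVf ?scale1r // gt_eqF.
  have E1 : E (x0 + k *: z - a) by apply: (qnB qE) => //; exact: (qnD qE).
  have E2 : E (x0 - a') by exact: (qnB qE).
  rewrite (qn_scale qE); last exact: (qnB qE).
  rewrite gtr0_norm ?invr_gt0 // ler_pdivrMl //.
  apply: le_trans (qn_nmB qE E1 E2) _.
  have -> : k * eta = Q * (d + d) by rewrite /d; field; rewrite gt_eqF //; lra.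
  by rewrite ler_pM2l ?lerD //; lra.
pose kap := (2 * P)^-1.
have kap0 : 0 < kap by rewrite invr_gt0; lra.
have kap1 : kap <= 1 / 2 by rewrite /kap invf_ple ?posrE //; [rewrite div1r invrK|]; lra.
have Pk : 2 * P * kap <= 1 by rewrite /kap mulfV //; lra.
have [K K1 HK] := qn_sum_geometric qF (ltn0Sn 0) (ltW kap0) Pk.
have Kp : 0 <= K by lra.
have kap_small b eps : 0 <= b -> 0 < eps -> exists j, b * kap ^+ j <= eps.
  move=> b0 e0; have [|||||j _ hj] := @geometric_beats_linear R kap b 0 eps => //; try lra.
  by exists j; move: hj; rewrite mul0r addr0 mulrC.
exists (P * (K * M)) => z Ez.
have [z0|] := eqVneq (nm E z) 0.
  by rewrite (qn_eq0 qE Ez z0) (qn_nm0 qF) (qn_nm0 qE) mulr0.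
set t := nm E z => t0; have tp : 0 < t by rewrite lt_neqAle eq_sym t0 (qn_ge0 qE).
have /choice[nx Hnx] (s : nat * V) : exists w, E s.2 -> nm E s.2 <= t * kap ^+ s.1 ->
    [/\ E w, nm F w <= M * (t * kap ^+ s.1) & nm E (s.2 - w) <= t * kap ^+ s.1.+1].
  case: s => i u /=; have [Eu|nEu] := pselect (E u); last by exists 0.
  have [ut|nut] := pselect (nm E u <= t * kap ^+ i); last by exists 0.
  have [||w [Ew nw] hw] := dens u (t * kap ^+ i) (t * kap ^+ i.+1) Eu _ ut.
  - by rewrite mulr_gt0 // exprn_gt0.
  - by rewrite mulr_gt0 // exprn_gt0.
  by exists w.
pose u := fix u i : V := if i is j.+1 then u j - nx (j, u j) else z.
have u_ok i : E (u i) /\ nm E (u i) <= t * kap ^+ i.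
  elim: i => [|i [IH1 IH2]]; first by rewrite expr0 mulr1.
  by have [h1 h2 h3] := Hnx (i, u i) IH1 IH2; split=> //=; exact: (qnB qE).
pose w i := nx (i, u i).
have w_ok i : E (w i) /\ nm F (w i) <= M * t * kap ^+ i.
  by have [h1 h2] := u_ok i; have [h3 h4 h5] := Hnx (i, u i) h1 h2; rewrite -mulrA.
pose s m := \sum_(i < m) w i.
have sE m : s m = z - u m.
  elim: m => [|m IH]; first by rewrite /s big_ord0 subrr.
  by rewrite /s big_ord_recr /= -/(s m) IH -/(w m) opprB addrA addrAC.
have Fw i : F (w i) by apply/FE; case: (w_ok i).
have Fs m : F (s m) by apply: (qn_sum qF).
have block j m : nm F (s (j + m)%N - s j) <= K * (M * t * kap ^+ j).
  rewrite /s big_split_ord /= addrAC subrr add0r.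
  apply: (HK m _ (fun l => w (j + l)%N)).
    apply: mulr_ge0; first by apply: mulr_ge0 => //; exact: ltW.
    by apply: exprn_ge0; exact: ltW.
  move=> l _; split=> //; rewrite divn1.
  by have [_] := w_ok (j + l)%N; rewrite exprD mulrA.
have [|y Fy sy] := cF (v := s) Fs.
  move=> eps e0.
  have KM0 : 0 <= P * (2 * (K * (M * t))).
    by do 4 (apply: mulr_ge0 => //); exact: ltW.
  have [|j hj] := kap_small (P * (2 * (K * (M * t)))) (eps / 2) KM0; first by lra.
  exists j => m m' jm jm'; rewrite -(subrKA (s j)).
  apply: le_lt_trans (qn_triangle qF _ _) _; [exact: (qnB qF)|exact: (qnB qF)|].
  have h1 := block j (m - j)%N; have h2 := block j (m' - j)%N.
  rewrite subnKC // in h1; rewrite subnKC // in h2.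
  rewrite (qn_distC qF (Fs j) (Fs m')).
  have := ler_wpM2l P0 (lerD h1 h2); lra.
have yz : y = z.
  apply/subr0_eq/(qn_eq0 qE); first by apply: (qnB qE) => //; exact/FE.
  apply/eqP; rewrite eq_le (qn_ge0 qE) ?andbT; last by apply: (qnB qE) => //; exact/FE.
  apply: le_eps => eps e0; rewrite add0r.
  pose d := eps / (2 * Q).
  have d0 : 0 < d by rewrite divr_gt0 //; lra.
  have d1 : 0 < d / (`|c| + 1) by rewrite divr_gt0 // ltr_wpDl.
  have /cvg0P/(_ _ d1)[n0 Hn0] := sy.
  have [n1 hn1] := kap_small t d (ltW tp) d0.
  pose m := maxn n0 n1.
  have hm : nm E (u m) <= d.
    have [_ h] := u_ok m; apply: le_trans h _; apply: le_trans hn1.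
    rewrite ler_pM2l // ler_wiXn2l ?leq_maxr //; [exact: ltW|lra].
  have := Hn0 m (leq_maxl _ _); have Fsy := qnB qF (Fs m) Fy.
  rewrite ger0_norm ?(qn_ge0 qF) // => h.
  have Esy : E (s m - y) by apply/FE.
  have h2 : nm E (s m - y) <= d.
    apply: le_trans (Ec Esy) _.
    apply: (@le_trans _ _ (`|c| * (d / (`|c| + 1)))).
      apply: (@le_trans _ _ (`|c| * nm F (s m - y))).
        by apply: ler_wpM2r; [exact: (qn_ge0 qF)|exact: ler_norm].
      by apply: ler_wpM2l => //; exact: ltW.
    rewrite mulrA ler_pdivrMr ?ltr_wpDl // mulrC ler_pM2l //; lra.
  have -> : y - z = - (s m - y) - u m.
    by rewrite sE opprB -[RHS]addrA -opprD subrK.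
  have [Eu _] := u_ok m.
  apply: le_trans (qn_nmB qE _ Eu) _; first exact: (qnN qE).
  rewrite (qn_nmN qE) //.
  have -> : eps = Q * (d + d) by rewrite /d; field; lra.
  by rewrite ler_pM2l ?lerD //; lra.
rewrite -yz; apply: le_eps => eps e0.
have e1 : 0 < eps / P by rewrite divr_gt0 //; lra.
have /cvg0P/(_ _ e1)[n0 Hn0] := sy.
have := Hn0 n0 (leqnn _); have Fsy := qnB qF (Fs n0) Fy.
rewrite ger0_norm ?(qn_ge0 qF) // => h.
have h2 := block 0%N n0; rewrite add0n expr0 mulr1 /s big_ord0 subr0 -/(s n0) in h2.
have -> : y = s n0 - (s n0 - y) by rewrite opprB addrC subrK.
apply: le_trans (qn_nmB qF (Fs n0) Fsy) _.
have Pp : 0 < P by lra.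
have h3 : P * (nm F (s n0) + nm F (s n0 - y)) <= P * (K * (M * t) + eps / P).
  by rewrite ler_pM2l // lerD // ltW.
apply: le_trans h3 _; rewrite mulrDr [P * (eps / P)]mulrC divfK ?gt_eqF // lerD2r.
rewrite le_eqVlt; apply/orP; left; apply/eqP; rewrite /t; ring.
Qed.

End Baire.

(** * Completeness of twisted sums *)

Section TwistedComplete.
Context {R : realType} {X : nspace (nat -> R : lmodType R)}.
Hypothesis HX : sequence_space X.
Let nX := seqsp_quasi HX.
Context {Omega : (nat -> R) -> (nat -> R)} {D : R}.
Hypothesis HO : centralizer_le X Omega D.
Local Notation Y := (twisted_sum X Omega).
Let qY := tw_quasi HX HO.
Let seq2 := ((nat -> R) * (nat -> R) : lmodType R)%type.

(** After subtraction of the lift of the limit in the quotient X, the first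
    coordinates tend to 0, and [Omega] is almost additive on small vectors. *)
Lemma tw_complete : is_complete Y.
Proof.
have D0 := cz_ge0 HO.
move=> v Yv Cv.
have X1 n : X (v n).1 by case: (Yv n).
have nm1 (p : seq2) : Y p -> nm X p.1 <= nm Y p.
  by case=> /= h1 h2; rewrite lerDl (qn_ge0 nX).
have [|x Xx xl] := seqsp_complete HX (v := fun n => (v n).1) X1.
  move=> eps /Cv[n0 H]; exists n0 => m n h1 h2; apply: le_lt_trans (H m n h1 h2).
  exact: (nm1 (v m - v n) (qnB qY (Yv m) (Yv n))).
have [Yx _] := tw_graph HX (Omega := Omega) Xx.
pose p n : seq2 := v n - (x, Omega x).
have Yp n : Y (p n) by exact: (qnB qY).
pose s n := (p n).2 - Omega (p n).1.
have Xs n : X (s n) by case: (Yp n).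
have Xp n : X (p n).1 by case: (Yp n).
have p1 eps : 0 < eps -> exists n0, forall n, (n0 <= n)%N -> nm X (p n).1 < eps.
  move=> e0; have /cvg0P/(_ _ e0)[n0 H] := xl; exists n0 => n /H.
  by rewrite ger0_norm //; apply: (qn_ge0 nX); exact: (Xp n).
have [|t Xt tl] := seqsp_complete HX (v := s) Xs.
  move=> eps e0; pose d := eps / (2 + 12 * D).
  have d0 : 0 < d by rewrite divr_gt0 //; lra.
  have [n1 H1] := Cv d d0; have [n2 H2] := p1 d d0.
  exists (maxn n1 n2) => m n; rewrite !geq_max => /andP[m1 m2] /andP[n1' n2'].
  have Ypp := qnB qY (Yv m) (Yv n).
  have E1 : v m - v n = p m - p n by rewrite /p opprB addrA subrK.
  have h1 := H1 m n m1 n1'; rewrite E1 in h1 Ypp.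
  case: Ypp => /= Xd Xd2.
  have [Xq nq] := cz_add HX HO Xd (Xp n).
  rewrite subrK in Xq nq.
  have E2 : s m - s n = ((p m).2 - (p n).2 - Omega ((p m).1 - (p n).1)) -
      (Omega (p m).1 - Omega ((p m).1 - (p n).1) - Omega (p n).1).
    rewrite /s; move: (Omega _) (Omega _) (Omega _) => a b c'.
    by apply/funext => k; rewrite !fctE; ring.
  rewrite E2; apply: le_lt_trans (X_triangleB HX Xd2 Xq) _.
  have h2 := H2 m m2; have h3 := H2 n n2'.
  have n0' := qn_ge0 nX Xd; have n0'' := qn_ge0 nX Xd2.
  rewrite /= in h1.
  have h4 : nm X ((p m).1 - (p n).1) + nm X (p n).1 <= 3 * d.
    have := X_triangleB HX (Xp m) (Xp n); lra.
  have D3 : 0 <= 3 * D by lra.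
  have h5 := ler_wpM2l D3 h4.
  have : (2 + 12 * D) * d = eps by rewrite /d mulrC divfK // gt_eqF //; lra.
  have : 0 <= D * d by rewrite mulr_ge0 // ltW.
  rewrite /= in nq; lra.
have [Yt _] := tw_fiber HX HO Xt.
have Yl : Y ((x, Omega x) + (0, t) : seq2) by exact: (qnD qY).
exists ((x, Omega x) + (0, t)) => //; apply/cvg0P => eps e0.
have e2 : 0 < eps / 2 by lra.
have [n1 H1] := p1 _ e2; have /cvg0P/(_ _ e2)[n2 H2] := tl.
exists (maxn n1 n2) => n; rewrite geq_max => /andP[h1 h2].
have -> : v n - ((x, Omega x) + (0, t)) = p n - (0, t) by rewrite /p opprD addrA.
rewrite ger0_norm; last by apply: (qn_ge0 qY); exact: (qnB qY).
have := H1 n h1; have := H2 n h2; rewrite ger0_norm; last by apply: (qn_ge0 nX); exact: (qnB nX).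
have -> : nm Y (p n - (0, t)) = nm X (p n).1 + nm X (s n - t).
  rewrite /= subr0; congr (_ + nm X _); rewrite /s addrAC //.
lra.
Qed.

End TwistedComplete.

(** * Unconditional bases *)

Lemma sum_iota (V : nmodType) n (g : nat -> V) j :
  \sum_(l < n) g (j + l)%N = \sum_(k <- iota j n) g k.
Proof.
rewrite -[j in iota j]addn0 iotaDl big_map.
by rewrite -(big_mkord xpredT (fun l => g (j + l)%N)) /index_iota subn0.
Qed.

(** Inside each block [m i, m i.+1) the members of [B i] are listed first, so that
    differences of partial sums of the rearranged series are the subsums over
    the [B i]. *)
Lemma block_permutation (m : nat -> nat) (B : nat -> pred nat) :
  m 0%N = 0%N -> (forall i, (m i < m i.+1)%N) ->
  exists (s : nat -> nat) (r : nat -> nat), bijective s /\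
  forall (V : nmodType) (f : nat -> V) i,
    (m i <= r i)%N /\ \sum_(k < m i) f (s k) = \sum_(k < m i) f k /\
    \sum_(k < r i) f (s k) = \sum_(k < m i) f k +
      \sum_(k <- iota (m i) (m i.+1 - m i) | B i k) f k.
Proof.
move=> m0 mS.
have mle i j : (i <= j)%N -> (m i <= m j)%N.
  move=> ij; rewrite -(subnKC ij); elim: (j - i)%N => [|l IH]; first by rewrite addn0.
  by rewrite addnS; apply: leq_trans IH _; exact: ltnW.
have ex n : exists i, (m i <= n < m i.+1)%N.
  elim: n => [|n [i /andP[h1 h2]]]; first by exists 0%N; rewrite m0 /= -{1}m0.
  have [h3|h3] := ltnP n.+1 (m i.+1).
    by exists i; rewrite h3 andbT leqW.
  exists i.+1; rewrite h3 /=; apply: leq_ltn_trans (mS i.+1); exact: h2.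
have /choice[blk Hblk] := ex.
have uniq_blk n i : (m i <= n < m i.+1)%N -> blk n = i.
  move=> /andP[h1 h2]; have /andP[h3 h4] := Hblk n.
  apply/eqP; rewrite eqn_leq; apply/andP; split; rewrite leqNgt; apply/negP => /mle h.
    by move: (leq_trans h h3); rewrite leqNgt h2.
  by move: (leq_trans h h1); rewrite leqNgt h4.
pose I i := iota (m i) (m i.+1 - m i).
pose L i := seq.filter (B i) (I i) ++ seq.filter (predC (B i)) (I i).
have permL i : perm_eq (L i) (I i) by rewrite /L perm_filterC.
have sizeL i : size (L i) = (m i.+1 - m i)%N by rewrite (perm_size (permL i)) size_iota.
have memL i k : (k \in L i) = (m i <= k < m i.+1)%N.
  by rewrite (perm_mem (permL i)) mem_iota subnKC // ltnW.
have uniqL i : uniq (L i) by rewrite (perm_uniq (permL i)) iota_uniq.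
pose s n := nth 0%N (L (blk n)) (n - m (blk n)).
pose s' k := (m (blk k) + index k (L (blk k)))%N.
have s_in n : (m (blk n) <= s n < m (blk n).+1)%N.
  rewrite -memL mem_nth // sizeL; have /andP[h1 h2] := Hblk n.
  by rewrite ltn_sub2r // (leq_ltn_trans h1).
have blk_s n : blk (s n) = blk n by apply: uniq_blk; exact: s_in.
have s'_in k : (m (blk k) <= s' k < m (blk k).+1)%N.
  rewrite leq_addr /= /s' -ltn_subRL -sizeL index_mem memL; exact: Hblk.
have blk_s' k : blk (s' k) = blk k by apply: uniq_blk; exact: s'_in.
have sE i l : (l < m i.+1 - m i)%N -> s (m i + l)%N = nth 0%N (L i) l.
  move=> h; rewrite /s (uniq_blk _ i) ?addKn //.
  by rewrite leq_addr -ltn_subRL.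
exists s, (fun i => m i + size (seq.filter (B i) (I i)))%N; split.
  exists s' => [n|k].
    rewrite /s' blk_s /s index_uniq ?subnKC //; first by case/andP: (Hblk n).
    rewrite sizeL; have /andP[h1 h2] := Hblk n.
    by rewrite ltn_sub2r // (leq_ltn_trans h1).
  by rewrite /s blk_s' /s' addKn nth_index // memL; exact: Hblk.
move=> V f i.
split; first exact: leq_addr.
have sum_m j : \sum_(k < m j) f (s k) = \sum_(k < m j) f k.
  elim: j => [|j IH]; first by rewrite m0 !big_ord0.
  rewrite -(subnKC (ltnW (mS j))) !big_split_ord /= IH; congr (_ + _).
  rewrite (sum_iota _ f) -(perm_big _ (permL j)) (big_nth 0%N) sizeL big_mkord.
  by apply: eq_bigr => l _; rewrite sE.
split; first exact: sum_m.
rewrite big_split_ord /= sum_m; congr (_ + _).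
rewrite -[RHS]big_filter -/(I i) (big_nth 0%N) big_mkord; apply: eq_bigr => l _.
rewrite sE; first by rewrite /L nth_cat ltn_ord.
apply: leq_trans (ltn_ord l) _.
by rewrite -[X in (_ <= X)%N](size_iota (m i)) -/(I i) size_filter count_size.
Qed.

Lemma real_cauchy (R : realType) (u : nat -> R) :
  (forall eps, 0 < eps -> exists n0, forall m n, (n0 <= m)%N -> (n0 <= n)%N ->
     `|u m - u n| < eps) ->
  exists l, forall eps, 0 < eps -> exists n0, forall n, (n0 <= n)%N -> `|u n - l| < eps.
Proof.
move=> H.
have : cvg (u @ \oo).
  apply: cauchy_cvg; apply/cauchyP => eps /H[n0 Hn]; exists (u n0).
  exists n0 => // n /= hn; rewrite -ball_normE /=; exact: Hn.
move=> /cvg_ex[l /cvgrPdist_lt Hl]; exists l => eps /Hl[n0 _ Hn].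
by exists n0 => n hn; rewrite distrC; exact: Hn.
Qed.

Section UnconditionalBasis.
Context {R : realType} {V : lmodType R} {Q : R} {E : nspace V}.
Hypothesis qE : quasi_normed Q E.
Hypothesis cE : is_complete E.
Context {b : nat -> V}.
Hypothesis Hb : unconditional_basis E b.

Let Eb n : E (b n). Proof. exact: Hb.1.1. Qed.

Lemma Esum_b n (a : nat -> R) : E (\sum_(k < n) a k *: b k).
Proof. by apply: (qn_sum qE) => k _; exact: (qnZ qE). Qed.

Lemma expansionP x a : E x -> expansion E b x a <->
  forall eps, 0 < eps -> exists n0, forall n, (n0 <= n)%N ->
    nm E (\sum_(k < n) a k *: b k - x) < eps.
Proof.
move=> Ex; rewrite /expansion cvg0P.
split=> H eps /H[n0 Hn]; exists n0 => n /Hn; rewrite ger0_norm //;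
  by apply: (qn_ge0 qE); apply: (qnB qE) => //; exact: Esum_b.
Qed.

Lemma expansion_uniq x a a' : E x -> expansion E b x a -> expansion E b x a' -> a = a'.
Proof. by move=> Ex h h'; have [a0 [_ u]] := Hb.1.2 x Ex; rewrite -(u _ h) -(u _ h'). Qed.

Lemma coordinates_exist : exists a : V -> nat -> R,
  (forall x, E x -> expansion E b x (a x)) /\
  forall (c : R) x y, E x -> E y -> a (c *: x + y) = c *: a x + a y.
Proof.
have /choice[a Ha] x : exists a, E x -> expansion E b x a.
  have [Ex|nEx] := pselect (E x); last by exists (fun=> 0).
  by have [a [h _]] := Hb.1.2 x Ex; exists a.
exists a; split=> // c x y Ex Ey.
have Exy := qn_lin qE c Ex Ey.
apply: (expansion_uniq Exy (Ha _ Exy)); apply/(expansionP _ Exy) => eps e0.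
pose d := eps / (Q * (`|c| + 1)).
have Q0 := qn_Q0 qE.
have c1 : 0 < `|c| + 1 by rewrite ltr_wpDl.
have d0 : 0 < d by rewrite divr_gt0 // mulr_gt0.
have [n1 H1] := (expansionP _ Ex).1 (Ha x Ex) d d0.
have [n2 H2] := (expansionP _ Ey).1 (Ha y Ey) d d0.
exists (maxn n1 n2) => n; rewrite geq_max => /andP[/H1 h1 /H2 h2].
have -> : \sum_(k < n) (c *: a x + a y) k *: b k - (c *: x + y) =
    c *: (\sum_(k < n) a x k *: b k - x) + (\sum_(k < n) a y k *: b k - y).
  rewrite scalerBr addrACA -opprD; congr (_ - _).
  rewrite scaler_sumr -big_split; apply: eq_bigr => k _ /=.
  by rewrite scalerA -scalerDl.
have E1 : E (\sum_(k < n) a x k *: b k - x) by apply: (qnB qE) => //; exact: Esum_b.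
have E2 : E (\sum_(k < n) a y k *: b k - y) by apply: (qnB qE) => //; exact: Esum_b.
apply: le_lt_trans (qn_triangle qE (qnZ qE c E1) E2) _.
rewrite (qn_scale qE) //.
have h3 : `|c| * nm E (\sum_(k < n) a x k *: b k - x) <= `|c| * d by rewrite ler_wpM2l // ltW.
have -> : eps = Q * (`|c| * d + d) by rewrite /d; field; rewrite !gt_eqF.
by rewrite ltr_pM2l //; lra.
Qed.

Context {a : V -> nat -> R}.
Hypothesis Ha : forall x, E x -> expansion E b x (a x).
Hypothesis alin : forall (c : R) x y, E x -> E y -> a (c *: x + y) = c *: a x + a y.

Let pr (B : pred nat) n z := \sum_(k < n) (if B k then a z k else 0) *: b k.

Lemma pr_in B n z : E (pr B n z).
Proof. exact: (Esum_b n (fun k => if B k then a z k else 0)). Qed.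

Lemma pr_lin B n (c : R) x y : E x -> E y ->
  pr B n (c *: x + y) = c *: pr B n x + pr B n y.
Proof.
move=> Ex Ey; rewrite /pr scaler_sumr -big_split; apply: eq_bigr => k _ /=.
rewrite alin // scalerA -scalerDl; congr (_ *: _).
by case: (B k); rewrite ?mulr0 ?addr0.
Qed.

Lemma nm_b0 k : 0 < nm E (b k).
Proof.
rewrite lt_neqAle (qn_ge0 qE) // andbT; apply/eqP => /esym/(qn_eq0 qE (Eb k)) bk0.
have E0 := qn_0 qE.
have h1 : expansion E b 0 0.
  apply/(expansionP _ E0) => eps e0; exists 0%N => n _.
  by rewrite subr0 big1 ?(qn_nm0 qE) // => i _; rewrite scale0r.
have h2 : expansion E b 0 (fun i => (i == k)%:R).
  apply/(expansionP _ E0) => eps e0; exists 0%N => n _.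
  rewrite subr0 big1 ?(qn_nm0 qE) // => i _.
  by case: eqP => [->|_]; rewrite ?bk0 ?scaler0 // scale0r.
have := congr1 (fun f => f k) (expansion_uniq E0 h1 h2).
by rewrite eqxx => /eqP; rewrite eq_sym oner_eq0.
Qed.

Lemma basis_partial_crude (c : nat -> R) t n : (forall k, (k < n)%N -> `|c k| * nm E (b k) <= t) ->
  0 <= t -> nm E (\sum_(k < n) c k *: b k) <= (2 * Q) ^+ n * t.
Proof.
move=> H t0; apply: (qn_sum_crude qE (v := fun k => c k *: b k)) => // k kn.
by split; [exact: (qnZ qE)|rewrite (qn_scale qE) // H].
Qed.

(** Otherwise some rearrangement of the expansion of z would have partial sums
    that are not Cauchy. *)
Lemma pr_bounded z : E z -> exists C, forall B n, nm E (pr B n z) <= C.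
Proof.
move=> Ez; apply: contrapT => unb; have Q0 := qn_Q0 qE.
have big m : exists p : nat * pred nat, (m < p.1)%N /\
    1 <= nm E (\sum_(k <- iota m (p.1 - m) | p.2 k) a z k *: b k).
  pose t := \sum_(k < m) `|a z k| * nm E (b k).
  have t0 : 0 <= t by apply: sumr_ge0 => k _; rewrite mulr_ge0 // (qn_ge0 qE).
  have tk k : (k < m)%N -> `|a z k| * nm E (b k) <= t.
    move=> km; rewrite /t (bigD1 (Ordinal km)) //= lerDl.
    by apply: sumr_ge0 => i _; rewrite mulr_ge0 // (qn_ge0 qE).
  have t0' : 0 <= (2 * Q) ^+ m * t by rewrite mulr_ge0 // exprn_ge0 // mulr_ge0 // ltW.
  apply: contrapT => none; apply: unb; exists (Q * ((2 * Q) ^+ m * t + 1)) => B n.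
  have low B' l : (l <= m)%N -> nm E (pr B' l z) <= (2 * Q) ^+ m * t.
    move=> lm; apply: (@le_trans _ _ ((2 * Q) ^+ l * t)).
      apply: (basis_partial_crude (c := fun k => if B' k then a z k else 0)) => // k kl.
      case: (B' k); first by apply: tk; exact: leq_trans lm.
      by rewrite normr0 mul0r.
    rewrite ler_wpM2r // ler_weXn2l //; have := qn_ge1 qE; lra.
  have [nm_|mn] := leqP n m.
    apply: le_trans (low B n nm_) _.
    have := qn_ge1 qE; nra.
  rewrite /pr -(subnKC (ltnW mn)) big_split_ord /=.
  apply: le_trans (qn_triangle qE _ _) _; first exact: (pr_in B m z).
    by apply: (qn_sum qE) => k _; exact: (qnZ qE).
  rewrite ler_pM2l // lerD //; first exact: (low B m).
  rewrite leNgt; apply/negP => h; apply: none; exists (n, B); split=> //=.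
  apply: ltW; apply: lt_le_trans h _.
  rewrite le_eqVlt; apply/orP; left; apply/eqP; congr (nm E _).
  rewrite (sum_iota _ (fun k => (if B k then a z k else 0) *: b k)) [RHS]big_mkcond.
  by apply: eq_bigr => k _; case: (B k); rewrite ?scale0r.
have /choice[nx Hnx] := big.
pose m := fix m i := if i is j.+1 then (nx (m j)).1 else 0%N.
have [s [r [bs Hs]]] := block_permutation (m := m) (fun i => (nx (m i)).2) erefl
  (fun i => (Hnx (m i)).1).
have m_ge i : (i <= m i)%N.
  by elim: i => // i IH; apply: leq_ltn_trans IH _; exact: (Hnx (m i)).1.
have := Hb.2 z (a z) Ez (Ha Ez) s bs; rewrite /expansion => /cvg0P.
have d0 : 0 < 1 / (2 * Q) by rewrite divr_gt0 // mulr_gt0.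
move=> /(_ _ d0)[n0 Hn0].
have [h1 [h2 h3]] := Hs V (fun k => a z k *: b k) n0.
have Es n : E (\sum_(k < n) (a z \o s) k *: (b \o s) k - z).
  by apply: (qnB qE) => //; apply: (qn_sum qE) => k _; apply: (qnZ qE); exact: Eb.
have e1 := Hn0 (m n0) (m_ge n0).
have e2 := Hn0 (r n0) (leq_trans (m_ge n0) h1).
rewrite ger0_norm in e1; last exact: (qn_ge0 qE).
rewrite ger0_norm in e2; last exact: (qn_ge0 qE).
have [_ e3] := Hnx (m n0).
have D : \sum_(k <- iota (m n0) ((nx (m n0)).1 - m n0) | (nx (m n0)).2 k) a z k *: b k =
    (\sum_(k < r n0) (a z \o s) k *: (b \o s) k - z) - (\sum_(k < m n0) (a z \o s) k *: (b \o s)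
      k - z).
  have -> : \sum_(k < r n0) (a z \o s) k *: (b \o s) k = \sum_(k < m n0) a z k *: b k +
      \sum_(k <- iota (m n0) ((nx (m n0)).1 - m n0) | (nx (m n0)).2 k) a z k *: b k by exact: h3.
  have -> : \sum_(k < m n0) (a z \o s) k *: (b \o s) k = \sum_(k < m n0) a z k *: b k by exact: h2.
  set u := \sum_(k < _) _; set w := \sum_(k <- _ | _) _.
  by rewrite opprB addrA subrK addrC addKr.
have := qn_nmB qE (Es (r n0)) (Es (m n0)); rewrite -D.
have h : Q * (nm E (\sum_(k < r n0) (a z \o s) k *: (b \o s) k - z) +
   nm E (\sum_(k < m n0) (a z \o s) k *: (b \o s) k - z)) < Q * (1 / (2 * Q) + 1 / (2 * Q)).
  by rewrite ltr_pM2l // ltrD.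
have : Q * (1 / (2 * Q) + 1 / (2 * Q)) = 1 by field; rewrite gt_eqF.
lra.
Qed.

Let vals z := [set t | exists B n, t = nm E (pr B n z)].
Let p z := sup (vals z).

Lemma p_ub B n z : E z -> nm E (pr B n z) <= p z.
Proof.
move=> Ez; apply: ub_le_sup; last by exists B, n.
by have [C HC] := pr_bounded Ez; exists C => _ [B' [n' ->]].
Qed.

Lemma p_le z C : (forall B n, nm E (pr B n z) <= C) -> p z <= C.
Proof.
move=> H; apply: ge_sup; last by move=> _ [B [n ->]].
by exists (nm E (pr xpredT 0 z)), xpredT, 0%N.
Qed.

Let F : nspace V := NSpace (carrier E) p.

Lemma nm_le_p z : E z -> nm E z <= Q * p z.
Proof.
move=> Ez; apply: le_eps => eps e0.
have Q0 := qn_Q0 qE.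
have d0 : 0 < eps / Q by rewrite divr_gt0.
have [n0 /(_ _ (leqnn _)) h] := (expansionP _ Ez).1 (Ha Ez) _ d0.
have e : \sum_(k < n0) a z k *: b k = pr xpredT n0 z by [].
rewrite e in h.
apply: (@le_trans _ _ (nm E (pr xpredT n0 z - (pr xpredT n0 z - z)))).
  by rewrite opprB addrC subrK.
apply: le_trans (qn_nmB qE (pr_in _ _ _) (qnB qE (pr_in _ _ _) Ez)) _.
have := p_ub xpredT n0 Ez => h2.
have -> : Q * p z + eps = Q * (p z + eps / Q) by field; rewrite gt_eqF.
by rewrite ler_pM2l // lerD // ltW.
Qed.

Lemma p_quasi : quasi_normed Q F.
Proof.
have Q0 := qn_Q0 qE.
have Ez := qnZ qE.
have Zle (c : R) x : E x -> p (c *: x) <= `|c| * p x.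
  move=> Ex; apply: p_le => B n.
  have := pr_lin B n c Ex (qn_0 qE); rewrite addr0.
  have -> : pr B n 0 = 0.
    have := pr_lin B n (-1) (qn_0 qE) (qn_0 qE).
    by rewrite scaler0 addr0 scaleN1r addNr.
  rewrite addr0 => ->; rewrite (qn_scale qE) ?ler_wpM2l //; [exact: p_ub|exact: pr_in].
split=> //=; [exact: (qn_ge1 qE)|exact: (qn_0 qE)|exact: (qn_lin qE)| | |].
- move=> x y Ex Ey; apply: p_le => B n.
  have := pr_lin B n 1 Ex Ey; rewrite !scale1r => ->.
  apply: le_trans (qn_triangle qE (pr_in _ _ _) (pr_in _ _ _)) _.
  by rewrite ler_pM2l // lerD // p_ub.
- move=> c x Ex; apply/eqP; rewrite eq_le Zle //=.
  have [->|c0] := eqVneq c 0.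
    rewrite normr0 mul0r; apply: le_trans (p_ub xpredT 0 (Ez 0 x Ex)).
    by rewrite (qn_ge0 qE) //; exact: pr_in.
  rewrite -ler_pdivlMl ?normr_gt0 //.
  have := Zle c^-1 _ (Ez c x Ex); rewrite scalerA mulVf // scale1r normfV //.
- move=> x Ex px; apply: (qn_eq0 qE) => //; apply/eqP; rewrite eq_le (qn_ge0 qE) // andbT.
  by have := nm_le_p Ex; rewrite px mulr0.
Qed.

Lemma a_coord k z : E z -> `|a z k| * nm E (b k) <= p z.
Proof.
move=> Ez; rewrite -(qn_scale qE) //.
have -> : a z k *: b k = pr (pred1 k) k.+1 z.
  rewrite /pr big_ord_recr /= eqxx big1 ?add0r // => i _.
  by rewrite ltn_eqF // scale0r.
exact: p_ub.
Qed.

(** The limits of the coordinates are the coordinates of the limit, because the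
    partial sums over finite sets converge uniformly. *)
Lemma p_complete : is_complete F.
Proof.
have Q0 := qn_Q0 qE; have Q1 := qn_ge1 qE.
move=> v Ev Cv; rewrite /= in Ev Cv.
have aB x y : E x -> E y -> a (x - y) = a x - a y.
  move=> Ex Ey; have := alin (-1) Ey Ex; rewrite !scaleN1r addrC => ->.
  by rewrite addrC.
have [|x Ex xl] := cE (v := v) Ev.
  move=> eps e0; have [|n0 H] := Cv (eps / Q); first by rewrite divr_gt0.
  exists n0 => m n h1 h2; apply: le_lt_trans (nm_le_p (qnB qE (Ev m) (Ev n))) _.
  by rewrite mulrC -ltr_pdivlMr //; exact: H.
have /choice[al Hal] k : exists l, forall eps, 0 < eps -> exists n0, forall n,
    (n0 <= n)%N -> `|a (v n) k - l| < eps.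
  apply: real_cauchy => eps e0; have bk := nm_b0 k.
  have [|n0 H] := Cv (eps * nm E (b k)); first by rewrite mulr_gt0.
  exists n0 => m n h1 h2; rewrite -(ltr_pM2r bk); apply: le_lt_trans (H m n h1 h2).
  by have := a_coord k (qnB qE (Ev m) (Ev n)); rewrite aB.
pose df (B : pred nat) m n := \sum_(k < m) (if B k then a (v n) k - al k else 0) *: b k.
have Edf B m n : E (df B m n) by exact: (Esum_b m (fun k => if B k then a (v n) k - al k else 0)).
have unif eps : 0 < eps -> exists n0, forall n, (n0 <= n)%N -> forall B m,
    nm E (df B m n) <= eps.
  move=> e0; pose d := eps / (2 * Q).
  have d0 : 0 < d by rewrite divr_gt0 // mulr_gt0.
  have [n0 H] := Cv d d0; exists n0 => n h1 B m.
  pose t := d / (2 * Q) ^+ m.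
  have Qm : 0 < (2 * Q) ^+ m by rewrite exprn_gt0 // mulr_gt0.
  have t0 : 0 < t by rewrite divr_gt0.
  have /choice[f Hf] k : exists n1, forall n', (n1 <= n')%N -> `|a (v n') k - al k| * nm E (b k)
    <= t.
    have [|n1 Hn1] := Hal k (t / nm E (b k)); first by rewrite divr_gt0 // nm_b0.
    by exists n1 => n' /Hn1 h; rewrite -ler_pdivlMr ?nm_b0 // ltW.
  pose n' := (n0 + \sum_(k < m) f k)%N.
  have -> : df B m n = (pr B m (v n - v n')) + df B m n'.
    rewrite /df /pr -big_split; apply: eq_bigr => k _ /=; rewrite -scalerDl; congr (_ *: _).
    by case: (B k); rewrite ?addr0 // aB // fctE addrA subrK.
  apply: le_trans (qn_triangle qE (pr_in _ _ _) (Edf _ _ _)) _.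
  have h3 : nm E (pr B m (v n - v n')) <= d.
    apply: le_trans (p_ub B m (qnB qE (Ev n) (Ev n'))) _; apply: ltW; apply: H => //.
    exact: leq_addr.
  have h4 : nm E (df B m n') <= d.
    apply: le_trans (_ : (2 * Q) ^+ m * t <= _); last by rewrite /t mulrC divfK // gt_eqF.
    apply: (basis_partial_crude (c := fun k => if B k then a (v n') k - al k else 0));
      last exact: ltW.
    move=> k km; case: (B k); last by rewrite normr0 mul0r ltW.
    by apply: Hf; rewrite /n' (bigD1 (Ordinal km)) //= addnCA leq_addr.
  have -> : eps = Q * (d + d) by rewrite /d; field; rewrite gt_eqF.
  by rewrite ler_pM2l // lerD.
have ax : a x = al.
  apply: (expansion_uniq Ex (Ha Ex)); apply/(expansionP _ Ex) => eps e0.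
  pose d := eps / (4 * Q * Q).
  have QQ : 0 < 4 * Q * Q by rewrite !mulr_gt0.
  have d0 : 0 < d by rewrite divr_gt0.
  have [n1 H1] := unif d d0; have /cvg0P/(_ d d0)[n2 H2] := xl.
  pose n := maxn n1 n2.
  have [n3 H3] := (expansionP _ (Ev n)).1 (Ha (Ev n)) d d0.
  exists n3 => m hm.
  have h1 := H1 n (leq_maxl _ _) xpredT m.
  have h2 := H2 n (leq_maxr _ _); have h3 := H3 m hm.
  have Evx : E (v n - x) by exact: (qnB qE).
  rewrite ger0_norm in h2; last exact: (qn_ge0 qE).
  have Es : E (\sum_(k < m) a (v n) k *: b k - v n) by apply: (qnB qE) => //; exact: Esum_b.
  have -> : \sum_(k < m) al k *: b k - x =
     ((\sum_(k < m) a (v n) k *: b k - v n) + (v n - x)) - df xpredT m n.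
    have -> : df xpredT m n = \sum_(k < m) a (v n) k *: b k - \sum_(k < m) al k *: b k.
      by rewrite -sumrB; apply: eq_bigr => k _; rewrite -scalerBl.
    by rewrite addrA subrK opprB [RHS]addrC addrA subrK.
  apply: le_lt_trans (qn_nmB qE (qnD qE Es Evx) (Edf _ _ _)) _.
  have h4 := qn_triangle qE Es Evx.
  have h5 : Q * (nm E (\sum_(k < m) a (v n) k *: b k - v n) + nm E (v n - x)) <= Q * (d + d).
    by rewrite ler_pM2l // lerD // ltW.
  have h6 : d <= Q * d by rewrite ler_peMl // ltW.
  have -> : eps = Q * (4 * Q * d) by rewrite /d; field; rewrite gt_eqF.
  rewrite ltr_pM2l //.
  have : 0 < Q * d by rewrite mulr_gt0.
  lra.
exists x => //; apply/cvg0P => eps e0.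
have [|n0 H] := unif (eps / 2); first by lra.
exists n0 => n h; rewrite ger0_norm; last by apply: (qn_ge0 p_quasi); exact: (qnB qE).
apply: (@le_lt_trans _ _ (eps / 2)); last lra.
apply: p_le => B m; apply: le_trans (H n h B m); rewrite le_eqVlt; apply/orP; left; apply/eqP.
congr (nm E _); apply: eq_bigr => k _; congr (_ *: _).
by rewrite aB // ax fctE.
Qed.

(** The supremum of the norms of the partial sums over finite sets is another
    complete quasi-norm, hence equivalent to the given one. *)
Theorem unconditional_projections : exists2 C, 0 <= C & forall (B : pred nat) n z, E z ->
  nm E (\sum_(k < n) (if B k then a z k else 0) *: b k) <= C * nm E z.
Proof.
have [C HC] := comparable_complete_equivalent qE cE p_quasi p_complete
  (fun x => conj id id) (c := Q) nm_le_p.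
exists `|C| => // B n z Ez; apply: le_trans (p_ub B n Ez) _.
apply: le_trans (HC z Ez) _; apply: ler_wpM2r; [exact: (qn_ge0 qE)|exact: ler_norm].
Qed.

End UnconditionalBasis.

(** Convexity turns bounds for finite subsums into bounds for arbitrary
    multipliers with values in [0, 1]: a dyadic multiplier is an average of
    indicator functions of its level sets. *)
Lemma multiplier_bound (R : realType) (V : lmodType R) (Q K : R) (E : nspace V)
    (b : nat -> V) (c t : nat -> R) M (T : R) :
  quasi_normed Q E -> dyadic_convex E K -> (forall k, E (b k)) -> 0 <= T ->
  (forall B : pred nat, nm E (\sum_(k < M) (if B k then c k else 0) *: b k) <= T) ->
  (forall k, 0 <= t k <= 1) ->
  nm E (\sum_(k < M) (t k * c k) *: b k) <= Q * (K * T).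
Proof.
move=> qE HK Eb T0 HT t01; have Q0 := qn_Q0 qE; have Q1 := qn_ge1 qE.
apply: le_eps => eps e0.
pose m := \sum_(k < M) `|c k| * nm E (b k).
have m0 : 0 <= m by apply: sumr_ge0 => k _; rewrite mulr_ge0 // (qn_ge0 qE).
have Qm : 0 <= (2 * Q) ^+ M * m by rewrite mulr_ge0 // exprn_ge0 // mulr_ge0 // ltW.
have eQ : 0 < eps / Q by rewrite divr_gt0.
have [|||||n _ hn] := @geometric_beats_linear R (1 / 2) ((2 * Q) ^+ M * m) 0 (eps / Q); try lra.
rewrite mul0r addr0 in hn.
pose tr k := Num.truncn (t k * 2 ^+ n).
have P2 : 0 < 2 ^+ n :> R by rewrite exprn_gt0.
have tr_bound k : (tr k)%:R <= t k * 2 ^+ n < (tr k)%:R + 1.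
  have /andP[tk0 _] := t01 k; have := truncn_itv (mulr_ge0 tk0 (ltW P2)).
  by rewrite natr1.
have tr_le k : (tr k <= 2 ^ n)%N.
  rewrite -(ler_nat R) natrX; have /andP[h _] := tr_bound k; apply: le_trans h _.
  by case/andP: (t01 k) => _ h1; rewrite -[X in _ <= X]mul1r ler_pM2r.
have Esum (f : nat -> R) : E (\sum_(k < M) f k *: b k).
  by apply: (qn_sum qE) => k _; exact: (qnZ qE).
pose S := \sum_(k < M) ((tr k)%:R / 2 ^+ n * c k) *: b k.
pose r := \sum_(k < M) ((t k - (tr k)%:R / 2 ^+ n) * c k) *: b k.
have -> : \sum_(k < M) (t k * c k) *: b k = S + r.
  by rewrite -big_split; apply: eq_bigr => k _ /=; rewrite -scalerDl; congr (_ *: _); ring.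
have hS : nm E S <= K * T.
  pose x i := \sum_(k < M) (if (i < tr k)%N then c k else 0) *: b k.
  have -> : S = (2 ^+ n)^-1 *: \sum_(i < 2 ^ n) x i.
    rewrite exchange_big scaler_sumr; apply: eq_bigr => k _ /=.
    rewrite -scaler_suml scalerA; congr (_ *: _).
    have -> : \sum_(i < 2 ^ n) (if (i < tr k)%N then c k else 0) = (tr k)%:R * c k.
      rewrite -big_mkcond /= -(big_ord_widen _ (fun=> c k) (tr_le k)).
      by rewrite sumr_const card_ord mulr_natl.
    by rewrite mulrA [_^-1 * _]mulrC.
  have Ex i : E (x i) by exact: (Esum (fun k => if (i < tr k)%N then c k else 0)).
  rewrite (qn_scale qE); last by apply: (qn_sum qE).
  rewrite gtr0_norm ?invr_gt0 // ler_pdivrMl //.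
  apply: le_trans (dyadic_convex_scale qE HK n (x := x) T0 _) _; last by rewrite mulrAC mulrC.
  by move=> i; split=> //; exact: (HT (fun k => (i < tr k)%N)).
have hr : nm E r <= eps / Q.
  apply: le_trans hn; rewrite mulrCA.
  apply: (qn_sum_crude qE (v := fun k => ((t k - (tr k)%:R / 2 ^+ n) * c k) *: b k)).
    move=> k kM; split; first exact: (qnZ qE).
    rewrite (qn_scale qE) // normrM -mulrA; apply: ler_pM => //.
    - by rewrite mulr_ge0 // (qn_ge0 qE).
    - have /andP[h1 h2] := tr_bound k.
      have e1 : t k - (tr k)%:R / 2 ^+ n = (t k * 2 ^+ n - (tr k)%:R) / 2 ^+ n.
        by field; rewrite gt_eqF.
      rewrite e1 ger0_norm; last by rewrite divr_ge0 ?(ltW P2) // subr_ge0.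
      by rewrite ler_pdivrMr // div1r exprVn mulVf ?gt_eqF //; lra.
    - rewrite /m (bigD1 (Ordinal kM)) //= lerDl.
      by apply: sumr_ge0 => i _; rewrite mulr_ge0 // (qn_ge0 qE).
  by rewrite mulr_ge0 // exprn_ge0 //; lra.
have ES : E S by exact: (Esum (fun k => (tr k)%:R / 2 ^+ n * c k)).
have Er : E r by exact: (Esum (fun k => (t k - (tr k)%:R / 2 ^+ n) * c k)).
apply: le_trans (qn_triangle qE ES Er) _.
have -> : Q * (K * T) + eps = Q * (K * T + eps / Q) by field; rewrite gt_eqF.
by rewrite ler_pM2l // lerD.
Qed.

Section BasisSums.
Context {R : realType} {X : nspace (nat -> R : lmodType R)}.
Hypothesis HX : sequence_space X.
Let nX := seqsp_quasi HX.
Context {Omega : (nat -> R) -> (nat -> R)} {D : R}.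
Hypothesis HO : centralizer_le X Omega D.
Local Notation Y := (twisted_sum X Omega).
Let qY := tw_quasi HX HO.
Let seq2 := ((nat -> R) * (nat -> R) : lmodType R)%type.

(** The rank one operators are those of the expansion in the given basis; on
    each coordinate k < N finitely many of them already reproduce the unit
    vector up to a quarter. *)
Theorem unconditional_sums_of_basis K : dyadic_convex Y K -> 1 <= K ->
  has_unconditional_basis Y -> uniform_unconditional_sums (X := X) (Omega := Omega).
Proof.
move=> HK K1 [b Hb]; have cY := tw_complete HX HO.
have [a [Ha alin]] := coordinates_exist qY Hb.
have [C C0 HC] := unconditional_projections qY cY Hb Ha alin.
pose Q := 1 + 3 * D; have qQ : quasi_normed Q Y := qY.
have Q0 : 0 < Q := qn_Q0 qQ.
have Yb n : Y (b n) by exact: Hb.1.1.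
exists (Q * (Q * (K * C) + Q * (K * C))).
  have h : 0 <= Q * (K * C) by rewrite !mulr_ge0 ?(ltW Q0) //; lra.
  by apply: mulr_ge0; [exact: ltW|exact: addr_ge0].
move=> N.
pose f k : seq2 := (@e_ R k, 0).
pose g k : seq2 := (0, @e_ R k).
have Yf k : Y (f k) by exact: (tw_unit HX HO).
have Yg k : Y (g k) by case: (tw_fiber HX HO (X_e HX k)).
have aD x y : Y x -> Y y -> a (x + y) = a x + a y.
  by move=> Yx Yy; have := alin 1 x y Yx Yy; rewrite !scale1r.
have a0 : a 0 = 0.
  by have := alin (-1) 0 0 (qn_0 qY) (qn_0 qY); rewrite scaler0 addr0 scaleN1r addNr.
have aZ (c : R) x : Y x -> a (c *: x) = c *: a x.
  by move=> Yx; have := alin c x 0 Yx (qn_0 qY); rewrite a0 !addr0.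
have /choice[n0 Hn0] k : exists n0, forall n, (n0 <= n)%N ->
    3 / 4 <= \sum_(j < n) a (f k) j * (b j).1 k.
  have ek := nm_e_gt0 HX k.
  have [|n0 H] := (expansionP qY Hb _ (Yf k)).1 (Ha _ (Yf k)) (nm X (@e_ R k) / 4).
    by rewrite divr_gt0.
  exists n0 => n /H; set S := \sum_(j < n) _ => h.
  have YS : Y (S - f k) by apply: (qnB qY) => //; exact: (Esum_b qY Hb).
  have S1 : (S - f k).1 k = \sum_(j < n) a (f k) j * (b j).1 k - 1.
    rewrite [LHS](_ : _ = S.1 k - @e_ R k k) // /e_ eqxx; congr (_ - _).
    by rewrite /S pair_sumE /= fct_sumE.
  have := nm_coord HX k YS.1; rewrite S1.
  have := qn_ge0 nX YS.2 => h1 h2; rewrite /= in h h1 h2.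
  have h3 : `|\sum_(j < n) a (f k) j * (b j).1 k - 1| * nm X (@e_ R k) < (1 / 4) * nm X (@e_ R k).
    by lra.
  rewrite ltr_pM2r // ltr_norml in h3; case/andP: h3 => h3 _; lra.
exists (\sum_(k < N) n0 k)%N, (fun k j => a (f k) j), (fun k j => a (g k) j), b; split=> //.
  by move=> k kN; apply: Hn0; rewrite (bigD1 (Ordinal kN)) //= leq_addr.
set M := (\sum_(k < N) n0 k)%N; move=> t t1 p Yp p0.
have Ytm n : Y (p.1 n *: f n + p.2 n *: g n) by apply: (qn_lin qY) => //; exact: (qnZ qY).
have phip j : functional N (fun k j => a (f k) j) (fun k j => a (g k) j) p j = a p j.
  have pE : p = \sum_(k < N) (p.1 k *: f k + p.2 k *: g k) by exact: pair_expansion.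
  rewrite /functional [in RHS]pE.
  elim: (N) => [|m IH]; first by rewrite !big_ord0 a0.
  have Ys : Y (\sum_(k < m) (p.1 k *: f k + p.2 k *: g k)) by apply: (qn_sum qY).
  rewrite !big_ord_recr /= IH aD // alin //; last exact: (qnZ qY).
  by rewrite aZ.
under eq_bigr => j _ do rewrite phip.
have Yp0 := qn_ge0 qY Yp.
have T0 : 0 <= C * nm Y p by rewrite mulr_ge0.
have MB (u : nat -> R) : (forall k, 0 <= u k <= 1) ->
    nm Y (\sum_(k < M) (u k * a p k) *: b k) <= Q * (K * (C * nm Y p)).
  by move=> u01; exact: (@multiplier_bound R seq2 Q K Y b (a p) u M _ qQ HK Yb T0 (fun B => HC B
    M p Yp) u01).
have Esum (h : nat -> R) : Y (\sum_(k < M) h k *: b k).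
  by apply: (qn_sum qY) => k _; exact: (qnZ qY).
pose tp k := Num.max (t k) 0; pose tn k := Num.max (- t k) 0.
have tpn k : [/\ t k = tp k - tn k, 0 <= tp k <= 1 & 0 <= tn k <= 1].
  have [e s] := max_parts (t k); have hp : 0 <= tp k by rewrite le_max lexx orbT.
  have hn : 0 <= tn k by rewrite le_max lexx orbT.
  by rewrite hp hn; split=> //=; apply: le_trans (t1 k); rewrite -s ?lerDl ?lerDr.
have -> : \sum_(j < M) (t j * a p j) *: b j =
    \sum_(j < M) (tp j * a p j) *: b j - \sum_(j < M) (tn j * a p j) *: b j.
  rewrite -sumrB; apply: eq_bigr => j _; rewrite -scalerBl -mulrBl; congr (_ * _ *: _).
  by case: (tpn j).
apply: le_trans (qn_nmB qQ (Esum (fun k => tp k * a p k)) (Esum (fun k => tn k * a p k))) _.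
have h1 : nm Y (\sum_(k < M) (tp k * a p k) *: b k) <= Q * (K * (C * nm Y p)).
  by apply: MB => k; case: (tpn k).
have h2 : nm Y (\sum_(k < M) (tn k * a p k) *: b k) <= Q * (K * (C * nm Y p)).
  by apply: MB => k; case: (tpn k).
have -> : Q * (Q * (K * C) + Q * (K * C)) * nm Y p =
  Q * (Q * (K * (C * nm Y p)) + Q * (K * (C * nm Y p))) by ring.
move: (Q * (K * (C * nm Y p))) h1 h2 => T h1 h2.
by rewrite ler_pM2l // lerD.
Qed.

End BasisSums.

(** * Isomorphisms *)

Lemma isomorphic_sym (R : realType) (V W : lmodType R) (E : nspace V) (F : nspace W) :
  isomorphic E F -> isomorphic F E.
Proof. by case=> T [T' [h1 h2 h3 h4]]; exists T', T. Qed.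

Lemma unconditional_basis_isomorphic (R : realType) (V W : lmodType R) (Q Q' : R)
    (E : nspace V) (F : nspace W) :
  quasi_normed Q E -> quasi_normed Q' F -> isomorphic E F ->
  has_unconditional_basis E -> has_unconditional_basis F.
Proof.
move=> qE qF [T [T' [[c [c0 Tl Tb]] [c' [c'0 T'l T'b]] T'T TT']]] [b Hb].
have Eb n : E (b n) by exact: Hb.1.1.
have T0 : T 0 = 0.
  by have := Tl (-1) 0 0 (qn_0 qE) (qn_0 qE); rewrite scaler0 addr0 scaleN1r addNr.
have ET y : F y -> E (T' y) by move=> Fy; case: (T'b y Fy).
have FT x : E x -> F (T x) by move=> Ex; case: (Tb x Ex).
have squeeze (u v : nat -> R) d : 0 <= d -> (forall n, 0 <= v n) -> (forall n, v n <= d * u n) ->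
    u @ \oo --> (0 : R) -> v @ \oo --> (0 : R).
  move=> d0 v0 uv /cvg0P u0; apply/cvg0P => eps e0.
  have e1 : 0 < eps / (d + 1) by rewrite divr_gt0 //; lra.
  have [n0 H] := u0 _ e1; exists n0 => n /H h; rewrite ger0_norm //.
  apply: le_lt_trans (uv n) _.
  have h1 : d * u n <= d * (eps / (d + 1)).
    by rewrite ler_wpM2l //; apply: le_trans (ler_norm _) _; exact: ltW.
  apply: le_lt_trans h1 _; rewrite mulrA ltr_pdivrMr; last lra.
  by rewrite mulrC ltr_pM2l //; lra.
have expn (e : nat -> nat) (a : nat -> R) y : F y ->
    expansion F (T \o b \o e) y a <-> expansion E (b \o e) (T' y) a.
  move=> Fy.
  have Es n : E (\sum_(k < n) a k *: b (e k)) by apply: (qn_sum qE) => k _; exact: (qnZ qE).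
  have Ed n : E (\sum_(k < n) a k *: b (e k) - T' y) by apply: (qnB qE) => //; exact: ET.
  have TS n : T (\sum_(k < n) a k *: b (e k)) = \sum_(k < n) a k *: T (b (e k)).
    elim: n => [|n IH]; first by rewrite !big_ord0.
    rewrite !big_ord_recr /= [in LHS]addrC.
    by rewrite (Tl (a n) _ _ (Eb (e n)) (Es n)) IH addrC.
  have TD n : \sum_(k < n) a k *: T (b (e k)) - y = T (\sum_(k < n) a k *: b (e k) - T' y).
    have h := Tl (-1) (T' y) _ (ET y Fy) (Es n).
    by rewrite !scaleN1r in h; rewrite addrC [in RHS]addrC h TT' // TS.
  have T'D n : T' (\sum_(k < n) a k *: T (b (e k)) - y) = \sum_(k < n) a k *: b (e k) - T' y.
    by rewrite TD T'T.
  have Fd n : F (\sum_(k < n) a k *: T (b (e k)) - y) by rewrite TD; exact: FT.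
  split; rewrite /expansion => H.
    apply: (squeeze _ _ c' c'0 _ _ H) => n /=; first exact: (qn_ge0 qE (Ed n)).
    by have [_ h] := T'b _ (Fd n); rewrite T'D in h; exact: h.
  apply: (squeeze _ _ c c0 _ _ H) => n /=; first exact: (qn_ge0 qF (Fd n)).
  by rewrite TD; case: (Tb _ (Ed n)).
exists (T \o b); split.
  split; first by move=> n; exact: FT.
  move=> y Fy; have [a [h u]] := Hb.1.2 _ (ET y Fy).
  exists a; split; first exact: (proj2 (expn id a y Fy) h).
  by move=> a' h'; apply: u; exact: (proj1 (expn id a' y Fy) h').
move=> y a Fy h s bs; apply: (proj2 (expn s (a \o s) y Fy)).
by apply: Hb.2 bs; [exact: ET|exact: (proj1 (expn id a y Fy) h)].
Qed.

Section DirectSumBasis.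
Context {R : realType} {X : nspace (nat -> R : lmodType R)}.
Hypothesis HX : sequence_space X.
Let nX := seqsp_quasi HX.
Let seq2 := ((nat -> R) * (nat -> R) : lmodType R)%type.
Local Notation XX := (direct_sum X X).
Let qXX := direct_sum_quasi HX.

(* The unit vectors of the two summands, alternately. *)
Let b n : seq2 := if odd n then (0, @e_ R n./2) else (@e_ R n./2, 0).
Let co (p : seq2) n : R := if odd n then p.2 n./2 else p.1 n./2.

Lemma interleaved_sum (s s' : nat -> nat) (a : nat -> R) n :
  cancel s s' -> cancel s' s ->
  \sum_(k < n) a (s k) *: b (s k) =
  (restr (fun i => s' i.*2 < n)%N (fun i => a i.*2),
   restr (fun i => s' i.*2.+1 < n)%N (fun i => a i.*2.+1)) :> seq2.
Proof.
move=> ss' s's.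
have pick (h : nat -> R) j : \sum_(k < n) (if s k == j then h (s k) else 0) =
    if (s' j < n)%N then h j else 0.
  case: ltnP => sj.
    rewrite (bigD1 (Ordinal sj)) //= s's eqxx big1 ?addr0 // => k kj.
    case: eqP => // skj; case/eqP: kj; apply/val_inj => /=; by rewrite -skj ss'.
  rewrite big1 // => k _; case: eqP => // skj.
  by move: (ltn_ord k); rewrite -(ss' k) skj ltnNge sj.
rewrite pair_sumE; apply/pair_equal_spec; split; apply/funext => i; rewrite fct_sumE /restr.
  rewrite -pick; apply: eq_bigr => k _.
  rewrite [LHS](_ : _ = a (s k) * (b (s k)).1 i) // /b.
  have := odd_double_half (s k); case: (odd (s k)) => /= hk.
    rewrite mulr0; case: eqP => // sk; move: hk; rewrite sk; lia.
  rewrite /e_; case: (i =P (s k)./2) => ik.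
    have -> : s k = i.*2 by lia.
    by rewrite eqxx; exact: mulr1.
  by rewrite mulr0n mulr0; case: eqP => // sk; case: ik; lia.
rewrite -pick; apply: eq_bigr => k _.
rewrite [LHS](_ : _ = a (s k) * (b (s k)).2 i) // /b.
have := odd_double_half (s k); case: (odd (s k)) => /= hk.
  rewrite /e_; case: (i =P (s k)./2) => ik.
    have -> : s k = i.*2.+1 by lia.
    by rewrite eqxx; exact: mulr1.
  by rewrite mulr0n mulr0; case: eqP => // sk; case: ik; lia.
rewrite mulr0; case: eqP => // sk; move: hk; rewrite sk; lia.
Qed.

(** In whatever order, the far partial sums miss only parts of the tails of the
    two components, and these are small by solidity. *)
Lemma interleaved_expansion (s s' : nat -> nat) p : cancel s s' -> cancel s' s ->
  XX p -> expansion XX (b \o s) p (co p \o s).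
Proof.
move=> ss' s's [X1 X2]; apply/cvg0P => eps e0.
have e2 : 0 < eps / 3 by lra.
have [n1 H1] := X_tail HX X1 e2; have [n2 H2] := X_tail HX X2 e2.
exists (\sum_(k < n1) (s' k.*2).+1 + \sum_(k < n2) (s' k.*2.+1).+1)%N => n hn.
rewrite (interleaved_sum (co p) n ss' s's).
have tail (x : nat -> R) (B : pred nat) : restr B x - x = - restr (fun i => ~~ B i) x.
  by apply/funext => i; rewrite !fctE /restr; case: (B i); rewrite /= ?subrr ?oppr0 // sub0r.
have c1 : (fun i => co p i.*2) = p.1.
  by apply/funext => i; rewrite /co odd_double doubleK.
have c2 : (fun i => co p i.*2.+1) = p.2.
  by apply/funext => i; rewrite /co /= odd_double /= uphalf_double.
rewrite c1 c2.
rewrite ger0_norm; last first.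
  apply: (qn_ge0 qXX); split.
    exact: (qnB nX (X_restr HX _ X1).1 X1).
  exact: (qnB nX (X_restr HX _ X2).1 X2).
have -> : nm XX ((restr (fun i => s' i.*2 < n)%N p.1, restr (fun i => s' i.*2.+1 < n)%N p.2) - p) =
    nm X (restr (fun i => s' i.*2 < n)%N p.1 - p.1) + nm X (restr (fun i => s' i.*2.+1 < n)%N p.2
      - p.2) by [].
rewrite !tail !(qn_nmN nX); [|exact: (X_restr HX _ X2).1|exact: (X_restr HX _ X1).1].
have h1 : nm X (restr (fun i => ~~ (s' i.*2 < n)%N) p.1) <= eps / 3.
  apply: H1 => k; rewrite -leqNgt => h; rewrite leqNgt; apply/negP => kn.
  move: (leq_trans hn h); rewrite (bigD1 (Ordinal kn)) //= -addnA; lia.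
have h2 : nm X (restr (fun i => ~~ (s' i.*2.+1 < n)%N) p.2) <= eps / 3.
  apply: H2 => k; rewrite -leqNgt => h; rewrite leqNgt; apply/negP => kn.
  move: (leq_trans hn h); rewrite (bigD1 (Ordinal kn)) //=; lia.
lra.
Qed.

Lemma direct_sum_basis : has_unconditional_basis XX.
Proof.
exists b.
have XXb n : XX (b n).
  by rewrite /b; case: odd; split=> /=; [exact: (qn_0 nX)|exact: X_e|exact: X_e|exact: (qn_0 nX)].
have uniq_co p a : XX p -> expansion XX b p a -> a = co p.
  move=> Xp /cvg0P H; apply/funext => j; apply/eqP; rewrite -subr_eq0 -normr_le0.
  have ej := nm_e_gt0 HX j./2.
  rewrite -(pmulr_lle0 _ ej); apply: le_eps => eps e0; rewrite add0r.
  have [n0 Hn0] := H eps e0; pose n := maxn n0 j.+1.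
  have := Hn0 n (leq_maxl _ _).
  have jn : (j < n)%N by exact: leq_maxr.
  have Sn : \sum_(k < n) a k *: b k = (restr (fun i => i.*2 < n)%N (fun i => a i.*2),
      restr (fun i => i.*2.+1 < n)%N (fun i => a i.*2.+1)) :> seq2.
    exact: (interleaved_sum (s := id) (s' := id)).
  rewrite Sn; have XXs : XX (\sum_(k < n) a k *: b k).
    by apply: (qn_sum qXX) => k _; exact: (qnZ qXX).
  rewrite Sn in XXs; have := qnB qXX XXs Xp; set u := _ - p => XXu.
  rewrite ger0_norm; last exact: (qn_ge0 qXX).
  move=> /ltW; apply: le_trans.
  have [U1 U2] := XXu.
  have := odd_double_half j; case: (boolP (odd j)) => oj /= hj.
    have -> : a j - co p j = u.2 j./2.
      rewrite /co oj /u [RHS](_ : _ = restr (fun i => i.*2.+1 < n)%N (fun i => a i.*2.+1) j./2 -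
        p.2 j./2) //.
      have -> : a j = a j./2.*2.+1 by congr (a _); lia.
      by rewrite /restr (_ : j./2.*2.+1 < n)%N //; lia.
    by apply: le_trans (nm_coord HX j./2 U2) _; rewrite /= lerDr (qn_ge0 nX).
  have -> : a j - co p j = u.1 j./2.
    rewrite /co (negbTE oj) /u [RHS](_ : _ = restr (fun i => i.*2 < n)%N (fun i => a i.*2) j./2 -
      p.1 j./2) //.
    by rewrite /restr (_ : (j./2).*2 = j) ?jn //; rewrite -[RHS]hj.
  by apply: le_trans (nm_coord HX j./2 U1) _; rewrite /= lerDl (qn_ge0 nX).
split.
  split=> // p Xp; exists (co p); split.
    exact: (interleaved_expansion (s := id) (s' := id)).
  by move=> a Ha; rewrite (uniq_co p a).
move=> p a Xp Ha s [s' ss' s's]; rewrite (uniq_co p a Xp Ha).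
exact: (interleaved_expansion ss' s's).
Qed.

End DirectSumBasis.

Section Isomorphisms.
Context {R : realType} {X : nspace (nat -> R : lmodType R)}.
Hypothesis HX : sequence_space X.
Let nX := seqsp_quasi HX.
Context {Omega : (nat -> R) -> (nat -> R)} {D : R}.
Hypothesis HO : centralizer_le X Omega D.
Local Notation Y := (twisted_sum X Omega).
Let qY := tw_quasi HX HO.
Let seq2 := ((nat -> R) * (nat -> R) : lmodType R)%type.

(* Changes Omega by the multiplier b; it maps the graph of multiplication by b
   onto the first summand. *)
Let shear (b : nat -> R) (p : seq2) : seq2 := (p.1, p.2 - b \* p.1).

Lemma shear_linear b (S : set seq2) : linear_on S (shear b).
Proof.
move=> a [x y] [x' y'] _ _; apply/pair_equal_spec; split=> //.
by apply/funext => k; rewrite /= !fctE /=;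
  rewrite [LHS](_ : _ = a * y k + y' k - b k * (a * x k + x' k)) // [RHS](_ : _ = a * (y k - b k
    * x k) + (y' k - b k * x' k)) //; ring.
Qed.

Lemma shearK b p : shear (fun k => - b k) (shear b p) = p.
Proof.
case: p => x y; apply/pair_equal_spec; split=> //=.
by apply/funext => k; rewrite !fctE /=; ring.
Qed.

Lemma shearNK b p : shear b (shear (fun k => - b k) p) = p.
Proof.
case: p => x y; apply/pair_equal_spec; split=> //=.
by apply/funext => k; rewrite !fctE /=; ring.
Qed.

Lemma twisted_sum_shift b :
  isomorphic Y (twisted_sum X (fun x => Omega x - b \* x)).
Proof.
have e (x y : nat -> R) : y - b \* x - (Omega x - b \* x) = y - Omega x.
  by rewrite opprB addrA subrK.
have e' (x y : nat -> R) : y - (fun k => - b k) \* x - Omega x = y - (Omega x - b \* x).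
  by apply/funext => k; rewrite !fctE /=; ring.
exists (shear b), (shear (fun k => - b k)); split.
- exists 1; split=> //; first exact: shear_linear.
  by move=> [x y] [/= Xx Xy]; rewrite mul1r /= e.
- exists 1; split=> //; first exact: shear_linear.
  by move=> [x y] [/= Xx Xy]; rewrite mul1r /= e'.
- by move=> p _; exact: shearK.
- by move=> p _; exact: shearNK.
Qed.

Variables (b : nat -> R) (C : R).
Hypothesis C0 : 0 < C.
Hypothesis HC : forall x, X x ->
  X (Omega x - b \* x) /\ nm X (Omega x - b \* x) <= C * nm X x.

Lemma twisted_sum_split : isomorphic Y (direct_sum X X).
Proof.
exists (shear b), (shear (fun k => - b k)); split.
- have c0 := C0; exists (1 + C); split; [lra|exact: shear_linear|].
  move=> [x y] [/= Xx Xy]; have [Xo no] := HC Xx.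
  have -> : y - b \* x = (y - Omega x) + (Omega x - b \* x) by rewrite addrA subrK.
  split; first by split=> //=; exact: (qnD nX).
  have := X_triangle HX Xy Xo.
  have : 0 <= C * nm X (y - Omega x) by rewrite mulr_ge0 ?(qn_ge0 nX) // ltW.
  lra.
- have c0 := C0; exists (1 + C); split; [lra|exact: shear_linear|].
  move=> [x y] [/= Xx Xy]; have [Xo no] := HC Xx.
  have -> : y - (fun k => - b k) \* x - Omega x = y - (Omega x - b \* x).
    by apply/funext => k; rewrite !fctE /=; ring.
  split; first by split=> //=; exact: (qnB nX).
  have := X_triangleB HX Xy Xo.
  have : 0 <= C * nm X y by rewrite mulr_ge0 ?(qn_ge0 nX) // ltW.
  lra.
- by move=> p _; exact: shearK.
- by move=> p _; exact: shearNK.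
Qed.

Lemma fiber_complemented : complemented Y [set p : seq2 | p.1 = 0 /\ X p.2].
Proof.
have b0 : b \* (0 : nat -> R) = 0 by apply/funext => k /=; rewrite mulr0.
have XP x y : X x -> X (y - Omega x) -> X (y - b \* x) /\
    nm X (y - b \* x) <= nm X (y - Omega x) + C * nm X x.
  move=> Xx Xy; have [Xo no] := HC Xx.
  have -> : y - b \* x = (y - Omega x) + (Omega x - b \* x) by rewrite addrA subrK.
  by split; [exact: (qnD nX)|apply: le_trans (X_triangle HX Xy Xo) _; rewrite lerD2l].
exists (fun p => (0, p.2 - b \* p.1)); split.
- have c0 := C0; exists (1 + C); split; first lra.
    move=> a p p' Yp Yp'; have := shear_linear b a (S := carrier Y) Yp Yp'.
    move=> /(congr1 snd) /= h; apply/pair_equal_spec; split=> //=.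
    by apply/funext => k; rewrite [RHS](_ : _ = a * 0 + 0) // mulr0 addr0.
  move=> [x y] [/= Xx Xy]; have [X1 n1] := XP x y Xx Xy.
  have [h1 h2] := tw_fiber HX HO X1; split; first exact: h1.
  move: h2; rewrite /= => ->.
  have : 0 <= C * nm X (y - Omega x) by rewrite mulr_ge0 ?(qn_ge0 nX) // ltW.
  have := qn_ge0 nX Xx; lra.
- by move=> p _ /=; rewrite b0 subr0.
- apply/seteqP; split=> [_ [[x y] [/= Xx Xy] <-]|[x y] [/= -> Xy]].
    by split=> //=; case: (XP x y Xx Xy).
  exists (0, y); last by rewrite /= b0 subr0.
  by case: (tw_fiber HX HO Xy).
Qed.

End Isomorphisms.

(** * The theorem *)

(** Subtracting the multiplier formed by the diagonal entries of [Omega] changes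
    neither the isomorphism class of the twisted sum nor the centralizer
    constant, and makes the k-th entry of the image of e_k vanish. *)
Lemma bounded_perturbation_of_sums (R : realType) (X : nspace (nat -> R : lmodType R))
    (Omega : (nat -> R) -> (nat -> R)) (D : R)
    (HX : sequence_space X) (HXsr : super_reflexive X)
    (HO : centralizer_le X Omega D) :
  (forall b, let Omega' := fun x => Omega x - b \* x in
     (forall K, 1 <= K -> dyadic_convex (twisted_sum X Omega') K ->
      uniform_unconditional_sums (X := X) (Omega := Omega'))) ->
  exists (b : nat -> R) (C : R), 0 < C /\ forall x, X x ->
    X (Omega x - b \* x) /\ nm X (Omega x - b \* x) <= C * nm X x.
Proof.
move=> H; pose b k := Omega (@e_ R k) k.
pose Omega' x := Omega x - b \* x.
have HO' : centralizer_le X Omega' D := cz_shift HO b.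
have [K K1 HK] := tw_convex HX HO' HXsr.
have Oe k : Omega' (@e_ R k) k = 0.
  by rewrite /Omega' !fctE /= /b /e_ eqxx mulr1 subrr.
have [C HC] := bounded_of_unconditional_sums HX HO' K1 HK Oe (H b K K1 HK).
exists b, (`|C| + 1); split; first by rewrite ltr_wpDl.
move=> x Xx; have [h1 h2] := HC x Xx; split=> //; apply: le_trans h2 _.
apply: ler_wpM2r; first exact: (qn_ge0 (seqsp_quasi HX)).
by apply: le_trans (ler_norm _) _; rewrite lerDl.
Qed.

Theorem theorem3p9 (R : realType) (X : nspace (nat -> R : lmodType R))
    (Omega : (nat -> R) -> (nat -> R))
    (HX : sequence_space X) (HXsr : super_reflexive X)
    (HOmega : centralizer X Omega) :
  let Y := twisted_sum X Omega in
  let X0 := [set p : (nat -> R) * (nat -> R) | p.1 = 0 /\ X p.2] in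
  [<-> isomorphic Y (direct_sum X X) ;
       local_unconditional_structure Y ;
       has_unconditional_basis Y ;
       complemented Y X0 ;
       exists (b : nat -> R) (C : R), 0 < C /\
         forall x, X x ->
           X (Omega x - b \* x) /\ nm X (Omega x - b \* x) <= C * nm X x ].
Proof.
move=> Y X0; have [D HO] := centralizerP HX HOmega.
have qY := tw_quasi HX HO; have qXX := direct_sum_quasi HX.
have shift b := twisted_sum_shift (X := X) (Omega := Omega) b.
have qY' b := tw_quasi HX (cz_shift HO b).
have from_lust : local_unconditional_structure Y -> exists (b : nat -> R) (C : R), 0 < C /\
    forall x, X x -> X (Omega x - b \* x) /\ nm X (Omega x - b \* x) <= C * nm X x.
  move=> lY; apply: (bounded_perturbation_of_sums HX HXsr HO) => b /= K K1 HK.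
  apply: (unconditional_sums_of_lust HX (cz_shift HO b)).
  exact: (lust_isomorphic (qY' b) qY (isomorphic_sym (shift b))).
have from_basis : has_unconditional_basis Y -> exists (b : nat -> R) (C : R), 0 < C /\
    forall x, X x -> X (Omega x - b \* x) /\ nm X (Omega x - b \* x) <= C * nm X x.
  move=> bY; apply: (bounded_perturbation_of_sums HX HXsr HO) => b /= K K1 HK.
  apply: (unconditional_sums_of_basis HX (cz_shift HO b) HK K1).
  exact: (unconditional_basis_isomorphic qY (qY' b) (shift b)).
tfae.
- move=> iso; apply: (lust_isomorphic qY qXX iso); exact: direct_sum_lust.
- move=> /from_lust[b [C [C0 HC]]].
  apply: (unconditional_basis_isomorphic qXX qY _ (direct_sum_basis HX)).
  exact/isomorphic_sym/(twisted_sum_split HX C0 HC).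
- by move=> /from_basis[b [C [C0 HC]]]; exact: (fiber_complemented HX HO C0 HC).
- move=> /(bounded_of_complemented HX HO)[b [C HC]].
  exists b, (`|C| + 1); split; first by rewrite ltr_wpDl.
  move=> x Xx; have [h1 h2] := HC x Xx; split=> //; apply: le_trans h2 _.
  apply: ler_wpM2r; first exact: (qn_ge0 (seqsp_quasi HX)).
  by apply: le_trans (ler_norm _) _; rewrite lerDl.
- by move=> [b [C [C0 HC]]]; exact: (twisted_sum_split HX C0 HC).
Qed.
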